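(* Let $(\varphi,\rho):(\mathfrak{C}:A)\to(\mathfrak{D}:B)$ be a homomorphism of corings such that ${}_A\mathfrak{C}$ and ${}_B\mathfrak{D}$ are flat. The following statements are equivalent: (a) the induction functor $-\otimes_AB:\mathcal{M}^{\mathfrak{C}}\to\mathcal{M}^{\mathfrak{D}}$ is a Frobenius functor; (b) the $(\mathfrak{C},\mathfrak{D})$-bicomodule $\mathfrak{C}\otimes_AB$ is quasi-finite and injector as a right $\mathfrak{D}$-comodule, and there exists an isomorphism of $(\mathfrak{D},\mathfrak{C})$-bicomodules $\mathrm{h}_{\mathfrak{D}}(\mathfrak{C}\otimes_AB,\mathfrak{D})\simeq B\otimes_A\mathfrak{C}$. Moreover, if $\mathfrak{C}$ and $\mathfrak{D}$ are coseparable, then the condition ''injector'' in (b) can be deleted.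
   Context: $k$ is a commutative ring, $A,B$ are associative unital $k$-algebras, $\mathfrak C$ is an $A$-coring and $\mathfrak D$ a $B$-coring. An $A$-coring is an $A$-bimodule $\mathfrak{C}$ with $A$-bimodule maps $\Delta_{\mathfrak C}:\mathfrak{C}\to\mathfrak{C}\otimes_A\mathfrak{C}$ (coassociative) and $\epsilon_{\mathfrak C}:\mathfrak{C}\to A$ (counit); write $\Delta(c)=\sum c_{(1)}\otimes c_{(2)}$. A right $\mathfrak{C}$-comodule is a right $A$-module $M$ with a coassociative, counital right $A$-linear coaction $\rho_M:M\to M\otimes_A\mathfrak{C}$, $m\mapsto\sum m_{(0)}\otimes m_{(1)}$; category $\mathcal{M}^{\mathfrak{C}}$. A $(\mathfrak{C},\mathfrak{D})$-bicomodule is an $(A,B)$-bimodule that is a left $\mathfrak{C}$-comodule with $B$-linear coaction $\lambda$ and a right $\mathfrak{D}$-comodule with $A$-linear coaction $\rho$, with $(\lambda\otimes_B\mathfrak{D})\rho=(\mathfrak{C}\otimes_A\rho)\lambda$. Homomorphism of corings $(\varphi,\rho)$: $\rho:A\to B$ is a $k$-algebra map and $\varphi:\mathfrak C\to\mathfrak D$ an $A$-bimodule map with $\Delta_{\mathfrak D}\varphi=\omega(\varphi\otimes_A\varphi)\Delta_{\mathfrak C}$ and $\epsilon_{\mathfrak D}\varphi=\rho\,\epsilon_{\mathfrak C}$, where $\omega:\mathfrak D\otimes_A\mathfrak D\to\mathfrak D\otimes_B\mathfrak D$ is canonical. The induction functor sends $M\in\mathcal M^{\mathfrak C}$ to $M\otimes_AB$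 with coaction $m\otimes_Ab\mapsto\sum m_{(0)}\otimes_A1_B\otimes_B\varphi(m_{(1)})b$. The bicomodule $\mathfrak C\otimes_AB$ has left coaction $\Delta_{\mathfrak C}\otimes_AB$ and right coaction given by this formula; the $(\mathfrak D,\mathfrak C)$-bicomodule $B\otimes_A\mathfrak C$ has left coaction $b\otimes c\mapsto\sum b\varphi(c_{(1)})\otimes_Ac_{(2)}\in\mathfrak D\otimes_A\mathfrak C\simeq\mathfrak D\otimes_B(B\otimes_A\mathfrak C)$ and right coaction $B\otimes_A\Delta_{\mathfrak C}$. A functor is Frobenius if it has a functor that is both a left and a right adjoint to it. A coring $\mathfrak C$ is coseparable if $\Delta_{\mathfrak C}$ is a split monomorphism of $\mathfrak C$-bicomodules. $N\in{}^{\mathfrak C}\mathcal M^{\mathfrak D}$ is quasi-finite as a right $\mathfrak D$-comodule if $-\otimes_AN:\mathcal M_A\to\mathcal M^{\mathfrak D}$ has a left adjoint $\mathrm h_{\mathfrak D}(N,-)$, with unit $\theta_Y:Y\to \mathrm h_{\mathfrak D}(N,Y)\otimes_AN$. It is injector as a right $\mathfrak D$-comodule if $-\otimes_AN$ preserves injective objects. $\mathrm h_{\mathfrak D}(N,Y)$ is a right $\mathfrak C$-comodule via the unique right $A$-linear $\rho$ with $(\rho\otimes_AN)\theta_Y=(\mathrm h_{\mathfrak D}(N,Y)\otimes_A\lambda_N)\theta_Y$; and $\mathrm h_{\mathfrak D}(N,\mathfrak D)$ is a $(\mathfrak D,\mathfrak C)$-bicomodule with left $B$-action by functoriality and left coaction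 $\mathrm h_{\mathfrak D}(N,\Delta_{\mathfrak D}):\mathrm h_{\mathfrak D}(N,\mathfrak D)\to\mathrm h_{\mathfrak D}(N,\mathfrak D\otimes_B\mathfrak D)\simeq\mathfrak D\otimes_B\mathrm h_{\mathfrak D}(N,\mathfrak D)$ (canonical, since $\mathrm h_{\mathfrak D}(N,-)$ preserves inductive limits). *)

(* Defs.v *)
From HB Require Import structures.
From mathcomp Require Import all_boot all_algebra.
From mathcomp Require Import boolp.

Set Implicit Arguments.
Unset Strict Implicit.
Unset Printing Implicit Defensive.
Import GRing.Theory.
Local Open Scope ring_scope.
Local Open Scope quotient_scope.

(* A k-algebra is a ring with a central structure morphism; unlike algType,
   this does not exclude the zero ring. *)
Record algebra (k : comPzRingType) := Algebra {
  alg_ring :> pzRingType;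
  alg_str : {rmorphism k -> alg_ring};
  alg_central : forall l a, alg_str l * a = a * alg_str l }.

Record alg_hom (k : comPzRingType) (A B : algebra k) := AlgHom {
  alg_fun :> {rmorphism A -> B};
  alg_homZ : forall l, alg_fun (alg_str A l) = alg_str B l }.

Definition base_alg (k : comPzRingType) : algebra k :=
  @Algebra k k idfun (@mulrC k).

Definition alg_hom_id (k : comPzRingType) (A : algebra k) : alg_hom A A :=
  @AlgHom k A A idfun (fun=> erefl).

Definition alg_hom_str (k : comPzRingType) (A : algebra k) :
  alg_hom (base_alg k) A :=
  @AlgHom k (base_alg k) A (alg_str A) (fun=> erefl).

(* Bimodules are k-symmetric.  One-sided modules are the bimodules whose other
   side is [base_alg k]: by [bm_sym] the k-action is then determined by the
   other one, and a morphism of bimodules is exactly a one-sided linear map. *)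
Record bimod (k : comPzRingType) (A B : algebra k) := Bimod {
  bm_sort :> zmodType;
  lact : A -> bm_sort -> bm_sort;
  ract : bm_sort -> B -> bm_sort;
  lactDl : forall a a' m, lact (a + a') m = lact a m + lact a' m;
  lactDr : forall a m m', lact a (m + m') = lact a m + lact a m';
  lactA : forall a a' m, lact (a * a') m = lact a (lact a' m);
  lact1 : forall m, lact 1 m = m;
  ractDl : forall m m' b, ract (m + m') b = ract m b + ract m' b;
  ractDr : forall m b b', ract m (b + b') = ract m b + ract m b';
  ractA : forall m b b', ract m (b * b') = ract (ract m b) b';
  ract1 : forall m, ract m 1 = m;
  lractA : forall a m b, ract (lact a m) b = lact a (ract m b);
  bm_sym : forall l m, lact (alg_str A l) m = ract m (alg_str B l) }.

Notation rmod A := (bimod (base_alg _) A).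

Notation "a *< m" := (lact a m) (at level 40, left associativity).
Notation "m >* b" := (ract m b) (at level 40, left associativity).

Definition bimod_morph (k : comPzRingType) (A B : algebra k)
    (M N : bimod A B) (f : M -> N) :=
  [/\ {morph f : x y / x + y},
      forall a m, f (a *< m) = a *< f m
    & forall m b, f (m >* b) = f m >* b].

Record bimap (k : comPzRingType) (A B : algebra k) (M N : bimod A B) := Bimap {
  bm_fun :> M -> N;
  bm_funP : bimod_morph bm_fun }.

Lemma morphD0 (U V : zmodType) (f : U -> V) :
  {morph f : x y / x + y} -> f 0 = 0.
Proof. by move=> fD; apply: (addrI (f 0)); rewrite -fD !addr0. Qed.

Section BimodTheory.
Variables (k : comPzRingType) (A B : algebra k).
Implicit Types M N P : bimod A B.

Lemma bmD M N (f : bimap M N) : {morph f : x y / x + y}.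
Proof. by case: f => f []. Qed.

Lemma bmZl M N (f : bimap M N) a m : f (a *< m) = a *< f m.
Proof. by case: f => f []. Qed.

Lemma bmZr M N (f : bimap M N) m b : f (m >* b) = f m >* b.
Proof. by case: f => f []. Qed.

Lemma bm0 M N (f : bimap M N) : f 0 = 0.
Proof. exact: (morphD0 (@bmD _ _ f)). Qed.

Lemma lact0 M (a : A) : a *< (0 : M) = 0.
Proof. exact: (morphD0 (lactDr a)). Qed.

Lemma ract0 M (b : B) : (0 : M) >* b = 0.
Proof. by apply: (morphD0 (f := fun m : M => m >* b)) => x y; rewrite ractDl. Qed.

Lemma bimap_eq M N (f g : bimap M N) : f =1 g -> f = g.
Proof.
case: f g => [f fP] [g gP] /= /funext efg; subst g.
by congr Bimap; exact: Prop_irrelevance.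
Qed.

Lemma bm_id_subproof M : bimod_morph (@id M).
Proof. by split. Qed.

Definition bm_id M : bimap M M := Bimap (@bm_id_subproof M).

Lemma bm_comp_subproof M N P (g : bimap N P) (f : bimap M N) :
  bimod_morph (fun x => g (f x)).
Proof. by split=> [x y|a x|x b]; rewrite ?bmD ?bmZl ?bmZr. Qed.

Definition bm_comp M N P (g : bimap N P) (f : bimap M N) : bimap M P :=
  Bimap (bm_comp_subproof g f).

Lemma bm_compE M N P (g : bimap N P) (f : bimap M N) x :
  bm_comp g f x = g (f x).
Proof. by []. Qed.

End BimodTheory.

Section Restriction.
Variables (k : comPzRingType) (A A' B B' : algebra k).
Variables (f : alg_hom A' A) (g : alg_hom B' B).

Lemma res_subproof (M : bimod A B) :
  (forall l (m : M), f (alg_str A' l) *< m = m >* g (alg_str B' l)).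
Proof. by move=> l m; rewrite !alg_homZ bm_sym. Qed.

Definition res (M : bimod A B) : bimod A' B'.
Proof.
refine (@Bimod k A' B' M (fun a m => f a *< m) (fun m b => m >* g b)
   _ _ _ _ _ _ _ _ _ (@res_subproof M)) => *;
 by rewrite ?rmorphD ?rmorphM ?rmorph1 ?(lactDl, lactDr, lactA, lact1,
   ractDl, ractDr, ractA, ract1, lractA).
Defined.

Lemma res_map_subproof (M N : bimod A B) (u : bimap M N) :
  @bimod_morph k A' B' (res M) (res N) u.
Proof. by split=> [x y|a x|x b]; rewrite ?bmD ?bmZl ?bmZr. Qed.

Definition res_map (M N : bimod A B) (u : bimap M N) : bimap (res M) (res N) :=
  Bimap (res_map_subproof u).

End Restriction.

Definition reg (k : comPzRingType) (A : algebra k) : bimod A A.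
Proof.
refine (@Bimod k A A A *%R *%R _ _ _ _ _ _ _ _ _ (@alg_central k A)) => *;
 by rewrite ?(mulrDl, mulrDr, mulrA, mul1r, mulr1).
Defined.

Definition forgetl (k : comPzRingType) (A B : algebra k) (M : bimod A B) :
  rmod B := res (alg_hom_str A) (alg_hom_id B) M.

(* The carrier of the tensor product only mentions the actions of the algebra
   in the middle, so that it is unchanged (up to conversion) when the outer
   algebras are. *)
Section TensorType.
Variables (A : Type) (M N : zmodType) (ra : M -> A -> M) (la : A -> N -> N).

Inductive tens_rel : seq (M * N) -> seq (M * N) -> Prop :=
| tens_refl s : tens_rel s s
| tens_sym s t : tens_rel s t -> tens_rel t s
| tens_trans s t u : tens_rel s t -> tens_rel t u -> tens_rel s u
| tens_cat s s' t t' :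
    tens_rel s s' -> tens_rel t t' -> tens_rel (s ++ t) (s' ++ t')
| tens_comm s t : tens_rel (s ++ t) (t ++ s)
| tens_zero n : tens_rel [:: (0, n)] [::]
| tens_addl m m' n : tens_rel [:: (m + m', n)] [:: (m, n); (m', n)]
| tens_addr m n n' : tens_rel [:: (m, n + n')] [:: (m, n); (m, n')]
| tens_bal m a n : tens_rel [:: (ra m a, n)] [:: (m, la a n)].

Definition tens_relb : rel (seq (M * N)) := fun s t => `[< tens_rel s t >].

Lemma tens_relb_refl : reflexive tens_relb.
Proof. by move=> s; apply/asboolP; exact: tens_refl. Qed.

Lemma tens_relb_sym : symmetric tens_relb.
Proof. by move=> s t; apply/idP/idP => /asboolP h; apply/asboolP; exact: tens_sym. Qed.

Lemma tens_relb_trans : transitive tens_relb.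
Proof.
by move=> s t u /asboolP h /asboolP h'; apply/asboolP; exact: tens_trans h h'.
Qed.

Canonical tens_equiv :=
  EquivRel tens_relb tens_relb_refl tens_relb_sym tens_relb_trans.

Definition tens := {eq_quot tens_relb}%qT.
HB.instance Definition _ := Choice.on tens.
HB.instance Definition _ := EqQuotient.on tens.

Lemma tens_eqP s t : tens_rel s t <-> \pi_tens s = \pi_tens t.
Proof. by split=> [h|/eqquotP/asboolP //]; apply/eqquotP/asboolP. Qed.

Definition tens0 : tens := \pi_tens [::].
Definition tens_add (x y : tens) : tens := \pi_tens (repr x ++ repr y).
Definition tens_opp (x : tens) : tens :=
  \pi_tens [seq (- p.1, p.2) | p <- repr x].

Lemma tens_addE s t : tens_add (\pi_tens s) (\pi_tens t) = \pi_tens (s ++ t).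
Proof.
by apply/tens_eqP/tens_cat; apply/tens_eqP; rewrite reprK.
Qed.

Lemma tens_cancel s : tens_rel ([seq (- p.1, p.2) | p <- s] ++ s) [::].
Proof.
elim: s => [|[m n] s IH] /=; first exact: tens_refl.
apply: (@tens_trans _ ([:: (- m, n); (m, n)] ++
   ([seq (- p.1, p.2) | p <- s] ++ s))).
  rewrite -cat1s -[X in X ++ _]cat1s -[X in tens_rel _ (X ++ _)]cat1s -!catA.
  apply: tens_cat; first exact: tens_refl.
  by rewrite -[(m, n) :: s]cat1s !catA; apply: tens_cat;
    [exact: tens_comm | exact: tens_refl].
rewrite -[[::]]cats0; apply: tens_cat IH.
by apply: tens_trans (tens_sym (tens_addl _ _ _)) _; rewrite addNr; exact: tens_zero.
Qed.

Lemma tens_addA : associative tens_add.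
Proof.
elim/quotW=> s; elim/quotW=> t; elim/quotW=> u. by rewrite (tens_addE t u) (tens_addE s t) !tens_addE catA.
Qed.

Lemma tens_addC : commutative tens_add.
Proof.
by elim/quotW=> s; elim/quotW=> t; rewrite !tens_addE; apply/tens_eqP/tens_comm.
Qed.

Lemma tens_add0 : left_id tens0 tens_add.
Proof. by elim/quotW=> s; rewrite tens_addE. Qed.

Lemma tens_addN : left_inverse tens0 tens_opp tens_add.
Proof.
by move=> x; rewrite -{2}[x]reprK tens_addE; apply/tens_eqP/tens_cancel.
Qed.

HB.instance Definition _ :=
  GRing.isZmodule.Build tens tens_addA tens_addC tens_add0 tens_addN.

Definition tpure (m : M) (n : N) : tens := \pi_tens [:: (m, n)].

Lemma tpureDl m m' n : tpure (m + m') n = tpure m n + tpure m' n.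
Proof. by rewrite [RHS]tens_addE; apply/tens_eqP/tens_addl. Qed.

Lemma tpureDr m n n' : tpure m (n + n') = tpure m n + tpure m n'.
Proof. by rewrite [RHS]tens_addE; apply/tens_eqP/tens_addr. Qed.

Lemma tpure_bal m a n : tpure (ra m a) n = tpure m (la a n).
Proof. exact/tens_eqP/tens_bal. Qed.

Lemma tens_ind (P : tens -> Prop) :
  P 0 -> (forall x y, P x -> P y -> P (x + y)) -> (forall m n, P (tpure m n)) ->
  forall t, P t.
Proof.
move=> P0 PD Pp; elim/quotW; elim=> [|[m n] s IH]; first exact: P0.
have -> : \pi_tens ((m, n) :: s) = tpure m n + \pi_tens s.
  by rewrite [RHS]tens_addE.
exact: PD.
Qed.

Definition balanced (Z : zmodType) (f : M -> N -> Z) :=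
  [/\ forall m m' n, f (m + m') n = f m n + f m' n,
      forall m n n', f m (n + n') = f m n + f m n'
    & forall m a n, f (ra m a) n = f m (la a n)].

Definition tlift (Z : zmodType) (f : M -> N -> Z) (t : tens) : Z :=
  \sum_(p <- repr t) f p.1 p.2.

Section Lift.
Variables (Z : zmodType) (f : M -> N -> Z).
Hypothesis fP : balanced f.

Lemma tlift_rel s t : tens_rel s t ->
  \sum_(p <- s) f p.1 p.2 = \sum_(p <- t) f p.1 p.2.
Proof.
case: fP => fDl fDr fb.
elim=> {s t} [s|s t _ ->|s t u _ -> _ ->|s s' t t' _ IH _ IH'|s t|n|m m' n|m n n'|m a n] //;
  rewrite ?big_cat ?big_cons ?big_nil /= ?addr0 //.
- by congr (_ + _).
- by rewrite addrC.
- by apply: (morphD0 (f := fun m => f m n)) => x y; rewrite fDl.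
Qed.

Lemma tlift_pi s : tlift f (\pi_tens s) = \sum_(p <- s) f p.1 p.2.
Proof. by apply/tlift_rel/tens_eqP; rewrite reprK. Qed.

Lemma tliftD : {morph tlift f : x y / x + y}.
Proof.
by elim/quotW=> s; elim/quotW=> t; rewrite [X in tlift f X]tens_addE !tlift_pi big_cat.
Qed.

Lemma tlift0 : tlift f 0 = 0.
Proof. exact: morphD0 tliftD. Qed.

Lemma tliftE m n : tlift f (tpure m n) = f m n.
Proof. by rewrite tlift_pi big_seq1. Qed.

End Lift.
End TensorType.

Arguments tpure {A M N ra la} m n.

Section Tensor.
Variables (k : comPzRingType) (R A S : algebra k).
Variables (M : bimod R A) (N : bimod A S).

Definition tens_mod := @tens A M N (@ract _ _ _ M) (@lact _ _ _ N).

Definition tens_lact (r : R) (t : tens_mod) : tens_mod :=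
  tlift (fun m n => tpure (r *< m) n) t.
Definition tens_ract (t : tens_mod) (s : S) : tens_mod :=
  tlift (fun m n => tpure m (n >* s)) t.

Lemma tens_lact_bal r : balanced (@ract _ _ _ M) (@lact _ _ _ N)
  (fun m n => tpure (r *< m) n : tens_mod).
Proof.
split=> [m m' n|m n n'|m a n].
- by rewrite lactDr tpureDl.
- by rewrite tpureDr.
- by rewrite -lractA tpure_bal.
Qed.

Lemma tens_ract_bal s : balanced (@ract _ _ _ M) (@lact _ _ _ N)
  (fun m n => tpure m (n >* s) : tens_mod).
Proof.
split=> [m m' n|m n n'|m a n].
- by rewrite tpureDl.
- by rewrite ractDl tpureDr.
- by rewrite lractA tpure_bal.
Qed.

Lemma tens_lactE r m n : tens_lact r (tpure m n) = tpure (r *< m) n.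
Proof. exact: tliftE (tens_lact_bal r) m n. Qed.
Lemma tens_ractE m n s : tens_ract (tpure m n) s = tpure m (n >* s).
Proof. exact: tliftE (tens_ract_bal s) m n. Qed.
Lemma tens_lactD r : {morph tens_lact r : x y / x + y}.
Proof. exact: tliftD (tens_lact_bal r). Qed.
Lemma tens_ractD s : {morph tens_ract^~ s : x y / x + y}.
Proof. exact: tliftD (tens_ract_bal s). Qed.

Lemma tens_ext (Z : zmodType) (f g : tens_mod -> Z) :
  {morph f : x y / x + y} -> {morph g : x y / x + y} ->
  (forall m n, f (tpure m n) = g (tpure m n)) -> f =1 g.
Proof.
move=> fD gD fg; elim/tens_ind => [|x y ex ey|//].
  by rewrite (morphD0 fD) (morphD0 gD).
by rewrite fD gD ex ey.
Qed.

Definition tensor : bimod R S.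
Proof.
refine (@Bimod k R S tens_mod tens_lact tens_ract _ _ _ _ _ _ _ _ _ _).
- move=> r r'; apply: tens_ext => [|x y|m n]; first exact: tens_lactD.
    by rewrite !tens_lactD addrACA.
  by rewrite !tens_lactE lactDl tpureDl.
- exact: tens_lactD.
- move=> r r'; apply: tens_ext => [|x y|m n]; first exact: tens_lactD.
    by rewrite !tens_lactD.
  by rewrite !tens_lactE lactA.
- apply: tens_ext => [|//|m n]; first exact: tens_lactD.
  by rewrite !tens_lactE lact1.
- by move=> x y s; exact: tens_ractD.
- move=> t s s'; move: t; apply: tens_ext => [|x y|m n]; first exact: tens_ractD.
    by rewrite !tens_ractD addrACA.
  by rewrite !tens_ractE ractDr tpureDr.
- move=> t s s'; move: t; apply: tens_ext => [|x y|m n]; first exact: tens_ractD.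
    by rewrite !tens_ractD.
  by rewrite !tens_ractE ractA.
- apply: tens_ext => [|//|m n]; first exact: tens_ractD.
  by rewrite !tens_ractE ract1.
- move=> r t s; move: t; apply: tens_ext => [x y|x y|m n].
  + by rewrite tens_lactD tens_ractD.
  + by rewrite tens_ractD tens_lactD.
  + by rewrite tens_lactE !tens_ractE tens_lactE.
- move=> l; apply: tens_ext => [||m n]; [exact: tens_lactD|exact: tens_ractD|].
  by rewrite tens_lactE tens_ractE bm_sym tpure_bal bm_sym.
Defined.

Definition ot (m : M) (n : N) : tensor := tpure m n.

Lemma otDl m m' n : ot (m + m') n = ot m n + ot m' n.
Proof. exact: tpureDl. Qed.
Lemma otDr m n n' : ot m (n + n') = ot m n + ot m n'.
Proof. exact: tpureDr. Qed.
Lemma ot_bal m a n : ot (m >* a) n = ot m (a *< n).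
Proof. exact: tpure_bal. Qed.
Lemma ot0l n : ot 0 n = 0.
Proof. by apply: (morphD0 (f := ot^~ n)) => x y; exact: otDl. Qed.
Lemma ot0r m : ot m 0 = 0.
Proof. by apply: (morphD0 (f := ot m)) => x y; exact: otDr. Qed.
Lemma otZl r m n : r *< ot m n = ot (r *< m) n.
Proof. exact: tens_lactE. Qed.
Lemma otZr m n s : ot m n >* s = ot m (n >* s).
Proof. exact: tens_ractE. Qed.

Lemma ot_ind (P : tensor -> Prop) :
  P 0 -> (forall x y, P x -> P y -> P (x + y)) -> (forall m n, P (ot m n)) ->
  forall t, P t.
Proof. exact: tens_ind. Qed.

Section Lift.
Variables (P : bimod R S) (f : M -> N -> P).

Definition bilin :=
  [/\ balanced (@ract _ _ _ M) (@lact _ _ _ N) f,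
      forall r m n, f (r *< m) n = r *< f m n
    & forall m n s, f m (n >* s) = f m n >* s].

Lemma blift_subproof : bilin -> @bimod_morph _ _ _ tensor P (tlift f).
Proof.
case=> fb fl fr; split=> [|r|t s]; first exact: tliftD fb.
- apply: tens_ext => [x y|x y|m n].
  + by rewrite (@lactDr _ _ _ tensor) (tliftD fb).
  + by rewrite (tliftD fb) lactDr.
  + by rewrite [r *< _]tens_lactE !(tliftE fb).
- move: t; apply: tens_ext => [x y|x y|m n].
  + by rewrite (@ractDl _ _ _ tensor) (tliftD fb).
  + by rewrite (tliftD fb) ractDl.
  + by rewrite [_ >* s]tens_ractE !(tliftE fb).
Qed.

Definition blift (h : bilin) : bimap tensor P := Bimap (blift_subproof h).

Lemma bliftE h m n : blift h (ot m n) = f m n.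
Proof. by have [fb _ _] := h; rewrite /= (tliftE fb). Qed.
End Lift.

Lemma bm_ext (P : bimod R S) (f g : bimap tensor P) :
  (forall m n, f (ot m n) = g (ot m n)) -> f = g.
Proof. 
by move=> fg; apply/bimap_eq/tens_ext=> //; exact: (@bmD _ _ _ tensor P). Qed.

End Tensor.

Notation "m \ot n" := (ot m n) (at level 39, left associativity).

Definition addE := (bmD, bm0, otDl, otDr, ot0l, ot0r, lactDr, lact0, ractDl,
  ract0, add0r).

Section TensorMaps.
Variables (k : comPzRingType).

Section Tmap.
Variables (R A S : algebra k) (M M' : bimod R A) (N N' : bimod A S).
Variables (f : bimap M M') (g : bimap N N').

Lemma tmap_subproof : bilin (fun (m : M) (n : N) => f m \ot g n).
Proof.
split; first split.
- by move=> *; rewrite !addE.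
- by move=> *; rewrite !addE.
- by move=> *; rewrite bmZr bmZl ot_bal.
- by move=> *; rewrite bmZl otZl.
- by move=> *; rewrite bmZr otZr.
Qed.

Definition tmap : bimap (tensor M N) (tensor M' N') := blift tmap_subproof.

Lemma tmapE m n : tmap (m \ot n) = f m \ot g n.
Proof. exact: bliftE. Qed.
End Tmap.

Section Assoc.
Variables (R A B S : algebra k).
Variables (M : bimod R A) (N : bimod A B) (P : bimod B S).

Lemma assoc1_subproof (p : P) : balanced (@ract _ _ _ M) (@lact _ _ _ N)
  (fun m n => m \ot (n \ot p)).
Proof.
split=> *; first by rewrite !addE.
  by rewrite !addE.
by rewrite ot_bal otZl.
Qed.

Definition assoc1 (t : tensor M N) (p : P) : tensor M (tensor N P) :=
  tlift (fun m n => m \ot (n \ot p)) t.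

Lemma assoc1E m n p : assoc1 (m \ot n) p = m \ot (n \ot p).
Proof. exact: tliftE (assoc1_subproof p) m n. Qed.

Lemma assoc1D p : {morph assoc1^~ p : x y / x + y}.
Proof. exact: tliftD (assoc1_subproof p). Qed.

Lemma assoc10 p : assoc1 0 p = 0.
Proof. exact: morphD0 (assoc1D p). Qed.

Lemma assoc_subproof : bilin assoc1.
Proof.
split; first split.
- by move=> x y p; exact: assoc1D.
- move=> t p p'; elim/ot_ind: t => [|x y ex ey|m n].
  + by rewrite !assoc10 addr0.
  + by rewrite !assoc1D ex ey addrACA.
  + by rewrite !assoc1E !addE.
- move=> t b p; elim/ot_ind: t => [|x y ex ey|m n].
  + by rewrite ract0 !assoc10.
  + by rewrite ractDl !assoc1D ex ey.
  + by rewrite otZr !assoc1E ot_bal.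
- move=> r t p; elim/ot_ind: t => [|x y ex ey|m n].
  + by rewrite lact0 !assoc10 lact0.
  + by rewrite lactDr !assoc1D ex ey lactDr.
  + by rewrite otZl !assoc1E otZl.
- move=> t p s; elim/ot_ind: t => [|x y ex ey|m n].
  + by rewrite !assoc10 ract0.
  + by rewrite !assoc1D ex ey ractDl.
  + by rewrite !assoc1E !otZr.
Qed.

Definition assoc : bimap (tensor (tensor M N) P) (tensor M (tensor N P)) :=
  blift assoc_subproof.

Lemma assocE m n p : assoc (m \ot n \ot p) = m \ot (n \ot p).
Proof. by rewrite bliftE assoc1E. Qed.

Lemma associ1_subproof (m : M) : balanced (@ract _ _ _ N) (@lact _ _ _ P)
  (fun n p => m \ot n \ot p).
Proof.
split=> *; first by rewrite !addE.
  by rewrite !addE.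
by rewrite -ot_bal otZr.
Qed.

Definition associ1 (m : M) (t : tensor N P) : tensor (tensor M N) P :=
  tlift (fun n p => m \ot n \ot p) t.

Lemma associ1E m n p : associ1 m (n \ot p) = m \ot n \ot p.
Proof. exact: tliftE (associ1_subproof m) n p. Qed.

Lemma associ1D m : {morph associ1 m : x y / x + y}.
Proof. exact: tliftD (associ1_subproof m). Qed.

Lemma associ10 m : associ1 m 0 = 0.
Proof. exact: morphD0 (associ1D m). Qed.

Lemma associ_subproof : bilin associ1.
Proof.
split; first split.
- move=> m m' t; elim/ot_ind: t => [|x y ex ey|n p].
  + by rewrite !associ10 addr0.
  + by rewrite !associ1D ex ey addrACA.
  + by rewrite !associ1E !addE.
- exact: associ1D.
- move=> m a t; elim/ot_ind: t => [|x y ex ey|n p].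
  + by rewrite lact0 !associ10.
  + by rewrite lactDr !associ1D ex ey.
  + by rewrite otZl !associ1E ot_bal.
- move=> r m t; elim/ot_ind: t => [|x y ex ey|n p].
  + by rewrite !associ10 lact0.
  + by rewrite !associ1D ex ey lactDr.
  + by rewrite !associ1E !otZl.
- move=> m t s; elim/ot_ind: t => [|x y ex ey|n p].
  + by rewrite ract0 !associ10 ract0.
  + by rewrite ractDl !associ1D ex ey ractDl.
  + by rewrite otZr !associ1E otZr.
Qed.

Definition associ : bimap (tensor M (tensor N P)) (tensor (tensor M N) P) :=
  blift associ_subproof.

Lemma associE m n p : associ (m \ot (n \ot p)) = m \ot n \ot p.
Proof. by rewrite bliftE associ1E. Qed.

Lemma assocK : cancel assoc associ.
Proof.
elim/ot_ind=> [|x y ex ey|t p]; rewrite ?addE ?ex ?ey //.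
by elim/ot_ind: t => [|x y ex ey|m n]; rewrite ?addE ?ex ?ey // assocE associE.
Qed.

Lemma associK : cancel associ assoc.
Proof.
elim/ot_ind=> [|x y ex ey|m t]; rewrite ?addE ?ex ?ey //.
by elim/ot_ind: t => [|x y ex ey|n p]; rewrite ?addE ?ex ?ey // associE assocE.
Qed.
End Assoc.

Section Unit.
Variables (A B : algebra k) (M : bimod A B).

Lemma lunit_subproof : bilin (fun (a : reg A) (m : M) => (a : A) *< m).
Proof.
split; first split; move=> *; rewrite ?addE ?lractA //.
- by rewrite -lactDl.
- by rewrite /= lactA.
- by rewrite /= lactA.
Qed.

Definition lunit : bimap (tensor (reg A) M) M := blift lunit_subproof.
Lemma lunitE (a : reg A) m : lunit (a \ot m) = (a : A) *< m.
Proof. exact: bliftE. Qed.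

Lemma runit_subproof : bilin (fun (m : M) (b : reg B) => m >* (b : B)).
Proof.
split; first split; move=> *; rewrite ?addE ?lractA //.
- by rewrite -ractDr.
- by rewrite /= ractA.
- by rewrite /= ractA.
Qed.

Definition runit : bimap (tensor M (reg B)) M := blift runit_subproof.
Lemma runitE m (b : reg B) : runit (m \ot b) = m >* (b : B).
Proof. exact: bliftE. Qed.
End Unit.
End TensorMaps.
Arguments assoc {k R A B S M N P}.
Arguments associ {k R A B S M N P}.
Arguments lunit {k A B M}.
Arguments runit {k A B M}.

Section OneSided.
Variables (k : comPzRingType) (R A S S' : algebra k).

(* [M (x) g] for a function g which is only left linear. *)
Definition rtens (M : bimod R A) (N : bimod A S) (N' : bimod A S')
    (g : N -> N') (t : tensor M N) : tensor M N' :=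
  tlift (fun m n => m \ot g n) t.

Section Laws.
Variables (M : bimod R A) (N : bimod A S) (N' : bimod A S') (g : N -> N').
Hypothesis gD : {morph g : x y / x + y}.
Hypothesis gZ : forall a n, g (a *< n) = a *< g n.

Lemma rtens_subproof : balanced (@ract _ _ _ M) (@lact _ _ _ N)
  (fun (m : M) n => m \ot g n).
Proof. by split=> *; rewrite ?gD ?gZ ?addE ?ot_bal. Qed.

Lemma rtensE (m : M) n : rtens g (m \ot n) = m \ot g n.
Proof. exact: tliftE rtens_subproof m n. Qed.
Lemma rtensD : {morph rtens (M := M) g : x y / x + y}.
Proof. exact: tliftD rtens_subproof. Qed.
Lemma rtens0 : rtens (M := M) g 0 = 0.
Proof. exact: morphD0 rtensD. Qed.
End Laws.
End OneSided.

Section OneSidedL.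
Variables (k : comPzRingType) (R R' A S : algebra k).

Definition ltens (M : bimod R A) (M' : bimod R' A) (N : bimod A S)
    (g : M -> M') (t : tensor M N) : tensor M' N :=
  tlift (fun m n => g m \ot n) t.

Section Laws.
Variables (M : bimod R A) (M' : bimod R' A) (N : bimod A S) (g : M -> M').
Hypothesis gD : {morph g : x y / x + y}.
Hypothesis gZ : forall m a, g (m >* a) = g m >* a.

Lemma ltens_subproof : balanced (@ract _ _ _ M) (@lact _ _ _ N)
  (fun m (n : N) => g m \ot n).
Proof. by split=> *; rewrite ?gD ?gZ ?addE ?ot_bal. Qed.

Lemma ltensE m (n : N) : ltens g (m \ot n) = g m \ot n.
Proof. exact: tliftE ltens_subproof m n. Qed.
Lemma ltensD : {morph ltens (N := N) g : x y / x + y}.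
Proof. exact: tliftD ltens_subproof. Qed.
Lemma ltens0 : ltens (N := N) g 0 = 0.
Proof. exact: morphD0 ltensD. Qed.
End Laws.
End OneSidedL.

Arguments rtensE {k R A S S'} M {N N' g} gD gZ m n.
Arguments rtensD {k R A S S'} M {N N' g} gD gZ x y.
Arguments rtens0 {k R A S S'} M {N N' g} gD gZ.
Arguments ltensE {k R R' A S M M'} N {g} gD gZ m n.
Arguments ltensD {k R R' A S M M'} N {g} gD gZ x y.
Arguments ltens0 {k R R' A S M M'} N {g} gD gZ.

Record category := Category {
  obj :> Type;
  hom : obj -> obj -> Type;
  idm : forall x, hom x x;
  comp : forall x y z, hom y z -> hom x y -> hom x z;
  compA : forall x y z t (f : hom z t) (g : hom y z) (h : hom x y),
    comp f (comp g h) = comp (comp f g) h;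
  comp1l : forall x y (f : hom x y), comp (idm y) f = f;
  comp1r : forall x y (f : hom x y), comp f (idm x) = f }.
Arguments idm {c} x.

Record functor (C D : category) := Functor {
  fobj :> C -> D;
  fmap : forall x y, hom x y -> hom (fobj x) (fobj y);
  fmap1 : forall x, fmap (idm x) = idm (fobj x);
  fmapM : forall x y z (f : hom y z) (g : hom x y),
    fmap (comp f g) = comp (fmap f) (fmap g) }.
Arguments fmap {C D} _ {x y} _.

(* F is the left adjoint. *)
Record adjunction (C D : category) (F : functor C D) (G : functor D C) :=
  Adjunction {
    adj_unit : forall x, hom x (G (F x));
    adj_counit : forall y, hom (F (G y)) y;
    adj_unit_nat : forall x x' (f : hom x x'),
      comp (fmap G (fmap F f)) (adj_unit x) = comp (adj_unit x') f;
    adj_counit_nat : forall y y' (g : hom y y'),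
      comp g (adj_counit y) = comp (adj_counit y') (fmap F (fmap G g));
    adj_triangleL : forall x,
      comp (adj_counit (F x)) (fmap F (adj_unit x)) = idm (F x);
    adj_triangleR : forall y,
      comp (fmap G (adj_counit y)) (adj_unit (G y)) = idm (G y) }.

Definition frobenius_functor (C D : category) (F : functor C D) :=
  exists G : functor D C, inhabited (adjunction F G) /\ inhabited (adjunction G F).

Definition mono (C : category) (x y : C) (f : hom x y) :=
  forall z (g h : hom z x), comp f g = comp f h -> g = h.

Definition split_mono (C : category) (x y : C) (f : hom x y) :=
  exists g : hom y x, comp g f = idm x.

Definition isomorphic (C : category) (x y : C) :=
  exists (f : hom x y) (g : hom y x), comp g f = idm x /\ comp f g = idm y.

Definition injective_object (C : category) (i : C) :=
  forall (x y : C) (f : hom x y), mono f ->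
  forall g : hom x i, exists h : hom y i, comp h f = g.

Definition preserves_injectives (C D : category) (F : functor C D) :=
  forall i : C, injective_object i -> injective_object (F i).

Record coring (k : comPzRingType) (A : algebra k) := Coring {
  cor_mod :> bimod A A;
  Delta : bimap cor_mod (tensor cor_mod cor_mod);
  counit : bimap cor_mod (reg A);
  Delta_coassoc : forall c,
    assoc (tmap Delta (bm_id _) (Delta c)) = tmap (bm_id _) Delta (Delta c);
  counitl : forall c, lunit (tmap counit (bm_id _) (Delta c)) = c;
  counitr : forall c, runit (tmap (bm_id _) counit (Delta c)) = c }.
Arguments Delta {k A}.
Arguments counit {k A}.

Section Coactions.
Variables (k : comPzRingType) (A B : algebra k).

Definition is_rcoaction (D : coring B) (M : bimod A B)
    (rho : bimap M (tensor M D)) :=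
  (forall m, assoc (tmap rho (bm_id D) (rho m)) =
             tmap (bm_id M) (Delta D) (rho m)) /\
  (forall m, runit (tmap (bm_id M) (counit D) (rho m)) = m).

Definition is_lcoaction (C : coring A) (M : bimod A B)
    (lam : bimap M (tensor C M)) :=
  (forall m, assoc (tmap (Delta C) (bm_id M) (lam m)) =
             tmap (bm_id C) lam (lam m)) /\
  (forall m, lunit (tmap (counit C) (bm_id M) (lam m)) = m).

(* For A = k these are the right D-comodules. *)
Record rcomod (D : coring B) := Rcomod {
  rc_mod :> bimod A B;
  rc_coact : bimap rc_mod (tensor rc_mod D);
  rc_coactP : is_rcoaction rc_coact }.

Record rcomod_map (D : coring B) (M N : rcomod D) := RcomodMap {
  rc_map :> bimap M N;
  rc_mapP : forall m, rc_coact N (rc_map m) =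
                      tmap rc_map (bm_id D) (rc_coact M m) }.

Record bicomod (C : coring A) (D : coring B) := Bicomod {
  bc_mod :> bimod A B;
  bc_l : bimap bc_mod (tensor C bc_mod);
  bc_r : bimap bc_mod (tensor bc_mod D);
  bc_lP : is_lcoaction bc_l;
  bc_rP : is_rcoaction bc_r;
  bc_lr : forall m, assoc (tmap bc_l (bm_id D) (bc_r m)) =
                    tmap (bm_id C) bc_r (bc_l m) }.

Record bicomod_map (C : coring A) (D : coring B) (M N : bicomod C D) :=
  BicomodMap {
    bc_map :> bimap M N;
    bc_mapl : forall m, bc_l N (bc_map m) = tmap (bm_id C) bc_map (bc_l M m);
    bc_mapr : forall m, bc_r N (bc_map m) = tmap bc_map (bm_id D) (bc_r M m) }.

Definition bc_rcomod (C : coring A) (D : coring B) (M : bicomod C D) :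
  rcomod D := Rcomod (bc_rP M).

End Coactions.
Arguments rc_coact {k A B D}.
Arguments bc_l {k A B C D}.
Arguments bc_r {k A B C D}.

Section TmapTheory.
Variables (k : comPzRingType) (R A S : algebra k).

Lemma tmap_id (M : bimod R A) (N : bimod A S) t :
  tmap (bm_id M) (bm_id N) t = t.
Proof.
by elim/ot_ind: t => [|x y ex ey|m n]; rewrite ?addE ?ex ?ey ?tmapE.
Qed.

Lemma tmap_comp (M M' M'' : bimod R A) (N N' N'' : bimod A S)
    (f' : bimap M' M'') (f : bimap M M') (g' : bimap N' N'') (g : bimap N N') t :
  tmap (bm_comp f' f) (bm_comp g' g) t = tmap f' g' (tmap f g t).
Proof.
by elim/ot_ind: t => [|x y ex ey|m n]; rewrite ?addE ?ex ?ey ?tmapE.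
Qed.

Lemma tmap_compl (M M' M'' : bimod R A) (N : bimod A S)
    (f' : bimap M' M'') (f : bimap M M') t :
  tmap (bm_comp f' f) (bm_id N) t = tmap f' (bm_id N) (tmap f (bm_id N) t).
Proof.
by elim/ot_ind: t => [|x y ex ey|m n]; rewrite ?addE ?ex ?ey ?tmapE.
Qed.

Lemma tmap_compr (M : bimod R A) (N N' N'' : bimod A S)
    (g' : bimap N' N'') (g : bimap N N') t :
  tmap (bm_id M) (bm_comp g' g) t = tmap (bm_id M) g' (tmap (bm_id M) g t).
Proof.
by elim/ot_ind: t => [|x y ex ey|m n]; rewrite ?addE ?ex ?ey ?tmapE.
Qed.

End TmapTheory.

Section Categories.
Variables (k : comPzRingType) (A B : algebra k).

Definition bimod_cat : category.
Proof.
refine (@Category (bimod A B) (@bimap k A B) (@bm_id k A B)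
  (fun M N P => @bm_comp k A B M N P) _ _ _) => *; exact: bimap_eq.
Defined.

Section Rcomod.
Variable D : coring B.

Lemma rcomod_map_eq (M N : rcomod A D) (f g : rcomod_map M N) : f =1 g -> f = g.
Proof.
case: f g => [f fP] [g gP] /= /bimap_eq efg; subst g.
by congr RcomodMap; exact: Prop_irrelevance.
Qed.

Definition rcomod_id (M : rcomod A D) : rcomod_map M M.
Proof. by exists (bm_id M) => m; rewrite tmap_id. Defined.

Definition rcomod_comp (M N P : rcomod A D) (g : rcomod_map N P)
  (f : rcomod_map M N) : rcomod_map M P.
Proof. by exists (bm_comp g f) => m; rewrite tmap_compl -!rc_mapP. Defined.

Definition rcomod_cat : category.
Proof.
refine (@Category (rcomod A D) (@rcomod_map k A B D) rcomod_id
  rcomod_comp _ _ _) => *; exact: rcomod_map_eq.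
Defined.
End Rcomod.

Section Bicomod.
Variables (C : coring A) (D : coring B).

Lemma bicomod_map_eq (M N : bicomod C D) (f g : bicomod_map M N) :
  f =1 g -> f = g.
Proof.
case: f g => [f fl fr] [g gl gr] /= /bimap_eq efg; subst g.
by congr BicomodMap; exact: Prop_irrelevance.
Qed.

Definition bicomod_id (M : bicomod C D) : bicomod_map M M.
Proof. by exists (bm_id M) => m; rewrite tmap_id. Defined.

Definition bicomod_comp (M N P : bicomod C D) (g : bicomod_map N P)
  (f : bicomod_map M N) : bicomod_map M P.
Proof.
exists (bm_comp g f) => m; first by rewrite tmap_compr -!bc_mapl.
by rewrite tmap_compl -!bc_mapr.
Defined.

Definition bicomod_cat : category.
Proof.
refine (@Category (bicomod C D) (@bicomod_map k A B C D) bicomod_id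
  bicomod_comp _ _ _) => *; exact: bicomod_map_eq.
Defined.
End Bicomod.
End Categories.

Definition rmod_cat (k : comPzRingType) (A : algebra k) : category :=
  bimod_cat (base_alg k) A.

Definition comod_cat (k : comPzRingType) (B : algebra k) (D : coring B) :
  category := rcomod_cat (base_alg k) D.

(* Flatness is exactness of - (x)_A N, i.e. preservation of exact pairs. *)
Definition exact_pair (k : comPzRingType) (A B : algebra k) (X Y Z : bimod A B)
    (f : bimap X Y) (g : bimap Y Z) :=
  forall y, g y = 0 <-> exists x, f x = y.

Definition left_flat (k : comPzRingType) (A B : algebra k) (N : bimod A B) :=
  forall (X Y Z : rmod A) (f : bimap X Y) (g : bimap Y Z), exact_pair f g ->
  exact_pair (tmap f (bm_id N)) (tmap g (bm_id N)).

Section TensRcomod.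
Variables (k : comPzRingType) (R A B : algebra k) (D : coring B).

Definition tens_rcoact (X : bimod R A) (N : bimod A B)
    (rho : bimap N (tensor N D)) : bimap (tensor X N) (tensor (tensor X N) D) :=
  bm_comp (associ) (tmap (bm_id X) rho).

Lemma tens_rcoactE (X : bimod R A) (N : bimod A B)
    (rho : bimap N (tensor N D)) x n :
  tens_rcoact X rho (x \ot n) = associ (x \ot rho n).
Proof. by rewrite bm_compE tmapE. Qed.

Lemma tens_rcoactP (X : bimod R A) (N : bimod A B)
    (rho : bimap N (tensor N D)) :
  is_rcoaction rho -> is_rcoaction (tens_rcoact X rho).
Proof.
case=> coa cou; split=> t.
- elim/ot_ind: t => [|x y ex ey|x n]; rewrite ?addE ?ex ?ey //.
  rewrite tens_rcoactE.
  have -> : tmap (bm_id _) (Delta D) (associ (x \ot rho n)) =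
            associ (x \ot tmap (bm_id _) (Delta D) (rho n)).
    elim/ot_ind: (rho n) => [|y z ey ez|y d]; rewrite ?addE ?ey ?ez //.
    by rewrite !(associE, tmapE).
  rewrite -coa.
  elim/ot_ind: (rho n) => [|y z ey ez|y d]; rewrite ?addE ?ey ?ez //.
  rewrite associE !tmapE tens_rcoactE.
  elim/ot_ind: (rho y) => [|u v eu ev|u v]; rewrite ?addE ?eu ?ev //.
  by rewrite !(associE, assocE).
- elim/ot_ind: t => [|x y ex ey|x n]; rewrite ?addE ?ex ?ey //.
  rewrite tens_rcoactE -{2}(cou n).
  elim/ot_ind: (rho n) => [|y z ey ez|y d]; rewrite ?addE ?ey ?ez //.
  by rewrite associE !tmapE !runitE otZr.
Qed.

Definition tens_rcomod (X : bimod R A) (N : rcomod A D) : rcomod R D :=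
  Rcomod (tens_rcoactP X (rc_coactP N)).

Definition tens_rcomod_map (X X' : bimod R A) (N N' : rcomod A D)
  (f : bimap X X') (g : rcomod_map N N') :
  rcomod_map (tens_rcomod X N) (tens_rcomod X' N').
Proof.
exists (tmap f g) => t.
elim/ot_ind: t => [|x y ex ey|x n]; rewrite ?addE ?ex ?ey //.
rewrite tmapE !tens_rcoactE rc_mapP.
elim/ot_ind: (rc_coact N n) => [|y z ey ez|y d]; rewrite ?addE ?ey ?ez //.
by rewrite !(associE, tmapE).
Defined.

End TensRcomod.

Definition tensor_functor (k : comPzRingType) (A B : algebra k) (D : coring B)
  (N : rcomod A D) : functor (rmod_cat A) (comod_cat D).
Proof.
refine (@Functor (rmod_cat A) (comod_cat D) (fun X => tens_rcomod X N)
  (fun X X' (f : bimap X X') => tens_rcomod_map f (rcomod_id N)) _ _).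
- by move=> X; apply: rcomod_map_eq => t; rewrite tmap_id.
- by move=> X Y Z f g; apply: rcomod_map_eq => t; rewrite tmap_compl.
Defined.

Section RegularBicomod.
Variables (k : comPzRingType) (A : algebra k) (C : coring A).

Lemma Delta_rP : is_rcoaction (Delta C).
Proof. split; [exact: Delta_coassoc | exact: counitr]. Qed.

Lemma Delta_lP : is_lcoaction (Delta C).
Proof. split; [exact: Delta_coassoc | exact: counitl]. Qed.

Definition reg_bicomod : bicomod C C :=
  Bicomod Delta_lP Delta_rP (@Delta_coassoc _ _ C).

End RegularBicomod.

Section TensLcoact.
Variables (k : comPzRingType) (A B S : algebra k) (C : coring A).

Definition tens_lcoact (M : bimod A B) (X : bimod B S)
    (lam : bimap M (tensor C M)) : bimap (tensor M X) (tensor C (tensor M X)) :=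
  bm_comp (assoc) (tmap lam (bm_id X)).

Lemma tens_lcoactE (M : bimod A B) (X : bimod B S)
    (lam : bimap M (tensor C M)) m x :
  tens_lcoact X lam (m \ot x) = assoc (lam m \ot x).
Proof. by rewrite bm_compE tmapE. Qed.

Lemma tens_lcoactP (M : bimod A B) (X : bimod B S)
    (lam : bimap M (tensor C M)) :
  is_lcoaction lam -> is_lcoaction (tens_lcoact X lam).
Proof.
case=> coa cou; split=> t.
- elim/ot_ind: t => [|x y ex ey|m x]; rewrite ?addE ?ex ?ey //.
  rewrite tens_lcoactE.
  pose g (w : tensor C M) := assoc (w \ot x).
  have gD : {morph g : x y / x + y} by move=> *; rewrite /g !addE.
  have gZ a w : g (a *< w) = a *< g w by rewrite /g -otZl bmZl.
  have rE := (rtensE C gD gZ, rtensD C gD gZ, rtens0 C gD gZ).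
  transitivity (rtens g (tmap (bm_id C) lam (lam m))).
    rewrite -coa; elim/ot_ind: (lam m) => [|y z ey ez|c n];
      rewrite ?(addE, rE) ?ey ?ez //.
    rewrite assocE !tmapE.
    elim/ot_ind: (Delta C c) => [|y z ey ez|c1 c2];
      rewrite ?(addE, rE) ?ey ?ez //.
    by rewrite !(assocE, rE) /g assocE.
  elim/ot_ind: (lam m) => [|y z ey ez|c n]; rewrite ?(addE, rE) ?ey ?ez //.
  by rewrite assocE !tmapE rE tens_lcoactE.
- elim/ot_ind: t => [|x y ex ey|m x]; rewrite ?addE ?ex ?ey //.
  rewrite tens_lcoactE -{2}(cou m).
  elim/ot_ind: (lam m) => [|y z ey ez|c n]; rewrite ?addE ?ey ?ez //.
  by rewrite assocE !tmapE !lunitE otZl.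
Qed.

End TensLcoact.

Section TensBicomod.
Variables (k : comPzRingType) (A B S : algebra k).
Variables (C : coring A) (D : coring S) (M : bimod A B) (N : bimod B S).
Variables (lam : bimap M (tensor C M)) (rho : bimap N (tensor N D)).

Lemma tens_lr t :
  assoc (tmap (tens_lcoact N lam) (bm_id D) (tens_rcoact M rho t)) =
  tmap (bm_id C) (tens_rcoact M rho) (tens_lcoact N lam t).
Proof.
elim/ot_ind: t => [|x y ex ey|m n]; rewrite ?addE ?ex ?ey //.
rewrite tens_rcoactE tens_lcoactE.
transitivity (tmap (bm_id C) (associ) (assoc (lam m \ot rho n))).
  elim/ot_ind: (rho n) => [|y z ey ez|n' d]; rewrite ?addE ?ey ?ez //.
  rewrite associE tmapE tens_lcoactE.
  elim/ot_ind: (lam m) => [|u v eu ev|c m']; rewrite ?addE ?eu ?ev //.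
  by rewrite !(assocE, tmapE) associE.
elim/ot_ind: (lam m) => [|u v eu ev|c m']; rewrite ?addE ?eu ?ev //.
by rewrite !(assocE, tmapE) tens_rcoactE.
Qed.

Hypotheses (lamP : is_lcoaction lam) (rhoP : is_rcoaction rho).

Definition tens_bicomod : bicomod C D :=
  Bicomod (tens_lcoactP N lamP) (tens_rcoactP M rhoP) tens_lr.

End TensBicomod.

Section Coseparable.
Variables (k : comPzRingType) (A : algebra k) (C : coring A).

Definition CC_bicomod : bicomod C C := tens_bicomod (Delta_lP C) (Delta_rP C).

Definition Delta_bicomod_map : bicomod_map (reg_bicomod C) CC_bicomod.
Proof.
exists (Delta C) => c; first exact: Delta_coassoc.
change (associ (tmap (bm_id C) (Delta C) (Delta C c)) =
        tmap (Delta C) (bm_id C) (Delta C c)).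
by rewrite -Delta_coassoc assocK.
Defined.

Definition coseparable :=
  split_mono (Delta_bicomod_map : @hom (bicomod_cat C C) _ _).

End Coseparable.

(* The canonical map M (x)_A N -> M (x)_B N along an algebra map A -> B. *)
Section Omega.
Variables (k : comPzRingType) (R R' A B S S' : algebra k).
Variables (f : alg_hom R' R) (h : alg_hom A B) (g : alg_hom S' S).
Variables (M : bimod R B) (N : bimod B S).

Lemma omega_subproof :
  @bilin _ _ _ _ (res f h M) (res h g N) (res f g (tensor M N))
    (fun (m : M) (n : N) => m \ot n).
Proof.
split; first split.
- by move=> m m' n; exact: otDl.
- by move=> m n n'; exact: otDr.
- by move=> m a n; exact: (@ot_bal _ _ _ _ M N m (h a) n).
- by move=> r m n; exact: esym (@otZl _ _ _ _ M N (f r) m n).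
- by move=> m n s; exact: esym (@otZr _ _ _ _ M N m n (g s)).
Qed.

Definition omega :
  bimap (tensor (res f h M) (res h g N)) (res f g (tensor M N)) :=
  blift omega_subproof.

Lemma omegaE (m : M) (n : N) :
  omega (ot (M := res f h M) (N := res h g N) m n) = m \ot n.
Proof. exact: bliftE. Qed.
End Omega.

Record coring_hom (k : comPzRingType) (A B : algebra k)
    (C : coring A) (D : coring B) := CoringHom {
  ch_alg : alg_hom A B;
  ch_map :> bimap C (res ch_alg ch_alg D);
  ch_Delta : forall c,
    Delta D (ch_map c) =
    omega ch_alg ch_alg ch_alg D D (tmap ch_map ch_map (Delta C c));
  ch_counit : forall c, counit D (ch_map c) = ch_alg (counit C c) }.

Section Induction.
Variables (k : comPzRingType) (A B : algebra k).
Variables (C : coring A) (D : coring B) (phi : coring_hom C D).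
Let rho := ch_alg phi.

Definition B_AB : bimod A B := res rho (alg_hom_id B) (reg B).
Definition B_BA : bimod B A := res (alg_hom_id B) rho (reg B).

Lemma phiD (x y : C) : phi (x + y) = phi x + phi y :> D.
Proof. exact: (bmD (ch_map phi)). Qed.
Lemma phiZl a (c : C) : phi (a *< c) = rho a *< (phi c : D) :> D.
Proof. exact: (bmZl (ch_map phi)). Qed.
Lemma phiZr (c : C) a : phi (c >* a) = (phi c : D) >* rho a :> D.
Proof. exact: (bmZr (ch_map phi)). Qed.

Lemma ind_kappa_subproof : bilin (P := tensor B_AB D)
  (fun (c : C) (b : B_AB) => ot (M := B_AB) (N := D) (1 : B) ((phi c : D) >* (b : B))).
Proof.
split; first split.
- by move=> c c' b; rewrite phiD ractDl otDr.
- by move=> c b b'; rewrite ractDr otDr.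
- by move=> c a b; rewrite phiZr -ractA.
- move=> a c b; rewrite phiZl lractA -ot_bal otZl; congr (ot (M := B_AB) _ _).
  by rewrite /= mul1r mulr1.
- by move=> c b b'; rewrite otZr -ractA.
Qed.

Definition ind_kappa : bimap (tensor C B_AB) (tensor B_AB D) :=
  blift ind_kappa_subproof.

Lemma ind_kappaE (c : C) (b : B_AB) :
  ind_kappa (c \ot b) = (1 : B_AB) \ot ((phi c : D) >* (b : B)).
Proof. exact: bliftE. Qed.

(* m (x) b |-> m_0 (x) 1 (x) phi(m_1) b *)
Definition ind_coact (R : algebra k) (M : bimod R A) (r : bimap M (tensor M C)) :
    bimap (tensor M B_AB) (tensor (tensor M B_AB) D) :=
  bm_comp associ (bm_comp (tmap (bm_id M) ind_kappa)
    (bm_comp assoc (tmap r (bm_id B_AB)))).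

Section IndTheory.
Variables (R : algebra k) (M : bimod R A) (r : bimap M (tensor M C)).

Definition ind_aux (b : B_AB) (t : tensor M C) : tensor (tensor M B_AB) D :=
  associ (tmap (bm_id M) ind_kappa (assoc (t \ot b))).

Lemma ind_coactE m b : ind_coact r (m \ot b) = ind_aux b (r m).
Proof. by rewrite !bm_compE tmapE. Qed.

Lemma ind_auxE b m c : ind_aux b (m \ot c) =
  m \ot (1 : B_AB) \ot ((phi c : D) >* (b : B)).
Proof. by rewrite /ind_aux assocE tmapE ind_kappaE associE. Qed.

Lemma ind_auxD b : {morph ind_aux b : x y / x + y}.
Proof. by move=> x y; rewrite /ind_aux !addE. Qed.

Lemma ind_aux0 b : ind_aux b 0 = 0.
Proof. by rewrite /ind_aux !addE. Qed.

Lemma ind_auxZ b a t : ind_aux b (a *< t) = a *< ind_aux b t.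
Proof. by rewrite /ind_aux -otZl !bmZl. Qed.

Lemma ind_coactP : is_rcoaction r -> is_rcoaction (ind_coact r).
Proof.
case=> coa cou; split=> t.
- elim/ot_ind: t => [|x y ex ey|m b]; rewrite ?addE ?ex ?ey //.
  rewrite ind_coactE.
  pose om (w : tensor C C) : tensor D D :=
    omega rho rho rho D D (tmap phi phi w).
  pose F (m' : M) (w : tensor C C) : tensor (tensor M B_AB) (tensor D D) :=
    (m' \ot (1 : B_AB)) \ot (om w >* (b : B)).
  have omD x y : om (x + y) = om x + om y by rewrite /om !addE.
  have omZ a x : om (a *< x) = rho a *< om x by rewrite /om !bmZl.
  have Fb : balanced (@ract _ _ _ M) (@lact _ _ _ (tensor C C)) F.
    split=> [m1 m2 w|m1 w w'|m1 a w]; rewrite /F.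
    - by rewrite !addE.
    - by rewrite omD !addE.
    - rewrite omZ lractA -ot_bal ot_bal otZr; congr (_ \ot _ \ot _).
      by rewrite /= mul1r mulr1.
  have FE := tliftE Fb; have FD := tliftD Fb; have F0 := tlift0 Fb.
  transitivity (tlift F (tmap (bm_id M) (Delta C) (r m))); last first.
    elim/ot_ind: (r m) => [|y z ey ez|m' c];
      rewrite ?(addE, FD, F0, ind_auxD, ind_aux0) ?ey ?ez //.
    rewrite tmapE ind_auxE [LHS]FE tmapE bmZr.
    by rewrite /F /om -ch_Delta.
  rewrite -coa.
  elim/ot_ind: (r m) => [|y z ey ez|m' c];
    rewrite ?(addE, FD, F0, ind_auxD, ind_aux0) ?ey ?ez //.
  rewrite tmapE ind_auxE !tmapE ind_coactE.
  elim/ot_ind: (r m') => [|y z ey ez|m'' c'];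
    rewrite ?(addE, FD, F0, ind_auxD, ind_aux0) ?ey ?ez //.
  rewrite ind_auxE !assocE [RHS]FE /F /om tmapE omegaE otZr.
  by rewrite ract1.
- elim/ot_ind: t => [|x y ex ey|m b]; rewrite ?addE ?ex ?ey //.
  rewrite ind_coactE -{2}(cou m).
  elim/ot_ind: (r m) => [|y z ey ez|m' c];
    rewrite ?(addE, ind_auxD, ind_aux0) ?ey ?ez //.
  rewrite ind_auxE !tmapE !runitE bmZr ch_counit otZr ot_bal.
  by congr (ot (N := B_AB) _ _); rewrite /= mul1r.
Qed.
End IndTheory.

Definition ind_rcomod (R : algebra k) (M : rcomod R C) : rcomod R D :=
  Rcomod (ind_coactP (rc_coactP M)).

Definition ind_rcomod_map (R : algebra k) (M N : rcomod R C)
  (f : rcomod_map M N) : rcomod_map (ind_rcomod M) (ind_rcomod N).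
Proof.
exists (tmap f (bm_id B_AB)) => t.
elim/ot_ind: t => [|x y ex ey|m b]; rewrite ?addE ?ex ?ey //.
rewrite tmapE !ind_coactE rc_mapP.
elim/ot_ind: (rc_coact M m) => [|y z ey ez|m' c];
  rewrite ?(addE, ind_auxD, ind_aux0) ?ey ?ez //.
by rewrite !(tmapE, ind_auxE).
Defined.

Definition induction_functor : functor (comod_cat C) (comod_cat D).
Proof.
refine (@Functor (comod_cat C) (comod_cat D) (@ind_rcomod (base_alg k))
  (@ind_rcomod_map (base_alg k)) _ _).
- by move=> M; apply: rcomod_map_eq => t; exact: tmap_id.
- by move=> M N P f g; apply: rcomod_map_eq => t; exact: tmap_compl.
Defined.

Lemma CB_lr t :
  assoc (tmap (tens_lcoact B_AB (Delta C)) (bm_id D) (ind_coact (Delta C) t)) =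
  tmap (bm_id C) (ind_coact (Delta C)) (tens_lcoact B_AB (Delta C) t).
Proof.
elim/ot_ind: t => [|x y ex ey|c b]; rewrite ?addE ?ex ?ey //.
rewrite ind_coactE tens_lcoactE.
have rE := (rtensE C (ind_auxD (M := C) b) (ind_auxZ (M := C) b),
  rtensD C (ind_auxD (M := C) b) (ind_auxZ (M := C) b),
  rtens0 C (ind_auxD (M := C) b) (ind_auxZ (M := C) b)).
transitivity (rtens (M := C) (ind_aux (M := C) b)
                (tmap (bm_id C) (Delta C) (Delta C c))).
  rewrite -Delta_coassoc.
  elim/ot_ind: (Delta C c) => [|y z ey ez|c1 c2];
    rewrite ?(addE, rE, ind_auxD, ind_aux0) ?ey ?ez //.
  rewrite ind_auxE !tmapE tens_lcoactE.
  elim/ot_ind: (Delta C c1) => [|y z ey ez|x y];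
    rewrite ?(addE, rE, ind_auxD, ind_aux0) ?ey ?ez //.
  by rewrite !assocE rE ind_auxE.
elim/ot_ind: (Delta C c) => [|y z ey ez|c1 c2];
  rewrite ?(addE, rE, ind_auxD, ind_aux0) ?ey ?ez //.
by rewrite assocE !tmapE rE ind_coactE.
Qed.

Definition CB_bicomod : bicomod C D :=
  Bicomod (tens_lcoactP B_AB (Delta_lP C)) (ind_coactP (Delta_rP C)) CB_lr.

Lemma coind_kappa_subproof : bilin (P := tensor D B_BA)
  (fun (b : B_BA) (c : C) => ot (M := D) (N := B_BA) ((b : B) *< (phi c : D)) (1 : B)).
Proof.
split; first split.
- by move=> b b' c; rewrite lactDl otDl.
- by move=> b c c'; rewrite phiD lactDr otDl.
- by move=> b a c; rewrite phiZl -lactA.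
- by move=> b b' c; rewrite otZl -lactA.
- move=> b c a; rewrite phiZr -lractA ot_bal otZr; congr (ot (N := B_BA) _ _).
  by rewrite /= mul1r mulr1.
Qed.

Definition coind_kappa : bimap (tensor B_BA C) (tensor D B_BA) :=
  blift coind_kappa_subproof.

Lemma coind_kappaE (b : B_BA) (c : C) :
  coind_kappa (b \ot c) = ((b : B) *< (phi c : D)) \ot (1 : B_BA).
Proof. exact: bliftE. Qed.

(* b (x) c |-> b phi(c_1) (x) 1 (x) c_2 *)
Definition BC_lcoact :
    bimap (tensor B_BA C) (tensor D (tensor B_BA C)) :=
  bm_comp assoc (bm_comp (tmap coind_kappa (bm_id C))
    (bm_comp associ (tmap (bm_id B_BA) (Delta C)))).

Definition coind_aux (b : B_BA) (t : tensor C C) : tensor D (tensor B_BA C) :=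
  assoc (tmap coind_kappa (bm_id C) (associ (b \ot t))).

Lemma BC_lcoactE b c : BC_lcoact (b \ot c) = coind_aux b (Delta C c).
Proof. by rewrite !bm_compE tmapE. Qed.

Lemma coind_auxE b c c' : coind_aux b (c \ot c') =
  ((b : B) *< (phi c : D)) \ot ((1 : B_BA) \ot c').
Proof. by rewrite /coind_aux associE tmapE coind_kappaE assocE. Qed.

Lemma coind_auxD b : {morph coind_aux b : x y / x + y}.
Proof. by move=> x y; rewrite /coind_aux !addE. Qed.

Lemma coind_aux0 b : coind_aux b 0 = 0.
Proof. by rewrite /coind_aux !addE. Qed.

Lemma coind_auxZ b t a : coind_aux b (t >* a) = coind_aux b t >* a.
Proof. by rewrite /coind_aux -otZr !bmZr. Qed.

Lemma BC_lcoactP : is_lcoaction BC_lcoact.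
Proof.
split=> t.
- elim/ot_ind: t => [|x y ex ey|b c]; rewrite ?addE ?ex ?ey //.
  rewrite BC_lcoactE.
  pose om (w : tensor C C) : tensor D D :=
    omega rho rho rho D D (tmap phi phi w).
  pose F (w : tensor C C) (c' : C) : tensor (tensor D D) (tensor B_BA C) :=
    ((b : B) *< om w) \ot ((1 : B_BA) \ot c').
  have omD x y : om (x + y) = om x + om y by rewrite /om !addE.
  have omZ a x : om (x >* a) = om x >* rho a by rewrite /om !bmZr.
  have Fb : balanced (@ract _ _ _ (tensor C C)) (@lact _ _ _ C) F.
    split=> [m1 m2 w|m1 w w'|w a m]; rewrite /F.
    - by rewrite omD !addE.
    - by rewrite !addE.
    - rewrite omZ -lractA ot_bal otZl -ot_bal; congr (_ \ot (_ \ot _)).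
      by rewrite /= mul1r mulr1.
  have FE := tliftE Fb; have FD := tliftD Fb; have F0 := tlift0 Fb.
  transitivity (assoc (tlift F (tmap (Delta C) (bm_id C) (Delta C c)))).
    elim/ot_ind: (Delta C c) => [|y z ey ez|c1 c2];
      rewrite ?(addE, FD, F0, coind_auxD, coind_aux0) ?ey ?ez //.
    rewrite tmapE coind_auxE [tlift F _]FE tmapE bmZl.
    by rewrite /F /om -ch_Delta.
  rewrite -[tmap _ _ _]assocK Delta_coassoc.
  elim/ot_ind: (Delta C c) => [|y z ey ez|c1 c2];
    rewrite ?(addE, FD, F0, coind_auxD, coind_aux0) ?ey ?ez //.
  rewrite tmapE coind_auxE !tmapE BC_lcoactE.
  elim/ot_ind: (Delta C c2) => [|y z ey ez|x y];
    rewrite ?(addE, FD, F0, coind_auxD, coind_aux0) ?ey ?ez //.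
  rewrite coind_auxE !associE [tlift F _]FE /F /om tmapE omegaE otZl assocE.
  by rewrite lact1.
- elim/ot_ind: t => [|x y ex ey|b c]; rewrite ?addE ?ex ?ey //.
  rewrite BC_lcoactE -{2}(counitl c).
  elim/ot_ind: (Delta C c) => [|y z ey ez|c1 c2];
    rewrite ?(addE, coind_auxD, coind_aux0) ?ey ?ez //.
  rewrite coind_auxE !tmapE !lunitE bmZl ch_counit otZl -ot_bal.
  by congr (ot (M := B_BA) _ _); rewrite /= mulr1.
Qed.

Lemma BC_lr t :
  assoc (tmap BC_lcoact (bm_id C) (tens_rcoact B_BA (Delta C) t)) =
  tmap (bm_id D) (tens_rcoact B_BA (Delta C)) (BC_lcoact t).
Proof.
elim/ot_ind: t => [|x y ex ey|b c]; rewrite ?addE ?ex ?ey //.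
rewrite tens_rcoactE BC_lcoactE.
have rE := (ltensE C (coind_auxD b) (coind_auxZ b),
  ltensD C (coind_auxD b) (coind_auxZ b), ltens0 C (coind_auxD b) (coind_auxZ b)).
transitivity (assoc (ltens (N := C) (coind_aux b)
                (tmap (Delta C) (bm_id C) (Delta C c)))).
  elim/ot_ind: (Delta C c) => [|y z ey ez|c1 c2];
    rewrite ?(addE, rE, coind_auxD, coind_aux0) ?ey ?ez //.
  by rewrite associE !tmapE rE BC_lcoactE.
rewrite -[tmap _ _ _]assocK Delta_coassoc.
elim/ot_ind: (Delta C c) => [|y z ey ez|c1 c2];
  rewrite ?(addE, rE, coind_auxD, coind_aux0) ?ey ?ez //.
rewrite tmapE coind_auxE !tmapE tens_rcoactE.
elim/ot_ind: (Delta C c2) => [|y z ey ez|x y];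
  rewrite ?(addE, rE, coind_auxD, coind_aux0) ?ey ?ez //.
by rewrite !associE rE coind_auxE assocE.
Qed.

Definition BC_bicomod : bicomod D C :=
  Bicomod BC_lcoactP (tens_rcoactP B_BA (Delta_rP C)) BC_lr.

End Induction.

Section AdjunctionTheory.
Variables (C D : category) (F : functor C D) (G : functor D C).
Variable adj : adjunction F G.

Lemma adj_uniq x y (u v : hom (F x) y) :
  comp (fmap G u) (adj_unit adj x) = comp (fmap G v) (adj_unit adj x) -> u = v.
Proof.
move=> e; suff E (w : hom (F x) y) :
    w = comp (adj_counit adj y) (fmap F (comp (fmap G w) (adj_unit adj x))).
  by rewrite [u]E e -E.
by rewrite fmapM compA -adj_counit_nat -compA adj_triangleL comp1r.
Qed.

Definition transpose x y (g : hom x (G y)) : hom (F x) y :=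
  comp (adj_counit adj y) (fmap F g).

Lemma transposeE x y (g : hom x (G y)) :
  comp (fmap G (transpose g)) (adj_unit adj x) = g.
Proof.
by rewrite /transpose fmapM -compA adj_unit_nat compA adj_triangleR comp1l.
Qed.
End AdjunctionTheory.

Section Forget.
Variables (k : comPzRingType) (R B : algebra k) (D : coring B).

Section Obj.
Variable Y : rcomod R D.

Lemma rforget_subproof :
  @bimod_morph _ _ _ (forgetl Y) (tensor (forgetl Y) D) (rc_coact Y).
Proof.
split; first exact: (bmD (rc_coact Y)).
  by move=> l y; exact: (bmZl (rc_coact Y) (alg_str R l) y).
by move=> y b; exact: (bmZr (rc_coact Y) y b).
Qed.

Lemma rforget_coactP : is_rcoaction (D := D) (Bimap rforget_subproof).
Proof.
split=> y; [exact: (proj1 (rc_coactP Y) y)|exact: (proj2 (rc_coactP Y) y)].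
Qed.

Definition rforget : rcomod (base_alg k) D := Rcomod rforget_coactP.

Lemma lmul_subproof (r : R) :
  @bimod_morph _ _ _ (forgetl Y) (forgetl Y) (fun y : Y => r *< y).
Proof.
split=> [x y|l y|y b]; first exact: (@lactDr _ _ _ Y r x y).
  change (r *< (alg_str R l *< (y : Y)) = alg_str R l *< (r *< (y : Y))).
  by rewrite -!lactA alg_central.
by change (r *< ((y : Y) >* b) = (r *< (y : Y)) >* b); rewrite lractA.
Qed.

Definition lmul (r : R) : rcomod_map rforget rforget.
Proof.
exists (Bimap (lmul_subproof r)) => y; exact: (bmZl (rc_coact Y) r y).
Defined.
End Obj.

Lemma rforget_map_subproof (Y Y' : rcomod R D) (f : rcomod_map Y Y') :
  @bimod_morph _ _ _ (forgetl Y) (forgetl Y') f.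
Proof.
split; first exact: (bmD f).
  by move=> l y; exact: (bmZl f (alg_str R l) y).
by move=> y b; exact: (bmZr f y b).
Qed.

Definition rforget_map (Y Y' : rcomod R D) (f : rcomod_map Y Y') :
  rcomod_map (rforget Y) (rforget Y').
Proof. exists (Bimap (rforget_map_subproof f)) => y; exact: (rc_mapP f y). Defined.

End Forget.

Section Cohom.
Variables (k : comPzRingType) (A B : algebra k) (D : coring B).

Record cohom (N : rcomod A D) := Cohom {
  coh_fun :> functor (comod_cat D) (rmod_cat A);
  coh_adj : adjunction coh_fun (tensor_functor N) }.

Definition quasi_finite (N : rcomod A D) := inhabited (cohom N).

Definition injector (N : rcomod A D) := preserves_injectives (tensor_functor N).

Variables (N : rcomod A D) (h : cohom N).

Definition coh_mod (Y : comod_cat D) : rmod A := h Y.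
Definition coh_map (Y Y' : comod_cat D) (f : hom Y Y') :
  bimap (coh_mod Y) (coh_mod Y') := fmap h f.
Definition coh_unit (Y : comod_cat D) :
  bimap (Y : rcomod _ D) (tensor (coh_mod Y) N) := rc_map (adj_unit (coh_adj h) Y).

Lemma coh_uniq (Y : comod_cat D) (X : rmod A) (u v : bimap (coh_mod Y) X) :
  (forall y, tmap u (bm_id N) (coh_unit Y y) = tmap v (bm_id N) (coh_unit Y y)) ->
  u = v.
Proof.
move=> e; apply: (adj_uniq (adj := coh_adj h)).
by apply: rcomod_map_eq => y; exact: e.
Qed.

Lemma coh_unit_nat (Y Y' : comod_cat D) (f : hom Y Y') y :
  tmap (coh_map f) (bm_id N) (coh_unit Y y) = coh_unit Y' (rc_map f y).
Proof. exact: (congr1 (fun g => rc_map g y) (adj_unit_nat (coh_adj h) f)). Qed.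

Section Bimodule.
Variables (R : algebra k).

Section Obj.
Variable Y : rcomod R D.
Let hY := coh_mod (rforget Y).

Lemma badd_subproof (X X' : rmod A) (u v : bimap X X') :
  bimod_morph (fun x => u x + v x).
Proof.
split=> [x y|a x|x b]; first by rewrite !bmD addrACA.
  by rewrite !bmZl lactDr.
by rewrite !bmZr ractDl.
Qed.

Definition badd (X X' : rmod A) (u v : bimap X X') : bimap X X' :=
  Bimap (badd_subproof u v).

Lemma tmap_badd (X X' : rmod A) (u v : bimap X X') (t : tensor X N) :
  tmap (badd u v) (bm_id N) t = tmap u (bm_id N) t + tmap v (bm_id N) t.
Proof.
elim/ot_ind: t => [|x y ex ey|x n]; rewrite ?addE ?ex ?ey //.
  by rewrite addrACA.
by rewrite !tmapE otDl.
Qed.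

Lemma coh_lactDl (r r' : R) (z : hY) :
  coh_map (lmul Y (r + r')) z = coh_map (lmul Y r) z + coh_map (lmul Y r') z.
Proof.
suff -> : coh_map (lmul Y (r + r')) =
          badd (coh_map (lmul Y r)) (coh_map (lmul Y r')) by [].
apply: coh_uniq => y; rewrite tmap_badd !coh_unit_nat -bmD.
by congr (coh_unit _ _); exact: (@lactDl _ _ _ Y r r' y).
Qed.

Lemma kmul_subproof (X : rmod A) (l : k) : bimod_morph (fun x : X => (l : base_alg k) *< x).
Proof.
split=> [x y|l' x|x b]; first exact: lactDr.
  by rewrite -!lactA; congr (_ *< _); exact: mulrC.
by rewrite lractA.
Qed.

Lemma coh_sym (l : k) (z : hY) :
  coh_map (lmul Y (alg_str R l)) z = z >* alg_str A l.
Proof.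
rewrite -bm_sym.
suff -> : coh_map (lmul Y (alg_str R l)) = Bimap (kmul_subproof hY l) by [].
apply: coh_uniq => y; rewrite coh_unit_nat.
transitivity ((l : base_alg k) *< coh_unit (rforget Y) y).
  by rewrite -bmZl.
elim/ot_ind: (coh_unit _ y) => [|x t ex et|x n]; rewrite ?addE ?ex ?et //.
Qed.

(* h_D(N, Y) with its left R-action by functoriality. *)
Definition coh_bimod : bimod R A.
Proof.
refine (@Bimod k R A hY (fun r z => coh_map (lmul Y r) z) (fun z a => z >* a)
  coh_lactDl _ _ _ _ _ _ _ _ coh_sym).
- by move=> r x y; exact: bmD.
- move=> r r' z; rewrite -[RHS]/(bm_comp (coh_map (lmul Y r)) (coh_map (lmul Y r')) z).
  congr (bm_fun _ z); rewrite /coh_map -[RHS](fmapM h); congr (fmap h _).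
  by apply: rcomod_map_eq => y; exact: (@lactA _ _ _ Y r r' y).
- move=> z; rewrite -[RHS]/(bm_id hY z).
  congr (bm_fun _ z); rewrite /coh_map -[RHS](fmap1 h); congr (fmap h _).
  by apply: rcomod_map_eq => y; exact: (@lact1 _ _ _ Y y).
- exact: ractDl.
- exact: ractDr.
- exact: ractA.
- exact: ract1.
- by move=> r z a; exact: esym (bmZr (coh_map (lmul Y r)) z a).
Defined.

Lemma theta_subproof :
  @bimod_morph _ _ _ Y (tensor coh_bimod N) (coh_unit (rforget Y)).
Proof.
split; first exact: (bmD (coh_unit (rforget Y))).
  by move=> r y; exact: esym (coh_unit_nat (lmul Y r) y).
by move=> y b; exact: (bmZr (coh_unit (rforget Y)) y b).
Qed.

Definition theta : bimap Y (tensor coh_bimod N) := Bimap theta_subproof.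

Definition theta_map : rcomod_map Y (tens_rcomod coh_bimod N).
Proof.
exists theta => y; exact: (rc_mapP (adj_unit (coh_adj h) (rforget Y)) y).
Defined.

Lemma of_coh_subproof (X : bimod R A) (u : bimap coh_bimod X) :
  @bimod_morph _ _ _ hY (forgetl X) u.
Proof.
split; first exact: (bmD u); last by move=> z a; exact: (bmZr u z a).
move=> l z; transitivity (u ((z : coh_bimod) >* alg_str A l)).
  by congr (u _); exact: (@bm_sym _ _ _ hY l z).
by rewrite bmZr -bm_sym.
Qed.

Lemma theta_uniq (X : bimod R A) (u v : bimap coh_bimod X) :
  (forall y, tmap u (bm_id N) (theta y) = tmap v (bm_id N) (theta y)) -> u = v.
Proof.
move=> e; suff E : Bimap (of_coh_subproof u) = Bimap (of_coh_subproof v).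
  by apply: bimap_eq => z; exact: (congr1 (fun w : bimap hY (forgetl X) => w z) E).
by apply: coh_uniq => y; exact: e.
Qed.

Section Transpose.
Variables (X : bimod R A) (g : rcomod_map Y (tens_rcomod X N)).

Lemma to_base_subproof :
  @bimod_morph _ _ _ (forgetl Y) (tensor (forgetl X) N) g.
Proof.
split; first exact: (bmD g).
  by move=> l y; exact: (bmZl g (alg_str R l) y).
by move=> y b; exact: (bmZr g y b).
Qed.

Definition to_base : rcomod_map (rforget Y) (tens_rcomod (forgetl X) N).
Proof. exists (Bimap to_base_subproof) => y; exact: (rc_mapP g y). Defined.

Definition ctr0 : bimap hY (forgetl X) :=
  @transpose _ _ _ _ (coh_adj h) (rforget Y) (forgetl X) to_base.

Lemma ctr0E y : tmap ctr0 (bm_id N) (coh_unit (rforget Y) y) = g y.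
Proof.
exact: (congr1 (fun f => rc_map f y)
  (@transposeE _ _ _ _ (coh_adj h) (rforget Y) (forgetl X) to_base)).
Qed.

Lemma lmulX_subproof (r : R) :
  @bimod_morph _ _ _ (forgetl X) (forgetl X) (fun x : X => r *< x).
Proof.
split=> [x y|l y|y b]; first exact: (@lactDr _ _ _ X r x y).
  change (r *< (alg_str R l *< (y : X)) = alg_str R l *< (r *< (y : X))).
  by rewrite -!lactA alg_central.
by change (r *< ((y : X) >* b) = (r *< (y : X)) >* b); rewrite lractA.
Qed.

Lemma ctr0Z (r : R) (z : hY) : ctr0 (coh_map (lmul Y r) z) = r *< (ctr0 z : X).
Proof.
suff E : bm_comp ctr0 (coh_map (lmul Y r)) =
         bm_comp (Bimap (lmulX_subproof r)) ctr0.
  exact: (congr1 (fun w : bimap hY (forgetl X) => w z) E).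
apply: coh_uniq => y.
rewrite (tmap_compl ctr0) (tmap_compl _ ctr0) coh_unit_nat.
transitivity (g (r *< (y : Y))); first exact: (ctr0E (r *< (y : Y))).
transitivity (tmap (Bimap (lmulX_subproof r)) (bm_id N)
  (g y : tensor (forgetl X) N)).
  exact: (bmZl g r y).
by congr (tmap _ _ _); exact: esym (ctr0E y).
Qed.

Lemma ctr_subproof : @bimod_morph _ _ _ coh_bimod X ctr0.
Proof.
split; first exact: (bmD ctr0); first exact: ctr0Z.
by move=> z a; exact: (bmZr ctr0 z a).
Qed.

Definition ctr : bimap coh_bimod X := Bimap ctr_subproof.

Lemma ctrE y : tmap ctr (bm_id N) (theta y) = g y.
Proof. exact: ctr0E. Qed.

End Transpose.
End Obj.

Lemma cohom_map_subproof (Y Y' : rcomod R D) (f : rcomod_map Y Y') :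
  @bimod_morph _ _ _ (coh_bimod Y) (coh_bimod Y') (coh_map (rforget_map f)).
Proof.
split; first exact: (bmD (coh_map (rforget_map f))); last first.
  by move=> z a; exact: (bmZr (coh_map (rforget_map f)) z a).
move=> r z.
have E : comp (fmap h (rforget_map f : @hom (comod_cat D) _ _)) (fmap h (lmul Y r)) =
         comp (fmap h (lmul Y' r)) (fmap h (rforget_map f : @hom (comod_cat D) _ _)).
  rewrite -!fmapM; congr (fmap h _).
  by apply: rcomod_map_eq => y; exact: (bmZl f r y).
exact: (congr1 (fun w : bimap (coh_mod _) (coh_mod (rforget Y')) => w z) E).
Qed.

Definition cohom_map (Y Y' : rcomod R D) (f : rcomod_map Y Y') :
  bimap (coh_bimod Y) (coh_bimod Y') := Bimap (cohom_map_subproof f).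

Lemma theta_nat (Y Y' : rcomod R D) (f : rcomod_map Y Y') y :
  tmap (cohom_map f) (bm_id N) (theta Y y) = theta Y' (f y).
Proof. exact: (coh_unit_nat (rforget_map f) y). Qed.

End Bimodule.
End Cohom.

Section CohomBicomod.
Variables (k : comPzRingType) (A B : algebra k).
Variables (C : coring A) (D : coring B) (N : bicomod C D).
Let Nr := bc_rcomod N.
Variable h : cohom Nr.

Section Right.
Variables (R : algebra k).

Section Coaction.
Variable X : bimod R A.

Definition lcoact_bimap : bimap (tensor X N) (tensor (tensor X C) N) :=
  bm_comp associ (tmap (bm_id X) (bc_l N)).

Lemma lcoact_bimapE x n : lcoact_bimap (x \ot n) = associ (x \ot bc_l N n).
Proof. by rewrite bm_compE tmapE. Qed.

Lemma lcoact_bimapP t : tens_rcoact (tensor X C) (bc_r N) (lcoact_bimap t) =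
  tmap lcoact_bimap (bm_id D) (tens_rcoact X (bc_r N) t).
Proof.
elim/ot_ind: t => [|x y ex ey|x n]; rewrite ?addE ?ex ?ey //.
rewrite lcoact_bimapE tens_rcoactE.
transitivity (associ (associ (x \ot
   (assoc (tmap (bc_l N) (bm_id D) (bc_r N n)) : tensor C (tensor N D))))).
  rewrite bc_lr.
  elim/ot_ind: (bc_l N n) => [|y z ey ez|c n']; rewrite ?addE ?ey ?ez //.
  by rewrite tmapE !associE tens_rcoactE.
elim/ot_ind: (bc_r N n) => [|y z ey ez|n' d]; rewrite ?addE ?ey ?ez //.
rewrite associE !tmapE lcoact_bimapE.
elim/ot_ind: (bc_l N n') => [|y z ey ez|c n'']; rewrite ?addE ?ey ?ez //.
by rewrite assocE !associE.
Qed.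

Definition lcoact_map :
  rcomod_map (tens_rcomod X Nr) (tens_rcomod (tensor X C) Nr) :=
  @RcomodMap _ _ _ _ (tens_rcomod X Nr) (tens_rcomod (tensor X C) Nr)
    lcoact_bimap lcoact_bimapP.

End Coaction.

Variable Y : rcomod R D.
Let hY := coh_bimod h Y.
Let th : bimap Y (tensor hY N) := theta h Y.

(* The right C-coaction of h_D(N, Y): the unique map whose composite with
   theta is (h_D(N, Y) (x)_A lambda_N) theta, see [cohom_rcoactE] and
   [theta_uniq]. *)
Definition cohom_rcoact : bimap hY (tensor hY C) :=
  ctr h (rcomod_comp (lcoact_map hY) (theta_map h Y)).

Lemma cohom_rcoactE y :
  tmap cohom_rcoact (bm_id N) (th y) = associ (tmap (bm_id hY) (bc_l N) (th y)).
Proof. exact: (ctrE h (rcomod_comp (lcoact_map hY) (theta_map h Y)) y). Qed.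

Lemma cohom_rcoactP : is_rcoaction cohom_rcoact.
Proof.
split=> z.
- suff E : bm_comp assoc (bm_comp (tmap cohom_rcoact (bm_id C)) cohom_rcoact) =
           bm_comp (tmap (bm_id hY) (Delta C)) cohom_rcoact.
    exact: (congr1 (fun w : bimap hY _ => w z) E).
  apply: theta_uniq => y.
  rewrite (tmap_compl assoc) (tmap_compl _ cohom_rcoact).
  rewrite (tmap_compl _ cohom_rcoact) [tmap cohom_rcoact _ _]cohom_rcoactE.
  transitivity (tmap assoc (bm_id N) (associ (tmap (bm_id _) (bc_l N)
     (tmap cohom_rcoact (bm_id N) (th y))))).
    congr (tmap _ _ _).
    elim/ot_ind: (th y) => [|u v eu ev|u n]; rewrite ?addE ?eu ?ev //.
    rewrite !tmapE.
    elim/ot_ind: (bc_l N n) => [|v w ev ew|c n']; rewrite ?addE ?ev ?ew //.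
    by rewrite !(associE, tmapE).
  rewrite cohom_rcoactE.
  elim/ot_ind: (th y) => [|u v eu ev|u n]; rewrite ?addE ?eu ?ev //.
  rewrite !tmapE.
  transitivity (associ ((u : hY) \ot associ (tmap (bm_id C) (bc_l N) (bc_l N n)))).
    elim/ot_ind: (bc_l N n) => [|v w ev ew|c n']; rewrite ?addE ?ev ?ew //.
    rewrite associE !tmapE.
    elim/ot_ind: (bc_l N n') => [|v w ev ew|c' n'']; rewrite ?addE ?ev ?ew //.
    by rewrite !(associE, assocE, tmapE).
  rewrite -(proj1 (bc_lP N)) assocK.
  elim/ot_ind: (bc_l N n) => [|v w ev ew|c n']; rewrite ?addE ?ev ?ew //.
  by rewrite !(associE, tmapE).
- suff E : bm_comp runit (bm_comp (tmap (bm_id hY) (counit C)) cohom_rcoact) =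
           bm_id hY.
    exact: (congr1 (fun w : bimap hY _ => w z) E).
  apply: theta_uniq => y.
  rewrite (tmap_compl runit) (tmap_compl _ cohom_rcoact).
  rewrite [tmap cohom_rcoact _ _]cohom_rcoactE tmap_id.
  rewrite -[RHS]/(th y).
  elim/ot_ind: (th y) => [|u v eu ev|u n]; rewrite ?addE ?eu ?ev //.
  rewrite tmapE -{2}(proj2 (bc_lP N) n).
  elim/ot_ind: (bc_l N n) => [|v w ev ew|c n']; rewrite ?addE ?ev ?ew //.
  by rewrite !(associE, tmapE) runitE lunitE ot_bal.
Qed.

Definition cohom_rcomod : rcomod R C := Rcomod cohom_rcoactP.

End Right.

(* The canonical map X (x)_R h_D(N, Y) -> h_D(N, X (x)_R Y), which sends
   x (x) z to h_D(N, x (x) -)(z). *)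
Section Upsilon.
Variables (S R : algebra k) (X : bimod S R) (Y : rcomod R D).
Let XY := tens_rcomod X Y.

Lemma tins_subproof (x : X) :
  @bimod_morph _ _ _ (forgetl Y) (forgetl XY) (fun y : Y => x \ot y).
Proof.
split=> [y y'|l y|y b].
- exact: (@otDr _ _ _ _ X Y x y y').
- change (x \ot (alg_str R l *< (y : Y)) = alg_str S l *< (x \ot (y : Y))).
  by rewrite -ot_bal -bm_sym otZl.
- by change (x \ot ((y : Y) >* b) = (x \ot (y : Y)) >* b); rewrite otZr.
Qed.

Lemma tins_aux (x : X) (t : tensor Y D) :
  associ (x \ot t) = ltens (fun y : Y => x \ot y) t.
Proof.
have gD : {morph (fun y : Y => x \ot y) : y y' / y + y'} by move=> *; exact: otDr.
have gZ (y : Y) b : x \ot (y >* b) = (x \ot y) >* b by rewrite otZr.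
elim/ot_ind: t => [|v w ev ew|y d].
- by rewrite ot0r bm0 ltens0.
- by rewrite otDr bmD ltensD // ev ew.
- by rewrite associE ltensE.
Qed.

Lemma tins_mapP (x : X) (y : Y) :
  tens_rcoact X (rc_coact Y) (x \ot y) = ltens (fun y : Y => x \ot y) (rc_coact Y y).
Proof. by rewrite tens_rcoactE tins_aux. Qed.

Definition tins (x : X) : rcomod_map (rforget Y) (rforget XY) :=
  @RcomodMap _ _ _ _ (rforget Y) (rforget XY) (Bimap (tins_subproof x)) (tins_mapP x).

Definition upsilon0 (x : X) (z : coh_bimod h Y) : coh_bimod h XY :=
  coh_map h (tins x) z.

Lemma upsilon_unit x y :
  tmap (coh_map h (tins x)) (bm_id Nr) (coh_unit h (rforget Y) y) =
  theta h XY (x \ot y).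
Proof. exact: (coh_unit_nat h (tins x) y). Qed.

Lemma upsilon_subproof : bilin upsilon0.
Proof.
have subD (z : coh_mod h (rforget Y)) x x' : coh_map h (tins (x + x')) z =
    coh_map h (tins x) z + coh_map h (tins x') z.
  suff -> : coh_map h (tins (x + x')) =
            badd (coh_map h (tins x)) (coh_map h (tins x')) by [].
  apply: coh_uniq => y; rewrite tmap_badd.
  rewrite -[LHS]/(tmap (coh_map h (tins (x + x'))) (bm_id Nr)
    (coh_unit h (rforget Y) y)).
  by rewrite !upsilon_unit otDl bmD.
split; first split.
- by move=> x x' z; exact: subD.
- by move=> x z z'; exact: (bmD (coh_map h (tins x))).
- move=> x r z.
  have E : fmap h (tins (x >* r) : @hom (comod_cat D) _ _) =
    comp (fmap h (tins x : @hom (comod_cat D) _ _)) (fmap h (lmul Y r)).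
    rewrite -fmapM; congr (fmap h _).
    by apply: rcomod_map_eq => y; exact: (ot_bal x r (y : Y)).
  exact: (congr1 (fun w : bimap (coh_mod h (rforget Y)) (coh_mod h (rforget XY)) => w z) E).
- move=> s x z.
  have E : fmap h (tins (s *< x) : @hom (comod_cat D) _ _) =
    comp (fmap h (lmul XY s)) (fmap h (tins x : @hom (comod_cat D) _ _)).
    rewrite -fmapM; congr (fmap h _).
    by apply: rcomod_map_eq => y; exact: esym (otZl s x (y : Y)).
  exact: (congr1 (fun w : bimap (coh_mod h (rforget Y)) (coh_mod h (rforget XY)) => w z) E).
- by move=> x z a; exact: (bmZr (coh_map h (tins x)) z a).
Qed.

Definition upsilon : bimap (tensor X (coh_bimod h Y)) (coh_bimod h XY) :=
  blift upsilon_subproof.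

Lemma upsilonE x z : upsilon (x \ot z) = coh_map h (tins x) z.
Proof. exact: bliftE. Qed.

Let hY := coh_bimod h Y.
Let th : bimap Y (tensor hY N) := theta h Y.

Definition upsilon_inv0 : bimap (tensor X Y) (tensor (tensor X hY) N) :=
  bm_comp associ (tmap (bm_id X) th).

Lemma upsilon_inv0E x y : upsilon_inv0 (x \ot y) = associ (x \ot th y).
Proof. by rewrite bm_compE tmapE. Qed.

Lemma upsilon_inv0P t :
  tens_rcoact (tensor X hY) (bc_r N) (upsilon_inv0 t) =
  tmap upsilon_inv0 (bm_id D) (tens_rcoact X (rc_coact Y) t).
Proof.
elim/ot_ind: t => [|x y ex ey|x y]; rewrite ?addE ?ex ?ey //.
rewrite upsilon_inv0E tens_rcoactE.
transitivity (tmap associ (bm_id D) (associ (x \ot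
   (tens_rcoact hY (bc_r N) (th y) : tensor (tensor hY N) D)))); last first.
  have -> : tens_rcoact hY (bc_r N) (th y) = tmap th (bm_id D) (rc_coact Y y).
    exact: (rc_mapP (theta_map h Y) y).
  elim/ot_ind: (rc_coact Y y) => [|v w ev ew|y' d]; rewrite ?addE ?ev ?ew //.
  by rewrite !(associE, tmapE) upsilon_inv0E.
elim/ot_ind: (th y) => [|v w ev ew|z n]; rewrite ?addE ?ev ?ew //.
rewrite associE !tens_rcoactE.
elim/ot_ind: (bc_r N n) => [|v w ev ew|n' d]; rewrite ?addE ?ev ?ew //.
by rewrite !(associE, tmapE).
Qed.

Definition upsilon_inv_map :
  rcomod_map XY (tens_rcomod (tensor X hY) Nr) :=
  @RcomodMap _ _ _ _ XY (tens_rcomod (tensor X hY) Nr)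
    upsilon_inv0 upsilon_inv0P.

(* The inverse of [upsilon], see [upsilonK] and [upsilon_invK]. *)
Definition upsilon_inv : bimap (coh_bimod h XY) (tensor X hY) :=
  ctr h upsilon_inv_map.

Lemma upsilon_invE (t : tensor X Y) :
  tmap upsilon_inv (bm_id N) (theta h XY t) = upsilon_inv0 t.
Proof. exact: (ctrE h upsilon_inv_map t). Qed.

Lemma tpur_subproof (x : X) :
  @bimod_morph _ _ _ (coh_mod h (rforget Y)) (forgetl (tensor X hY))
    (fun z : hY => x \ot z).
Proof.
split=> [z z'|l z|z a].
- exact: (@otDr _ _ _ _ X hY x z z').
- rewrite (@bm_sym _ _ _ (coh_mod h (rforget Y)) l z).
  change (x \ot ((z : hY) >* alg_str A l) = alg_str S l *< (x \ot (z : hY))).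
  by rewrite bm_sym otZr.
- by change (x \ot ((z : hY) >* a) = (x \ot (z : hY)) >* a); rewrite otZr.
Qed.

Lemma upsilonK : cancel upsilon upsilon_inv.
Proof.
elim/ot_ind=> [|v w ev ew|x z]; rewrite ?addE ?ev ?ew //.
rewrite upsilonE.
suff E : bm_comp (Bimap (of_coh_subproof upsilon_inv)) (coh_map h (tins x)) =
         Bimap (tpur_subproof x).
  exact: (congr1 (fun w : bimap (coh_mod h (rforget Y)) (forgetl (tensor X hY)) => w z) E).
apply: coh_uniq => y; rewrite (tmap_compl _ (coh_map h (tins x))).
transitivity (tmap upsilon_inv (bm_id N) (theta h XY (x \ot y))).
  rewrite -[LHS]/(tmap (Bimap (of_coh_subproof upsilon_inv)) (bm_id Nr)
    (tmap (coh_map h (tins x)) (bm_id Nr) (coh_unit h (rforget Y) y))).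
  by rewrite upsilon_unit.
rewrite upsilon_invE upsilon_inv0E.
transitivity (ltens (fun z : hY => x \ot z) (th y)); last by [].
have gD : {morph (fun z : hY => x \ot z) : y y' / y + y'} by move=> *; exact: otDr.
have gZ (z' : hY) b : x \ot (z' >* b) = (x \ot z') >* b by rewrite otZr.
elim/ot_ind: (th y) => [|v w ev ew|z' n].
- by rewrite ot0r bm0 ltens0.
- by rewrite otDr bmD ltensD // ev ew.
- by rewrite associE ltensE.
Qed.

Lemma upsilon_invK : cancel upsilon_inv upsilon.
Proof.
move=> t; suff E : bm_comp upsilon upsilon_inv = bm_id _.
  exact: (congr1 (fun w : bimap _ (coh_bimod h XY) => w t) E).
apply: theta_uniq => y; rewrite (tmap_compl upsilon) tmap_id.
rewrite [tmap upsilon_inv _ _]upsilon_invE.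
rewrite -[RHS]/(theta h XY (y : tensor X Y)).
move: (y : tensor X Y) => {}y.
elim/ot_ind: y => [|v w ev ew|x y]; rewrite ?addE ?ev ?ew //.
rewrite -upsilon_unit upsilon_inv0E.
transitivity (ltens (coh_map h (tins x) : hY -> coh_bimod h XY) (th y)); last by [].
have gD : {morph (coh_map h (tins x) : hY -> coh_bimod h XY) : y y' / y + y'}.
  exact: (bmD (coh_map h (tins x))).
have gZ (z' : hY) b : (coh_map h (tins x) : hY -> coh_bimod h XY) (z' >* b) =
   (coh_map h (tins x) : hY -> coh_bimod h XY) z' >* b.
  exact: (bmZr (coh_map h (tins x)) z' b).
elim/ot_ind: (th y) => [|v w ev ew|z' n].
- by rewrite ot0r !bm0 ltens0.
- by rewrite otDr !bmD ltensD // ev ew.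
- by rewrite associE tmapE upsilonE ltensE.
Qed.

End Upsilon.

Section Left.
Variables (R : algebra k) (E : coring R) (Y : bicomod E D).
Let Yr := bc_rcomod Y.
Let hY := coh_bimod h Yr.
Let th : bimap Y (tensor hY N) := theta h Yr.

Definition bc_l_map : rcomod_map Yr (tens_rcomod E Yr).
Proof.
refine (@RcomodMap _ _ _ _ Yr (tens_rcomod E Yr) (bc_l Y) _) => y.
rewrite -[LHS]/(associ (tmap (bm_id E) (bc_r Y) (bc_l Y y))).
by rewrite -bc_lr assocK.
Defined.

(* The composite h_D(N, Y) -> h_D(N, E (x)_R Y) -> E (x)_R h_D(N, Y) of
   h_D(N, lambda_Y) and the inverse of the canonical map; for Y = D this is the
   left D-coaction of h_D(N, D). *)
Definition cohom_lcoact : bimap hY (tensor E hY) :=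
  bm_comp (upsilon_inv E Yr) (cohom_map h bc_l_map).

Lemma cohom_lcoactE y :
  tmap cohom_lcoact (bm_id N) (th y) =
  associ (tmap (bm_id E) th (bc_l Y y)).
Proof.
rewrite (tmap_compl (upsilon_inv E Yr)).
transitivity (tmap (upsilon_inv E Yr) (bm_id N)
   (theta h (tens_rcomod E Yr) (bc_l Y y))).
  congr (tmap _ _ _); exact: (theta_nat h bc_l_map y).
exact: (upsilon_invE (X := E) (Y := Yr) (bc_l Y y)).
Qed.

Lemma cohom_lcoactP : is_lcoaction cohom_lcoact.
Proof.
split=> z.
- suff EE : bm_comp assoc (bm_comp (tmap (Delta E) (bm_id hY)) cohom_lcoact) =
            bm_comp (tmap (bm_id E) cohom_lcoact) cohom_lcoact.
    exact: (congr1 (fun w : bimap hY _ => w z) EE).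
  apply: theta_uniq => y.
  rewrite (tmap_compl assoc) !(tmap_compl _ cohom_lcoact).
  rewrite [tmap cohom_lcoact _ _]cohom_lcoactE.
  transitivity (associ (tmap (bm_id E) (bm_comp associ (tmap (bm_id E) th))
     (assoc (tmap (Delta E) (bm_id Y) (bc_l Y y))))).
    elim/ot_ind: (bc_l Y y) => [|v w ev ew|e y']; rewrite ?addE ?ev ?ew //.
    rewrite !tmapE.
    transitivity (tmap assoc (bm_id N) (associ (Delta E e \ot th y'))).
      congr (tmap _ _ _).
      elim/ot_ind: (th y') => [|v w ev ew|z' n]; rewrite ?addE ?ev ?ew //.
      by rewrite associE !tmapE associE.
    elim/ot_ind: (Delta E e) => [|v w ev ew|e1 e2]; rewrite ?addE ?ev ?ew //.
    rewrite assocE tmapE bm_compE tmapE.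
    elim/ot_ind: (th y') => [|v w ev ew|z' n]; rewrite ?addE ?ev ?ew //.
    by rewrite !(associE, assocE, tmapE).
  rewrite (proj1 (bc_lP Y)).
  elim/ot_ind: (bc_l Y y) => [|v w ev ew|e y']; rewrite ?addE ?ev ?ew //.
  rewrite !tmapE bm_compE -cohom_lcoactE.
  elim/ot_ind: (th y') => [|v w ev ew|z' n]; rewrite ?addE ?ev ?ew //.
  by rewrite !(associE, assocE, tmapE).
- suff EE : bm_comp lunit (bm_comp (tmap (counit E) (bm_id hY)) cohom_lcoact) =
            bm_id hY.
    exact: (congr1 (fun w : bimap hY _ => w z) EE).
  apply: theta_uniq => y.
  rewrite (tmap_compl lunit) (tmap_compl _ cohom_lcoact).
  rewrite [tmap cohom_lcoact _ _]cohom_lcoactE tmap_id.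
  rewrite -[RHS]/(th y) -{2}(proj2 (bc_lP Y) y).
  elim/ot_ind: (bc_l Y y) => [|v w ev ew|e y']; rewrite ?addE ?ev ?ew //.
  rewrite !tmapE lunitE bmZl.
  elim/ot_ind: (th y') => [|v w ev ew|z' n]; rewrite ?addE ?ev ?ew //.
  by rewrite !(associE, tmapE) lunitE otZl.
Qed.

Lemma cohom_lr z :
  assoc (tmap cohom_lcoact (bm_id C) (cohom_rcoact Yr z)) =
  tmap (bm_id E) (cohom_rcoact Yr) (cohom_lcoact z).
Proof.
suff EE : bm_comp assoc (bm_comp (tmap cohom_lcoact (bm_id C)) (cohom_rcoact Yr)) =
          bm_comp (tmap (bm_id E) (cohom_rcoact Yr)) cohom_lcoact.
  exact: (congr1 (fun w : bimap hY _ => w z) EE).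
apply: theta_uniq => y.
rewrite (tmap_compl assoc) (tmap_compl _ (cohom_rcoact Yr)).
rewrite (tmap_compl _ cohom_lcoact) [tmap cohom_lcoact _ _]cohom_lcoactE.
rewrite [tmap (cohom_rcoact Yr) _ _]cohom_rcoactE.
transitivity (tmap assoc (bm_id N) (lcoact_bimap (tensor E hY)
   (tmap cohom_lcoact (bm_id N) (th y)))).
  congr (tmap _ _ _).
  rewrite -[theta h Yr y]/(th y).
  elim/ot_ind: (th y) => [|v w ev ew|z' n]; rewrite ?addE ?ev ?ew //.
  rewrite !tmapE lcoact_bimapE.
  elim/ot_ind: (bc_l N n) => [|v w ev ew|c n']; rewrite ?addE ?ev ?ew //.
  by rewrite !(associE, tmapE).
rewrite cohom_lcoactE.
elim/ot_ind: (bc_l Y y) => [|v w ev ew|e y']; rewrite ?addE ?ev ?ew //.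
rewrite !tmapE.
transitivity (associ (e \ot (lcoact_bimap hY (th y')))).
  elim/ot_ind: (th y') => [|v w ev ew|z' n]; rewrite ?addE ?ev ?ew //.
  rewrite associE !lcoact_bimapE.
  elim/ot_ind: (bc_l N n) => [|v w ev ew|c n']; rewrite ?addE ?ev ?ew //.
  by rewrite !(associE, assocE, tmapE).
rewrite -[lcoact_bimap hY (th y')]/(associ (tmap (bm_id hY) (bc_l N) (th y'))).
rewrite -cohom_rcoactE.
elim/ot_ind: (theta h Yr y') => [|v w ev ew|z' n]; rewrite ?addE ?ev ?ew //.
by rewrite !(associE, tmapE).
Qed.

Definition cohom_bicomod : bicomod E C :=
  Bicomod cohom_lcoactP (cohom_rcoactP Yr) cohom_lr.

End Left.
End CohomBicomod.

(* Main.v *)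
(** Put W = B (x)_A C, N = C (x)_A B and let F be the induction functor.  A
    D-colinear map F(M) -> Y amounts to a C-colinear map from M to the cotensor
    product of Y and W over D, namely m |-> f(m_0 (x) 1) (x) 1 (x) m_1.

    If N is quasi-finite, Y |-> h_D(N, Y) is always left adjoint to F: the
    coaction of h = h_D(N, Y) identifies h (x)_A B with the cotensor product of
    h and N over C, and the unit of the cohom adjunction takes values in it.
    Applying h_D(N, -) to the coaction of Y gives sigma : h_D(N, Y) -> Y (x)_B
    h_D(N, D).  When sigma identifies h_D(N, Y) with the cotensor product of Y
    and h_D(N, D), and h_D(N, D) is isomorphic to W, then h_D(N, -) is right
    adjoint to F as well.  The identification is tested against maps into the
    character module E = Hom_Z(A, Q/Z), a cogenerator of M_A: such maps
    correspond to colinear maps into E (x)_A N, which can be extended because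
    E (x)_A N is injective (N injector) or because the coactions of D-comodules
    split naturally (D coseparable).

    Conversely, if G is left and right adjoint to F, then - (x)_A N, being F
    after the cofree functor, is right adjoint to G followed by the forgetful
    functor, which preserves monomorphisms; and G(D) is isomorphic to W because
    G is right adjoint to F. *)
From HB Require Import structures.
From mathcomp Require Import all_boot all_order all_algebra.
From mathcomp Require Import boolp classical_sets.
Require Import Defs.

Set Implicit Arguments.
Unset Strict Implicit.
Unset Printing Implicit Defensive.
Import Order.TTheory GRing.Theory Num.Theory.
Local Open Scope ring_scope.

(** * Adjunctions, submodules and subcomodules *)

Section Universal.
Variables (C D : category) (F : functor C D) (G : functor D C).

(** The counit at [y] is the factorisation of the identity of [G y]; its naturality and the other
    triangle follow from uniqueness of factorisations. The unit is recorded in the conclusion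
    because the cohom coaction is later compared through it. *)
Lemma adjunction_of_unit (eta : forall x, hom x (G (F x))) :
  (forall x x' (f : hom x x'), comp (fmap G (fmap F f)) (eta x) = comp (eta x') f) ->
  (forall x y (g : hom x (G y)), exists f : hom (F x) y, comp (fmap G f) (eta x) = g) ->
  (forall x y (f f' : hom (F x) y),
     comp (fmap G f) (eta x) = comp (fmap G f') (eta x) -> f = f') ->
  exists adj : adjunction F G, forall x, adj_unit adj x = eta x.
Proof.
move=> nat ex uniq.
pose e y := projT1 (cid (ex (G y) y (idm (G y)))).
have eE y : comp (fmap G (e y)) (eta (G y)) = idm (G y) by rewrite /e; case: cid.
suff [h1 h2] : (forall y y' (g : hom y y'), comp g (e y) = comp (e y') (fmap F (fmap G g))) /\
  (forall x, comp (e (F x)) (fmap F (eta x)) = idm (F x)).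
  by exists (@Adjunction C D F G eta e nat h1 h2 eE).
split=> [y y' g|x]; apply: uniq.
  by rewrite !fmapM -!compA eE nat comp1r compA eE comp1l.
by rewrite !fmapM -!compA nat compA eE fmap1.
Qed.

Lemma adjunction_of_counit (e : forall y, hom (F (G y)) y) :
  (forall y y' (g : hom y y'), comp g (e y) = comp (e y') (fmap F (fmap G g))) ->
  (forall x y (f : hom (F x) y), exists g : hom x (G y), comp (e y) (fmap F g) = f) ->
  (forall x y (g g' : hom x (G y)),
     comp (e y) (fmap F g) = comp (e y) (fmap F g') -> g = g') ->
  inhabited (adjunction F G).
Proof.
move=> nat ex uniq.
pose eta x := projT1 (cid (ex x (F x) (idm (F x)))).
have etaE x : comp (e (F x)) (fmap F (eta x)) = idm (F x) by rewrite /eta; case: cid.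
suff [h1 h2] : (forall x x' (f : hom x x'),
      comp (fmap G (fmap F f)) (eta x) = comp (eta x') f) /\
  (forall y, comp (fmap G (e y)) (eta (G y)) = idm (G y)).
  by exists; exact: (@Adjunction C D F G eta e h1 nat etaE h2).
split=> [x x' f|y]; apply: uniq.
  by rewrite !fmapM !compA -nat etaE comp1l -compA etaE comp1r.
by rewrite !fmapM compA -nat -compA etaE fmap1 comp1r.
Qed.

Variable adj : adjunction F G.

Lemma adj_counit_uniq x y (u v : hom x (G y)) :
  comp (adj_counit adj y) (fmap F u) = comp (adj_counit adj y) (fmap F v) -> u = v.
Proof.
move=> e; suff E (w : hom x (G y)) :
    w = comp (fmap G (comp (adj_counit adj y) (fmap F w))) (adj_unit adj x).
  by rewrite [u]E e -E.
by rewrite fmapM -compA adj_unit_nat compA adj_triangleR comp1l.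
Qed.

Lemma adj_transposeR x y (f : hom (F x) y) :
  comp (adj_counit adj y) (fmap F (comp (fmap G f) (adj_unit adj x))) = f.
Proof. by rewrite fmapM compA -adj_counit_nat -compA adj_triangleL comp1r. Qed.

Lemma right_adjoint_mono x y (f : hom x y) : mono f -> mono (fmap G f).
Proof.
move=> fm z g h e; apply: adj_counit_uniq; apply: fm.
by rewrite !compA !adj_counit_nat -!compA -!fmapM e.
Qed.

(** An extension problem for [G i] along [f] is transposed to one for [i] along [fmap F f], and its
    solution is transposed back. *)
Lemma right_adjoint_injectives :
  (forall x y (f : hom x y), mono f -> mono (fmap F f)) -> preserves_injectives G.
Proof.
move=> Fm i inj x y f fm g.
have [h hE] := inj _ _ _ (Fm _ _ _ fm) (transpose adj g).
exists (comp (fmap G h) (adj_unit adj y)).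
by rewrite -compA -adj_unit_nat compA -fmapM hE transposeE.
Qed.

End Universal.

(** * Submodules, kernels, images and differences of maps *)

Section SubBimod.
Variables (k : comPzRingType) (A B : algebra k) (M : bimod A B).

Record submod := Submod {
  sub_mem :> M -> Prop;
  sub_zero : sub_mem 0;
  sub_add : forall x y, sub_mem x -> sub_mem y -> sub_mem (x + y);
  sub_lact : forall a x, sub_mem x -> sub_mem (a *< x);
  sub_ract : forall b x, sub_mem x -> sub_mem (x >* b) }.

Variable K : submod.

(** Membership is made boolean so that [val] is injective and the choice structure is inherited from
    [M]. *)
Definition sub_sort := {x : M | `[< K x >]}.
HB.instance Definition _ := Choice.on sub_sort.
HB.instance Definition _ := SubChoice.on sub_sort.

Definition sub_in x (Kx : K x) : sub_sort := exist _ x (asboolT Kx).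
Lemma subP (x : sub_sort) : K (val x). Proof. by case: x => x /= /asboolP. Qed.

Lemma sub_ext (x y : sub_sort) : val x = val y -> x = y.
Proof. exact: val_inj. Qed.

(** Opposites come from the action of -1, so [submod] does not ask for them. *)
Lemma sub_opp x : K x -> K (- x).
Proof.
move=> Kx; suff -> : - x = (-1) *< x by exact: sub_lact.
apply: (addrI x); rewrite subrr -{1}[x]lact1 -lactDl subrr.
by apply/esym/(morphD0 (f := fun a : A => a *< x)) => a b; rewrite lactDl.
Qed.

Definition sub0 : sub_sort := sub_in (sub_zero K).
Definition subD (x y : sub_sort) : sub_sort := sub_in (sub_add (subP x) (subP y)).
Definition subN (x : sub_sort) : sub_sort := sub_in (sub_opp (subP x)).

Lemma subDA : associative subD.
Proof. by move=> x y z; apply: val_inj; rewrite /= addrA. Qed.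
Lemma subDC : commutative subD.
Proof. by move=> x y; apply: val_inj; rewrite /= addrC. Qed.
Lemma sub0D : left_id sub0 subD.
Proof. by move=> x; apply: val_inj; rewrite /= add0r. Qed.
Lemma subND : left_inverse sub0 subN subD.
Proof. by move=> x; apply: val_inj; rewrite /= addNr. Qed.
HB.instance Definition _ := GRing.isZmodule.Build sub_sort subDA subDC sub0D subND.

Definition sub_bimod : bimod A B.
Proof.
refine (@Bimod k A B sub_sort (fun a x => sub_in (sub_lact a (subP x)))
  (fun x b => sub_in (sub_ract b (subP x))) _ _ _ _ _ _ _ _ _ _) => *;
  by apply: val_inj; rewrite /= ?(lactDl, lactDr, lactA, lact1,
   ractDl, ractDr, ractA, ract1, lractA, bm_sym).
Defined.

Lemma sub_val_subproof : bimod_morph (val : sub_bimod -> M).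
Proof. by []. Qed.
Definition sub_val : bimap sub_bimod M := Bimap sub_val_subproof.

Lemma sub_val_inj : injective sub_val.
Proof. by move=> x y e; exact: sub_ext. Qed.

Variables (X : bimod A B) (f : bimap X M) (fK : forall x, K (f x)).

Lemma corestr_subproof : bimod_morph (fun x => sub_in (fK x) : sub_bimod).
Proof. by split=> [x y|a x|x b]; apply: sub_ext; rewrite /= ?(bmD, bmZl, bmZr). Qed.
Definition corestr : bimap X sub_bimod := Bimap corestr_subproof.

End SubBimod.

Section Kernel.
Variables (k : comPzRingType) (A B : algebra k) (M M' : bimod A B) (f : bimap M M').

Definition ker_submod : submod M.
Proof.
refine (@Submod _ _ _ M (fun x => f x = 0) (bm0 f) _ _ _) => [x y|a x|b x].
- by rewrite bmD => -> ->; rewrite addr0.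
- by rewrite bmZl => ->; rewrite lact0.
- by rewrite bmZr => ->; rewrite ract0.
Defined.

Definition im_submod : submod M'.
Proof.
refine (@Submod _ _ _ M' (fun y => exists x, f x = y) _ _ _ _).
- by exists 0; rewrite bm0.
- by move=> _ _ [x <-] [y <-]; exists (x + y); rewrite bmD.
- by move=> a _ [x <-]; exists (a *< x); rewrite bmZl.
- by move=> b _ [x <-]; exists (x >* b); rewrite bmZr.
Defined.

Lemma bmB x y : f (x - y) = f x - f y.
Proof. by apply: (addIr (f y)); rewrite -bmD !subrK. Qed.

Lemma ker_inj : (forall x, f x = 0 -> x = 0) -> injective f.
Proof. by move=> h x y e; apply: subr0_eq; apply: h; rewrite bmB e subrr. Qed.

Lemma bzero_subproof : bimod_morph (fun _ : M => 0 : M').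
Proof. by split=> [x y|a x|x b]; rewrite ?addr0 ?lact0 ?ract0. Qed.
Definition bzero : bimap M M' := Bimap bzero_subproof.

Lemma bsub_subproof (g : bimap M M') : bimod_morph (fun x => f x - g x).
Proof.
split=> [x y|a x|x b]; first by rewrite !bmD opprD addrACA.
  by rewrite !bmZl; apply: (addIr (a *< g x)); rewrite subrK -lactDr subrK.
by rewrite !bmZr; apply: (addIr (g x >* b)); rewrite subrK -ractDl subrK.
Qed.
Definition bsub (g : bimap M M') : bimap M M' := Bimap (bsub_subproof g).

End Kernel.

Section TmapBsub.
Variables (k : comPzRingType) (R A S : algebra k) (M M' : bimod R A) (N : bimod A S).

Lemma tmap_bsub (f g : bimap M M') (t : tensor M N) :
  tmap (bsub f g) (bm_id N) t = tmap f (bm_id N) t - tmap g (bm_id N) t.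
Proof.
elim/ot_ind: t => [|x y ex ey|x n]; first by rewrite !bm0 subr0.
  by rewrite ![X in X = _]bmD ex ey !bmD opprD addrACA.
rewrite !tmapE; apply: (addIr (g x \ot n)); rewrite subrK -otDl.
by congr (_ \ot _); rewrite /= subrK.
Qed.

Lemma tmap_bzero (t : tensor M N) : tmap (bzero M M') (bm_id N) t = 0.
Proof.
elim/ot_ind: t => [|x y ex ey|x n]; first by rewrite bm0.
  by rewrite bmD ex ey addr0.
by rewrite tmapE ot0l.
Qed.
End TmapBsub.

(** * Flatness and subcomodules *)

Section Flat.
Variables (k : comPzRingType) (A B : algebra k) (N : bimod A B).
Hypothesis flatN : left_flat N.

(** Injectivity of [f] is exactness of the pair formed by a zero map and [f]; the zero map may start
    at [X] itself. *)
Lemma flat_inj (X Y : rmod A) (f : bimap X Y) :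
  injective f -> injective (tmap f (bm_id N)).
Proof.
move=> fi; apply: ker_inj => t e.
have ex : exact_pair (bzero X X) f.
  move=> y; split=> [e'|[x <-]]; last by rewrite bm0.
  by exists 0; apply: fi; rewrite e' !bm0.
by have [t' <-] := (flatN ex t).1 e; exact: tmap_bzero.
Qed.

Lemma flat_ker (X Y : rmod A) (f : bimap X Y) (t : tensor X N) :
  tmap f (bm_id N) t = 0 ->
  exists t', tmap (sub_val (ker_submod f)) (bm_id N) t' = t.
Proof.
have ex : exact_pair (sub_val (ker_submod f)) f.
  move=> y; split=> [e|[x <-]]; first by exists (sub_in (K := ker_submod f) e).
  exact: (subP (K := ker_submod f) x).
by move=> e; apply/(flatN ex t).
Qed.
End Flat.

Section Subcomodule.
Variables (k : comPzRingType) (B : algebra k) (D : coring B).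
Hypothesis flatD : left_flat D.

(** By flatness [K (x) D -> M (x) D] and its tensor product with [D] are injective. Preimages chosen
    pointwise are therefore unique, hence linear in [x], and coassociativity can be checked in
    [M (x) D (x) D]. *)
Lemma subcomodule (M : comod_cat D) (K : rmod B)
    (i : bimap K (M : rcomod _ D)) :
  injective i ->
  (forall x, exists t, tmap i (bm_id D) t = rc_coact (M : rcomod _ D) (i x)) ->
  exists2 r : bimap K (tensor K D), is_rcoaction r &
    forall x, tmap i (bm_id D) (r x) = rc_coact (M : rcomod _ D) (i x).
Proof.
move=> ii ex; have iDi := flat_inj flatD ii.
have iDDi := flat_inj flatD iDi.
pose r0 x := projT1 (cid (ex x)).
have r0E x : tmap i (bm_id D) (r0 x) = rc_coact (M : rcomod _ D) (i x).
  by rewrite /r0; case: cid.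
have r0P : bimod_morph r0.
  by split=> [x y|a x|x b]; apply: iDi; rewrite !(r0E, bmD, bmZl, bmZr).
exists (Bimap r0P) => //; split=> x.
  apply: (can_inj (@associK _ _ _ _ _ _ _ _)); apply: iDDi; rewrite assocK.
  rewrite -tmap_compl; have -> : tmap (bm_comp (tmap i (bm_id D)) (Bimap r0P)) (bm_id D) (r0 x) =
     tmap (rc_coact M) (bm_id D) (tmap i (bm_id D) (r0 x)).
    elim/ot_ind: (r0 x) => [|u v eu ev|u d]; rewrite ?addE ?eu ?ev //.
    by rewrite !tmapE bm_compE r0E.
  rewrite r0E.
  have -> : tmap (tmap i (bm_id D)) (bm_id D) (associ (tmap (bm_id K) (Delta D) (r0 x))) =
    associ (tmap (bm_id _) (Delta D) (tmap i (bm_id D) (r0 x))).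
    elim/ot_ind: (r0 x) => [|u v eu ev|u d]; rewrite ?addE ?eu ?ev //.
    rewrite !tmapE; elim/ot_ind: (Delta D d) => [|a b ea eb|a b]; rewrite ?addE ?ea ?eb //.
    by rewrite !(associE, tmapE).
  by rewrite r0E -(proj1 (rc_coactP M)) assocK.
apply: ii; rewrite -[RHS](proj2 (rc_coactP (M : rcomod _ D))) -r0E -[Bimap r0P x]/(r0 x).
elim/ot_ind: (r0 x) => [|u v eu ev|u d]; rewrite ?addE ?eu ?ev //.
by rewrite !tmapE !runitE bmZr.
Qed.

(** By flatness the kernel of [f] is a subcomodule; its inclusion and the zero map have the same
    composite with [f], so they agree. *)
Lemma comod_mono_inj (M M' : comod_cat D) (f : hom M M') :
  mono f -> injective (f : rcomod_map M M').
Proof.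
move=> fm; apply: ker_inj => x fx.
pose K := ker_submod (rc_map (f : rcomod_map M M')).
have [|r rP rE] := @subcomodule M (sub_bimod K) (sub_val K) (@sub_val_inj _ _ _ _ K).
  move=> y; apply: flat_ker => //.
  by rewrite -[LHS](rc_mapP (f : rcomod_map M M')) [X in rc_coact _ X](subP y) bm0.
pose KM := Rcomod rP.
pose g : rcomod_map KM M := @RcomodMap _ _ _ _ KM M (sub_val K) (fun m => esym (rE m)).
have z0 (m : KM) : rc_coact M (bzero KM (M : rcomod _ D) m) =
   tmap (bzero KM (M : rcomod _ D)) (bm_id D) (rc_coact KM m).
  by rewrite tmap_bzero bm0.
pose g' : rcomod_map KM M := RcomodMap z0.
have := fm KM g g'; have E : comp f (g : @hom (comod_cat D) _ _) = comp f (g' : @hom (comod_cat D) _ _).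
  apply: rcomod_map_eq => y.
  by rewrite -[LHS]/(f _) -[RHS]/((f : rcomod_map _ _) 0) bm0 [LHS](subP y).
move=> /(_ E) gg; exact: (congr1 (fun w : rcomod_map KM M => w (sub_in (K := K) fx)) gg).
Qed.

(** Exactness of the functor of maps into [I]: [u] descends to the image of [d], which is a
    subcomodule of [Z] by flatness, and then extends to [Z] because [I] is injective. *)
Lemma injective_factor (I X Z : comod_cat D) (d : hom X Z) (u : hom X I) :
  injective_object I ->
  (forall x, (d : rcomod_map _ _) x = 0 -> (u : rcomod_map _ _) x = 0) ->
  exists w : hom Z I, u = comp w d.
Proof.
move=> inj ker_du.
pose K := im_submod (rc_map (d : rcomod_map X Z)).
have dK x : K ((d : rcomod_map X Z) x) by exists x.
pose d' := corestr dK.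
have dE (t : tensor (X : rcomod _ D) D) :
    tmap (sub_val K) (bm_id D) (tmap d' (bm_id D) t) =
    tmap (d : rcomod_map X Z) (bm_id D) t.
  rewrite -tmap_compl; elim/ot_ind: t => [|a b ea eb|a b]; rewrite ?addE ?ea ?eb //.
have iDi := flat_inj flatD (@sub_val_inj _ _ _ _ K).
have [|r rP rE] := @subcomodule Z (sub_bimod K) (sub_val K) (@sub_val_inj _ _ _ _ K).
  move=> y; have [x xE] := subP y.
  exists (tmap d' (bm_id D) (rc_coact (X : rcomod _ D) x)).
  by rewrite dE -[LHS](rc_mapP (d : rcomod_map X Z)) xE.
have rd x : r (d' x) = tmap d' (bm_id D) (rc_coact (X : rcomod _ D) x).
  by apply: iDi; rewrite rE dE [LHS]rc_mapP.
pose Q := Rcomod rP.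
(* [u] is evaluated at an arbitrarily chosen preimage under [d]; the condition on kernels makes the
   value independent of the choice. *)
pose v0 (q : Q) := (u : rcomod_map X I) (projT1 (cid (subP q))).
have v0E x : v0 (d' x) = (u : rcomod_map X I) x.
  rewrite /v0; case: cid => x' /= xE; apply: subr0_eq; rewrite -bmB; apply: ker_du.
  by rewrite bmB xE subrr.
have d's q : exists x, q = d' x.
  by have [x xE] := subP q; exists x; apply: (@sub_ext _ _ _ _ K); rewrite /= xE.
have v0P : @bimod_morph _ _ _ Q (I : rcomod _ D) v0.
  split=> [x y|a x|x b]; have [x' ->] := d's x.
  - by have [y' ->] := d's y; rewrite -[d' x' + d' y'](bmD d') !v0E bmD.
  - by rewrite -[a *< d' x'](bmZl d') !v0E bmZl.
  - by rewrite -[d' x' >* b](bmZr d') !v0E bmZr.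
have vc (q : Q) : rc_coact I (Bimap v0P q) = tmap (Bimap v0P) (bm_id D) (rc_coact Q q).
  have [x ->] := d's q; rewrite -[X in rc_coact I X]/(v0 _) v0E [LHS]rc_mapP.
  rewrite [rc_coact Q _]rd -tmap_compl.
  elim/ot_ind: (rc_coact _ x) => [|a b ea eb|a b]; rewrite ?addE ?ea ?eb //.
  by rewrite !tmapE bm_compE; congr (_ \ot _); rewrite -v0E.
pose v : rcomod_map Q I := RcomodMap vc.
pose i : rcomod_map Q Z := @RcomodMap _ _ _ _ Q Z (sub_val K) (fun m => esym (rE m)).
have im : mono (i : @hom (comod_cat D) _ _).
  move=> T g g' e; apply: rcomod_map_eq => t; apply: (@sub_val_inj _ _ _ _ K).
  exact: (congr1 (fun w : rcomod_map T Z => w t) e).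
have [w wE] := inj _ _ _ im (v : @hom (comod_cat D) _ _).
exists w; apply: rcomod_map_eq => x; rewrite -v0E.
exact: (congr1 (fun w : rcomod_map Q I => w (d' x)) (esym wE)).
Qed.

End Subcomodule.

Lemma rmod_mono_inj (k : comPzRingType) (A : algebra k) (X Y : rmod_cat A) (f : hom X Y) :
  mono f -> injective (f : bimap X Y).
Proof.
move=> fm; apply: ker_inj => x fx.
pose K := ker_submod (f : bimap X Y).
have := fm (sub_bimod K) (sub_val K) (bzero _ _).
have E : comp f (sub_val K : @hom (rmod_cat A) _ _) =
   comp f (bzero (sub_bimod K) (X : rmod A) : @hom (rmod_cat A) _ _).
  apply: bimap_eq => y.
  by rewrite -[RHS]/((f : bimap X Y) 0) bm0; exact: (subP y).
move=> /(_ E) gg; exact: (congr1 (fun w : bimap (sub_bimod K) X => w (sub_in (K := K) fx)) gg).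
Qed.

(** * Characters and injective modules *)

Section PartialHom.
Variables (T Q : zmodType).
Implicit Types G : T * Q -> Prop.

(* Additive maps defined on a subgroup of [T], through their graphs. *)
Definition partial_hom G :=
  [/\ G 0, forall p q, G p -> G q -> G (p - q) & forall v, G (0, v) -> v = 0].

Lemma partial_homMz G p (n : int) : partial_hom G -> G p -> G (p *~ n).
Proof.
move=> [G0 GB _] Gp.
have GN q : G q -> G (- q) by move=> Gq; rewrite -sub0r; exact: GB.
have Gn (m : nat) : G (p *+ m).
  elim: m => [|m IH]; first by rewrite mulr0n.
  by rewrite mulrSr -[p in X in _ + X]opprK; apply: GB => //; exact: GN.
by case: n => m; [exact: Gn | exact/GN/Gn].
Qed.

(** The generator is the least positive element of the subgroup, or 0 if there is none. *)
Lemma int_subgroup (P : int -> Prop) : P 0 -> (forall m n, P m -> P n -> P (m - n)) ->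
  exists d : nat, P d%:Z /\ forall n, P n -> exists m, n = d%:Z * m.
Proof.
move=> P0 PB; have PN n : P n -> P (- n) by move=> Pn; rewrite -sub0r; exact: PB.
have PD m n : P m -> P n -> P (m + n) by move=> Pm Pn; rewrite -[n]opprK; apply: PB => //; exact: PN.
have PM m n : P m -> P (m * n).
  move=> Pm; have Pk (j : nat) : P (m * j%:Z).
    elim: j => [|j IH]; first by rewrite mulr0.
    by rewrite -addn1 PoszD mulrDr mulr1; exact: PD.
  by case: n => j; rewrite ?NegzE ?mulrN; [|apply: PN]; exact: Pk.
have [[d [d0 Pd]]|no] := pselect (exists d : nat, (0 < d)%N /\ P d%:Z); last first.
  exists 0%N; split=> // n Pn; exists 0; rewrite mulr0.
  case: n Pn => [[|j] //|j] Pn; case: no; exists j.+1; split=> //.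
  by move/PN: Pn; rewrite NegzE opprK.
have ex : exists d : nat, (0 < d)%N && `[< P d%:Z >].
  by exists d; rewrite d0; exact/asboolP.
case: (ex_minnP ex) => e /andP[e0 /asboolP Pe] emin.
exists e; split=> // n Pn; exists (n %/ e%:Z)%Z.
have e_neq0 : e%:Z != 0 by rewrite -lt0n.
have Pr : P (n %% e%:Z)%Z.
  have -> : (n %% e%:Z)%Z = n - e%:Z * (n %/ e%:Z)%Z.
    by rewrite {2}(divz_eq n e%:Z) mulrC addrAC subrr add0r.
  by apply: PB => //; exact: PM.
rewrite {1}(divz_eq n e%:Z) mulrC; suff -> : (n %% e%:Z)%Z = 0 by rewrite addr0.
(* A nonzero remainder would be a positive element of [P] below the minimum [e]. *)
have := modz_ge0 n e_neq0; have := ltz_mod n e_neq0.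
case: (n %% e%:Z)%Z Pr => // [[|j]] // Pj jlt _; have := emin j.+1.
by rewrite andTb => /(_ (asboolT Pj)); rewrite leqNgt -ltz_nat; move: jlt => /= ->.
Qed.

Definition adjoin G (p : T * Q) : T * Q -> Prop :=
  fun w => exists2 g, G g & exists n : int, w = g + p *~ n.

(** The graph stays single-valued because every value that [G] already prescribes at a multiple of
    [x] is the corresponding multiple of [q]. *)
Lemma adjoinP G x q : partial_hom G ->
  (forall n v, G (x *~ n, v) -> v = q *~ n) -> partial_hom (adjoin G (x, q)).
Proof.
move=> GP xq; have [G0 GB Gu] := GP; split.
- by exists 0 => //; exists 0; rewrite mulr0z addr0.
- move=> _ _ [g Gg [n ->]] [g' Gg' [n' ->]]; exists (g - g'); first exact: GB.
  by exists (n - n'); rewrite mulrzBr opprD addrACA.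
- move=> v [g Gg [n E]].
  (* Over 0 the component [g.1] must cancel [x *~ n], so the hypothesis forces [g.2] to cancel
     [q *~ n]. *)
  have e1 : x *~ - n = g.1.
    have := congr1 fst E; rewrite /= (raddfMz fst) mulrNz /= => e.
    by apply/esym/(addIr (x *~ n)); rewrite addNr.
  have e2 : v = g.2 + q *~ n by have := congr1 snd E; rewrite /= (raddfMz snd).
  rewrite e2 (xq (- n) g.2) ?mulrNz ?addNr //.
  by rewrite -mulrNz e1 -surjective_pairing.
Qed.

Lemma adjoin_sub G p g : G g -> adjoin G p g.
Proof. by move=> Gg; exists g => //; exists 0; rewrite mulr0z addr0. Qed.

Lemma adjoin_new G p : partial_hom G -> adjoin G p p.
Proof. by case=> G0 _ _; exists 0 => //; exists 1; rewrite add0r. Qed.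

Definition divisible := forall (x : Q) (n : nat), (0 < n)%N -> exists y, y *+ n = x.

Hypothesis Qdiv : divisible.

(** The integers [n] with [x *~ n] in the domain are the multiples of some [d], and divisibility
    gives [q] whose multiple by [d] is the value [v0] prescribed at [x *~ d]. If [d] is 0, then [v0]
    is 0 and [q := 0] is taken. *)
Lemma partial_hom_step G x : partial_hom G -> exists q, partial_hom (adjoin G (x, q)).
Proof.
move=> GP; have [G0 GB Gu] := GP.
have [d [[v0 Gv0] dP]] : exists d : nat, (exists v, G (x *~ d%:Z, v)) /\
    forall n, (exists v, G (x *~ n, v)) -> exists m, n = d%:Z * m.
  apply: (int_subgroup (P := fun n => exists v, G (x *~ n, v))).
    by exists 0; rewrite mulr0z.
  move=> m n [v Gv] [w Gw]; exists (v - w).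
  by rewrite mulrzBr; exact: (GB (_, _) (_, _)).
have [q qE] : exists q, q *+ d = v0.
  case: d v0 Gv0 {dP} => [|d] v0 Gv0; last exact: Qdiv.
  by exists 0; rewrite mulr0n; apply/esym/Gu; rewrite mulr0z in Gv0.
exists q; apply: adjoinP => // n v Gv.
have [m nE] := dP n (ex_intro _ v Gv).
apply: subr0_eq; apply: Gu; have := GB _ _ Gv (partial_homMz m GP Gv0).
suff -> : (x *~ n, v) - (x *~ d%:Z, v0) *~ m = (0, v - q *~ n) by [].
rewrite [LHS]surjective_pairing; congr (_, _).
  by rewrite /= (raddfMz fst) /= -mulrzA nE subrr.
by rewrite /= (raddfMz snd) /= nE mulrzA -pmulrn qE.
Qed.

Lemma divisible_extension G : partial_hom G ->
  exists2 f : T -> Q, {morph f : x y / x + y} & forall p, G p -> f p.1 = p.2.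
Proof.
(* Zorn's lemma is applied to the graphs containing [G]. The nonemptiness guard admits the empty
   set, which is the union of the empty chain. *)
move=> GP; pose P (A : set (T * Q)) := (exists p, A p) ->
  partial_hom A /\ forall p, G p -> A p.
have [F FP Ftot|A [AP Amax]] := @Zorn_bigcup _ P.
  move=> [p [X FX Xp]].
  have XP Y q (FY : F Y) (Yq : Y q) : partial_hom Y /\ forall p, G p -> Y p.
    by apply: (FP _ FY); exists q.
  split; last by move=> q Gq; exists X => //; exact: (XP X p FX Xp).2.
  split.
  - by exists X => //; have [[]] := XP X p FX Xp.
  - move=> q r [Y FY Yq] [Z FZ Zr].
    have [YZ|ZY] := Ftot _ _ FY FZ.
      by exists Z => //; have [[_ ZB _] _] := XP Z r FZ Zr; apply: ZB => //; exact: YZ.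
    by exists Y => //; have [[_ YB _] _] := XP Y q FY Yq; apply: YB => //; exact: ZY.
  - by move=> v [Y FY Yv]; have [[_ _ Yu] _] := XP Y _ FY Yv; exact: Yu.
(* An empty maximal set would be strictly contained in [G]. *)
have [p Ap] : exists p, A p.
  apply: contrapT => no; apply: (Amax G); last by [].
  split; first by move=> p Ap; case: no; exists p.
  by move=> /(_ 0); case: GP => G0 _ _ /(_ G0) A0; apply: no; exists 0.
have [AH GA] := AP (ex_intro _ p Ap); have [A0 AB Au] := AH.
(* A point outside the domain could be adjoined, against maximality. *)
have Atot x : exists q, A (x, q).
  have [q qP] := partial_hom_step x AH.
  exists q; apply: contrapT => nA; apply: (Amax (adjoin A (x, q))).
    split; first by move=> g; exact: adjoin_sub.
    by move=> /(_ (x, q)) h; apply/nA/h; exact: adjoin_new.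
  by move=> _; split=> // g Gg; exact/adjoin_sub/GA.
have Afun x v w : A (x, v) -> A (x, w) -> v = w.
  move=> Av Aw; apply: subr0_eq; apply: Au.
  by have := AB _ _ Av Aw; rewrite [_ - _]surjective_pairing /= subrr.
pose f x := projT1 (cid (Atot x)).
have fA x : A (x, f x) by rewrite /f; case: cid.
exists f => [x y|[x v] Gp]; last by apply: (Afun x) => //; exact: GA.
apply: (Afun (x + y)) => //.
have := AB _ _ (fA x) (AB _ _ A0 (fA y)).
by rewrite [_ - _]surjective_pairing /= !sub0r !opprK.
Qed.

End PartialHom.

(** * The divisible group Q/Z and separation by characters *)

Definition QmodZ := {ideal_quot (GRing.ZmodClosed.clone rat Num.int_num_subdef _)}.
HB.instance Definition _ := GRing.Zmodule.on QmodZ.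

Section QmodZTheory.
Local Open Scope quotient_scope.

Lemma QmodZ_piD (x y : rat) : \pi_QmodZ (x + y) = \pi_QmodZ x + \pi_QmodZ y.
Proof. by rewrite !piE. Qed.

Lemma QmodZ_piMn (x : rat) n : \pi_QmodZ (x *+ n) = (\pi_QmodZ x : QmodZ) *+ n.
Proof.
elim: n => [|n IH]; first by rewrite !mulr0n piE.
by rewrite !mulrS QmodZ_piD IH.
Qed.

Lemma QmodZ_pi0 (x : rat) : (\pi_QmodZ x == 0 :> QmodZ) = (x \is a Num.int).
Proof.
have -> : (0 : QmodZ) = \pi_QmodZ 0 by rewrite piE.
by rewrite -[LHS]Quotient.idealrBE subr0.
Qed.

Lemma QmodZ_divisible : divisible QmodZ.
Proof.
move=> x n n0; exists (\pi_QmodZ (repr x / n%:R)).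
by rewrite -QmodZ_piMn -(mulr_natr (_ / _)) divfK ?pnatr_eq0 -?lt0n // reprK.
Qed.

(** For [d > 1] the class of 1/d works, since 1/d is not an integer. For [d = 0] any nonzero class
    does, and the class of 1/2 is taken. *)
Lemma QmodZ_torsion (d : nat) : d <> 1%N -> exists2 q : QmodZ, q <> 0 & q *+ d = 0.
Proof.
have tor (e : nat) : (1 < e)%N -> exists2 q : QmodZ, q <> 0 & q *+ e = 0.
  move=> e1; have e0 : (e%:R : rat) != 0 by rewrite pnatr_eq0 -lt0n (ltn_trans _ e1).
  exists (\pi_QmodZ (e%:R^-1)).
    apply/eqP; rewrite QmodZ_pi0; apply/negP => /intrP [m mE].
    have /(congr1 (fun z => z * e%:R)) := mE; rewrite mulVf // -[e%:R]/(e%:Z%:~R) -intrM -[1]/(1%:~R).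
    move/intr_inj => E; have := congr1 absz E; rewrite abszM /= => /esym/eqP.
    by rewrite muln_eq1 => /andP[_ /eqP e1']; rewrite e1' in e1.
  by apply/eqP; rewrite -QmodZ_piMn QmodZ_pi0 -(mulr_natr _^-1) mulVf.
case: d => [|[|d]] // _; last exact: tor.
by have [q q0 _] := tor 2%N isT; exists q.
Qed.
End QmodZTheory.

Section Separation.
Variables (T : zmodType) (P : T -> Prop).
Hypotheses (P0 : P 0) (PB : forall x y, P x -> P y -> P (x - y)).

(** The character is extended from the subgroup generated by [P] and [z], where it kills [P] and
    sends [z] to some nonzero [q]. If the multiples of [z] in [P] are those by multiples of [d], it
    is well defined as soon as [d] kills [q]; such a [q] exists because [d] is not 1. *)
Lemma character_separation z : ~ P z ->
  exists2 f : T -> QmodZ, {morph f : x y / x + y} & (forall x, P x -> f x = 0) /\ f z <> 0.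
Proof.
move=> Pz; pose G (p : T * QmodZ) := P p.1 /\ p.2 = 0.
have GP : partial_hom G.
  split; rewrite /G //=; last by move=> v [].
  by move=> p q [Pp ->] [Pq ->]; rewrite subr0; split=> //; exact: PB.
have [|m n|d [Pd dP]] := int_subgroup (P := fun n => P (z *~ n)).
- by rewrite mulr0z.
- by move=> Pm Pn; rewrite mulrzBr; exact: PB.
have [d1|q q0 qd] := @QmodZ_torsion d; first by apply: Pz; rewrite d1 in Pd.
have [|f fD fE] := divisible_extension QmodZ_divisible (G := adjoin G (z, q)).
  apply: adjoinP => // n v [Pn /= ->].
  by have [m ->] := dP n Pn; rewrite mulrzA -pmulrn qd mul0rz.
exists f => //; split=> [x Px|].
  by apply: (fE (x, 0)); exact: adjoin_sub.
by have -> := fE (z, q) (adjoin_new _ GP).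
Qed.
End Separation.

(** * The character module of A *)

Section CharacterModule.
Variables (k : comPzRingType) (A : algebra k).

Definition char_sort := {f : A -> QmodZ | `[< {morph f : x y / x + y} >]}.
HB.instance Definition _ := Choice.on char_sort.

Definition char_of (f : A -> QmodZ) (fD : {morph f : x y / x + y}) : char_sort :=
  exist _ f (asboolT fD).

Lemma charD (f : char_sort) : {morph val f : x y / x + y}.
Proof. by case: f => f /= /asboolP. Qed.

Lemma char_eq (f g : char_sort) : val f =1 val g -> f = g.
Proof. by move=> e; apply: val_inj; exact/funext. Qed.

Lemma char0_subproof : {morph (fun _ : A => 0 : QmodZ) : x y / x + y}.
Proof. by move=> x y; rewrite addr0. Qed.
Lemma charD_subproof (f g : char_sort) :
  {morph (fun a => val f a + val g a) : x y / x + y}.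
Proof. by move=> x y; rewrite !charD addrACA. Qed.
Lemma charN_subproof (f : char_sort) : {morph (fun a => - val f a) : x y / x + y}.
Proof. by move=> x y; rewrite charD opprD. Qed.

Definition char0 := char_of char0_subproof.
Definition char_add f g := char_of (charD_subproof f g).
Definition char_opp f := char_of (charN_subproof f).

Lemma char_addA : associative char_add.
Proof. by move=> f g h; apply: char_eq => a /=; rewrite addrA. Qed.
Lemma char_addC : commutative char_add.
Proof. by move=> f g; apply: char_eq => a /=; rewrite addrC. Qed.
Lemma char_add0 : left_id char0 char_add.
Proof. by move=> f; apply: char_eq => a /=; rewrite add0r. Qed.
Lemma char_addN : left_inverse char0 char_opp char_add.
Proof. by move=> f; apply: char_eq => a /=; rewrite addNr. Qed.
HB.instance Definition _ :=
  GRing.isZmodule.Build char_sort char_addA char_addC char_add0 char_addN.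

Lemma char_mul_subproof (b : A) (f : char_sort) :
  {morph (fun a => val f (b * a)) : x y / x + y}.
Proof. by move=> x y; rewrite mulrDr charD. Qed.
Definition char_mul b f := char_of (char_mul_subproof b f).

Definition char_mod : rmod A.
Proof.
refine (@Bimod k (base_alg k) A char_sort (fun l f => char_mul (alg_str A l) f)
  (fun f b => char_mul b f) _ _ _ _ _ _ _ _ _ _).
- by move=> l l' f; apply: char_eq => a /=; rewrite rmorphD mulrDl charD.
- by move=> l f g; exact: char_eq.
- by move=> l l' f; apply: char_eq => a /=; rewrite mulrC rmorphM mulrA.
- by move=> f; apply: char_eq => a /=; rewrite rmorph1 mul1r.
- by move=> f g b; exact: char_eq.
- by move=> f b b'; apply: char_eq => a /=; rewrite mulrDl charD.
- by move=> f b b'; apply: char_eq => a /=; rewrite mulrA.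
- by move=> f; apply: char_eq => a /=; rewrite mul1r.
- by move=> l f b; apply: char_eq => a /=; rewrite !mulrA alg_central.
- by [].
Defined.

Section Transpose.
Variables (X : rmod A) (f : X -> QmodZ).
Hypothesis fD : {morph f : x y / x + y}.

Lemma to_char_subproof1 (x : X) : {morph (fun a : A => f (x >* a)) : a b / a + b}.
Proof. by move=> a b; rewrite ractDr fD. Qed.

Lemma to_char_subproof : @bimod_morph _ _ _ X char_mod
  (fun x => char_of (to_char_subproof1 x)).
Proof.
split=> [x y|l x|x b]; apply: char_eq => a /=.
- by rewrite ractDl fD.
- by rewrite bm_sym -ractA.
- by rewrite -ractA.
Qed.

(** Additive maps from [X] to Q/Z correspond to linear maps from [X] to the character module;
    evaluation at 1 is the inverse passage. *)
Definition to_char : bimap X char_mod := Bimap to_char_subproof.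

Lemma to_charE x a : val (to_char x : char_sort) a = f (x >* a).
Proof. by []. Qed.
End Transpose.

(** Evaluation at 1 turns [g] into an additive map on the image of [i], which extends to [Y] because
    Q/Z is divisible; [to_char] makes the extension linear. *)
Lemma char_mod_injective : injective_object (char_mod : rmod_cat A).
Proof.
move=> X Y i /rmod_mono_inj ii g.
pose G (p : ((Y : rmod A) * QmodZ)%type) := exists x : X,
  p = ((i : bimap X Y) x, val ((g : bimap X char_mod) x : char_sort) 1).
have gB (x y : X) : val ((g : bimap X char_mod) (x - y) : char_sort) 1 =
    val ((g : bimap X char_mod) x : char_sort) 1 - val ((g : bimap X char_mod) y : char_sort) 1.
  by rewrite bmB.
have GP : partial_hom G.
  split.
  - by exists 0; rewrite !bm0.
  - by move=> _ _ [x ->] [y ->]; exists (x - y); rewrite gB bmB.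
  - move=> v [x [e ->]]; have -> : x = 0 by apply: ii; rewrite -e bm0.
    by rewrite bm0.
have [f fD fE] := divisible_extension QmodZ_divisible GP.
exists (to_char fD : @hom (rmod_cat A) _ _); apply: bimap_eq => x; apply: char_eq => a.
rewrite -[LHS]/(f ((i : bimap X Y) x >* a)) -bmZr.
rewrite (fE (_, val ((g : bimap X char_mod) (x >* a) : char_sort) 1)); last by exists (x >* a).
by rewrite /= bmZr /= mulr1.
Qed.

(** An additive character separates [z] from [K]. Its linear version still kills [K], as [K] is
    stable under the right action, and evaluation at 1 shows that it does not kill [z]. *)
Lemma char_mod_separation (X : rmod A) (K : submod X) (z : X) : ~ K z ->
  exists2 u : bimap X char_mod, forall x, K x -> u x = 0 & u z <> 0.
Proof.
move=> Kz; have [||f fD [fK fz]] := @character_separation X K _ _ z Kz.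
- exact: sub_zero.
- by move=> x y Kx Ky; apply: sub_add => //; exact: sub_opp.
exists (to_char fD) => [x Kx|].
  by apply: char_eq => a; rewrite to_charE fK //; exact: sub_ract.
by move/(congr1 (fun w : char_sort => val w 1)); rewrite to_charE ract1.
Qed.

End CharacterModule.

(** * Cohom is left adjoint to induction *)

Section CohomFunctor.
Variables (k : comPzRingType) (A B : algebra k) (C : coring A) (D : coring B).
Variables (N : bicomod C D) (h : cohom (bc_rcomod N)).

(** Both composites agree after [theta], by naturality of [theta] and the equation defining the
    coaction. *)
Lemma cohom_map_colin (R : algebra k) (Y Y' : rcomod R D) (f : rcomod_map Y Y') z :
  cohom_rcoact h Y' (cohom_map h f z) =
  tmap (cohom_map h f) (bm_id C) (cohom_rcoact h Y z).
Proof.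
suff E : bm_comp (cohom_rcoact h Y') (cohom_map h f) =
    bm_comp (tmap (cohom_map h f) (bm_id C)) (cohom_rcoact h Y).
  exact: (congr1 (fun w : bimap (coh_bimod h Y) _ => w z) E).
apply: theta_uniq => y.
rewrite (tmap_compl (cohom_rcoact h Y')) (tmap_compl _ (cohom_rcoact h Y)).
rewrite cohom_rcoactE.
transitivity (tmap (cohom_rcoact h Y') (bm_id N) (theta h Y' (f y))).
  congr (tmap _ _ _); exact: theta_nat.
rewrite cohom_rcoactE -theta_nat.
elim/ot_ind: (theta h Y y) => [|u v eu ev|u n]; rewrite ?addE ?eu ?ev //.
rewrite !tmapE; elim/ot_ind: (bc_l N n) => [|v w ev ew|c n']; rewrite ?addE ?ev ?ew //.
by rewrite !(associE, tmapE).
Qed.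

Definition cohom_rcomod_map (R : algebra k) (Y Y' : rcomod R D) (f : rcomod_map Y Y') :
  rcomod_map (cohom_rcomod h Y) (cohom_rcomod h Y') :=
  @RcomodMap _ _ _ _ (cohom_rcomod h Y) (cohom_rcomod h Y')
    (cohom_map h f) (cohom_map_colin f).

Lemma theta_colin (R : algebra k) (Y : rcomod R D) y :
  tens_rcoact (coh_bimod h Y) (bc_r N) (theta h Y y) =
  tmap (theta h Y) (bm_id D) (rc_coact Y y).
Proof. exact: (rc_mapP (theta_map h Y) y). Qed.

Lemma cohom_map1 (R : algebra k) (Y : rcomod R D) : cohom_map h (rcomod_id Y) = bm_id _.
Proof. by apply: theta_uniq => y; rewrite theta_nat tmap_id. Qed.

Lemma cohom_mapM (R : algebra k) (Y Y' Y'' : rcomod R D) (g : rcomod_map Y' Y'')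
    (f : rcomod_map Y Y') :
  cohom_map h (rcomod_comp g f) = bm_comp (cohom_map h g) (cohom_map h f).
Proof.
apply: theta_uniq => y; rewrite (tmap_compl _ (cohom_map h f)).
by rewrite [RHS](congr1 (tmap _ _) (theta_nat h f y)) !theta_nat.
Qed.

Definition cohom_functor : functor (comod_cat D) (comod_cat C).
Proof.
refine (@Functor (comod_cat D) (comod_cat C) (fun Y => cohom_rcomod h Y)
  (fun Y Y' f => cohom_rcomod_map f) _ _) => *; apply: rcomod_map_eq => z.
  by rewrite -[LHS]/(cohom_map h _ z) [cohom_map _ _]cohom_map1.
by rewrite -[LHS]/(cohom_map h _ z) [cohom_map _ _]cohom_mapM.
Defined.

End CohomFunctor.

(** * Induction as the cotensor product with N over C *)

Section InsertCoaction.
Variables (k : comPzRingType) (A B : algebra k) (C : coring A) (D : coring B).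
Variables (phi : coring_hom C D).
Let N := CB_bicomod phi.
Let b_ab := B_AB phi.

Section Delete.
Variables (R : algebra k) (M : bimod R A).

(** The counit of [C] is applied to the factor [C] of [N]. With [ind_ins] it identifies [M (x)_A B]
    with the cotensor product of [M] and [N] over [C]. *)
Definition ind_del : bimap (tensor M N) (tensor M b_ab) :=
  tmap (bm_id M) (bm_comp lunit (tmap (counit C) (bm_id b_ab))).

Lemma ind_delE m c (b : b_ab) : ind_del (m \ot (c \ot b)) = m \ot (counit C c *< b).
Proof. by rewrite tmapE bm_compE tmapE lunitE. Qed.

End Delete.

Lemma ind_del_nat (R : algebra k) (M M' : bimod R A) (f : bimap M M') t :
  ind_del M' (tmap f (bm_id N) t) = tmap f (bm_id b_ab) (ind_del M t).
Proof.
elim/ot_ind: t => [|u v eu ev|m n]; rewrite ?addE ?eu ?ev //.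
by rewrite !tmapE.
Qed.

Section Insert.
Variables (R : algebra k) (M : rcomod R C).
Let r := rc_coact M.

Definition ind_ins : bimap (tensor M b_ab) (tensor M N) :=
  bm_comp assoc (tmap r (bm_id b_ab)).

Lemma ind_insE m b : ind_ins (m \ot b) = assoc (r m \ot b).
Proof. by rewrite bm_compE tmapE. Qed.

Lemma ind_delK : cancel ind_ins (ind_del M).
Proof.
elim/ot_ind=> [|u v eu ev|m b]; rewrite ?addE ?eu ?ev //.
rewrite ind_insE -[in RHS](proj2 (rc_coactP M) m).
elim/ot_ind: (rc_coact M m) => [|u v eu ev|m' c]; rewrite ?addE ?eu ?ev //.
by rewrite assocE ind_delE tmapE runitE ot_bal.
Qed.

(** Coassociativity of [M] puts the image of [ind_ins] inside the cotensor product. *)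
Lemma ind_ins_lcoact t : lcoact_bimap N M (ind_ins t) = tmap r (bm_id N) (ind_ins t).
Proof.
elim/ot_ind: t => [|u v eu ev|m b]; rewrite ?addE ?eu ?ev //.
rewrite ind_insE.
transitivity (assoc (associ (tmap (bm_id M) (Delta C) (r m)) \ot b)).
  elim/ot_ind: (r m) => [|u v eu ev|m' c]; rewrite ?addE ?eu ?ev //.
  rewrite assocE tmapE lcoact_bimapE tens_lcoactE.
  elim/ot_ind: (Delta C c) => [|u v eu ev|c1 c2]; rewrite ?addE ?eu ?ev //.
  by rewrite !(assocE, associE).
rewrite -(proj1 (rc_coactP M)) assocK.
elim/ot_ind: (rc_coact M m) => [|u v eu ev|m' c]; rewrite ?addE ?eu ?ev //.
by rewrite !(tmapE, assocE).
Qed.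

Lemma ind_insK (t : tensor M N) :
  lcoact_bimap N M t = tmap r (bm_id N) t -> ind_ins (ind_del M t) = t.
Proof.
move=> e.
(* [del'] applies the counit to the factor [C] of [N]. After [tmap r (bm_id N)] it gives [ind_ins]
   after [ind_del]; after [lcoact_bimap] it gives the identity, by the counit law. *)
pose del' : bimap (tensor (tensor M C) N) (tensor M N) :=
  bm_comp assoc (ind_del (tensor M C)).
have -> : ind_ins (ind_del M t) = del' (tmap r (bm_id N) t).
  elim/ot_ind: t {e} => [|u v eu ev|m n]; rewrite ?addE ?eu ?ev //.
  elim/ot_ind: n => [|u v eu ev|c b]; rewrite ?addE ?eu ?ev //.
  by rewrite ind_delE ind_insE tmapE bm_compE ind_delE.
rewrite -e; elim/ot_ind: t {e} => [|u v eu ev|m n]; rewrite ?addE ?eu ?ev //.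
rewrite lcoact_bimapE.
elim/ot_ind: n => [|u v eu ev|c b]; rewrite ?addE ?eu ?ev //.
rewrite tens_lcoactE -[in RHS](counitr c).
elim/ot_ind: (Delta C c) => [|u v eu ev|c1 c2]; rewrite ?addE ?eu ?ev //.
by rewrite assocE associE bm_compE ind_delE assocE tmapE runitE ot_bal.
Qed.

Lemma ind_ins_colin t :
  tens_rcoact M (bc_r N) (ind_ins t) = tmap ind_ins (bm_id D) (ind_coact phi r t).
Proof.
elim/ot_ind: t => [|u v eu ev|m b]; rewrite ?addE ?eu ?ev //.
rewrite ind_insE ind_coactE.
(* With [b] fixed, [ind_aux b] is additive and left linear but not a bimodule map, so tensoring it
   with [M] goes through a balanced map. *)
pose J (m' : M) (w : tensor C C) := associ (m' \ot ind_aux b w).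
have Jb : balanced (@ract _ _ _ M) (@lact _ _ _ (tensor C C)) J.
  split=> [x y w|x w w'|x a w]; rewrite /J.
  - by rewrite !addE.
  - by rewrite ind_auxD !addE.
  - by rewrite ind_auxZ ot_bal.
have JE := tliftE Jb; have JD := tliftD Jb; have J0 := tlift0 Jb.
transitivity (tlift J (tmap (bm_id M) (Delta C) (r m))).
  elim/ot_ind: (r m) => [|u v eu ev|m' c]; rewrite ?(addE, JD, J0) ?eu ?ev //.
  by rewrite assocE tens_rcoactE tmapE [RHS]JE /J ind_coactE.
rewrite -(proj1 (rc_coactP M)).
elim/ot_ind: (rc_coact M m) => [|u v eu ev|m' c];
  rewrite ?(addE, JD, J0, ind_auxD, ind_aux0) ?eu ?ev //.
rewrite tmapE ind_auxE tmapE ind_insE.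
elim/ot_ind: (rc_coact M m') => [|u v eu ev|m'' c'];
  rewrite ?(addE, JD, J0, ind_auxD, ind_aux0) ?eu ?ev //.
by rewrite !assocE [LHS]JE /J ind_auxE associE.
Qed.

Definition ind_ins_map : rcomod_map (ind_rcomod phi M) (tens_rcomod M (bc_rcomod N)) :=
  @RcomodMap _ _ _ _ (ind_rcomod phi M) (tens_rcomod M (bc_rcomod N)) ind_ins ind_ins_colin.

Lemma ind_ins_inj (t t' : tensor (tensor M b_ab) D) :
  tmap ind_ins (bm_id D) t = tmap ind_ins (bm_id D) t' -> t = t'.
Proof.
have K u : tmap (ind_del M) (bm_id D) (tmap ind_ins (bm_id D) u) = u.
  rewrite -tmap_compl; elim/ot_ind: u => [|u v eu ev|u d]; rewrite ?addE ?eu ?ev //.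
  by rewrite tmapE bm_compE ind_delK.
by move/(congr1 (tmap (ind_del M) (bm_id D))); rewrite !K.
Qed.

(** Colinearity can be tested in [M (x) N], since [ind_ins (x) D] has a left inverse. *)
Lemma ind_colin (Y : rcomod R D) (g : bimap Y (tensor M b_ab)) :
  (forall y, tens_rcoact M (bc_r N) (ind_ins (g y)) =
     tmap (bm_comp ind_ins g) (bm_id D) (rc_coact Y y)) ->
  forall y, ind_coact phi r (g y) = tmap g (bm_id D) (rc_coact Y y).
Proof.
move=> e y; apply: ind_ins_inj.
by rewrite -ind_ins_colin e tmap_compl.
Qed.

End Insert.

Lemma ind_ins_nat (R : algebra k) (M M' : rcomod R C) (f : rcomod_map M M') t :
  ind_ins M' (tmap f (bm_id b_ab) t) = tmap f (bm_id N) (ind_ins M t).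
Proof.
elim/ot_ind: t => [|u v eu ev|m b]; rewrite ?addE ?eu ?ev //.
rewrite tmapE !ind_insE rc_mapP.
elim/ot_ind: (rc_coact M m) => [|u v eu ev|m' c]; rewrite ?addE ?eu ?ev //.
by rewrite tmapE !assocE tmapE.
Qed.

End InsertCoaction.

Section CohomLeftAdjoint.
Variables (k : comPzRingType) (A B : algebra k) (C : coring A) (D : coring B).
Variables (phi : coring_hom C D).
Let N := CB_bicomod phi.
Let b_ab := B_AB phi.
Variable h : cohom (bc_rcomod N).

Section Unit.
Variables (Y : comod_cat D).
Let hY := cohom_rcomod h Y.
Let th : bimap (Y : rcomod _ D) (tensor hY N) := theta h Y.

Definition cohom_unit0 : bimap (Y : rcomod _ D) (tensor hY b_ab) :=
  bm_comp (ind_del phi hY) th.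

(** By the very definition of the C-coaction on cohom, [theta] takes its values in the cotensor
    product, so nothing is lost by [ind_del]. *)
Lemma ind_ins_unit y : ind_ins phi hY (cohom_unit0 y) = th y.
Proof.
rewrite -[cohom_unit0 y]/(ind_del phi hY (th y)) ind_insK // -[RHS]/(tmap (cohom_rcoact h Y) _ _).
by rewrite [RHS]cohom_rcoactE.
Qed.

Lemma cohom_unit_colin y : ind_coact phi (rc_coact hY) (cohom_unit0 y) =
  tmap cohom_unit0 (bm_id D) (rc_coact (Y : rcomod _ D) y).
Proof.
have insE : bm_comp (ind_ins phi hY) cohom_unit0 = th.
  by apply: bimap_eq => z; exact: ind_ins_unit.
apply: ind_colin => {}y; rewrite ind_ins_unit insE.
exact: theta_colin.
Qed.

Definition cohom_unit : rcomod_map (Y : rcomod _ D) (ind_rcomod phi hY) :=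
  @RcomodMap _ _ _ _ (Y : rcomod _ D) (ind_rcomod phi hY) cohom_unit0 cohom_unit_colin.

End Unit.

Lemma cohom_adjunction : inhabited (adjunction (cohom_functor h) (induction_functor phi)).
Proof.
have [] := @adjunction_of_unit _ _ (cohom_functor h) (induction_functor phi) cohom_unit;
  last by move=> adj _; exists.
- move=> Y Y' f; apply: rcomod_map_eq => y.
  rewrite -[LHS]/(tmap (cohom_map h f) (bm_id b_ab) (ind_del phi _ (theta h Y y))).
  by rewrite -ind_del_nat theta_nat.
- move=> Y M g.
  pose g' : rcomod_map (Y : rcomod _ D) (tens_rcomod (M : rcomod _ C) (bc_rcomod N)) :=
    rcomod_comp (ind_ins_map phi (M : rcomod _ C)) (g : rcomod_map _ _).
  pose u := ctr h g'.
  have uE y : tmap u (bm_id N) (theta h Y y) = ind_ins phi M ((g : rcomod_map _ _) y).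
    exact: (ctrE h g' y).
  (* [u] is colinear because the maps to compare agree after [theta]: [ind_ins] lands in the
     cotensor product of [M] and [N]. *)
  have uC z : rc_coact (M : rcomod _ C) (u z) = tmap u (bm_id C) (cohom_rcoact h Y z).
    suff E : bm_comp (rc_coact (M : rcomod _ C)) u = bm_comp (tmap u (bm_id C)) (cohom_rcoact h Y).
      exact: (congr1 (fun w : bimap (coh_bimod h Y) _ => w z) E).
    apply: theta_uniq => y.
    rewrite (tmap_compl _ u) (tmap_compl _ (cohom_rcoact h Y)) cohom_rcoactE uE.
    rewrite -ind_ins_lcoact -uE.
    elim/ot_ind: (theta h Y y) => [|v w ev ew|z' n]; rewrite ?addE ?ev ?ew //.
    rewrite !tmapE lcoact_bimapE.
    elim/ot_ind: (bc_l N n) => [|v w ev ew|c n']; rewrite ?addE ?ev ?ew //.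
    by rewrite !(associE, tmapE).
  exists (@RcomodMap _ _ _ _ (cohom_rcomod h Y) (M : rcomod _ C) u uC).
  apply: rcomod_map_eq => y.
  rewrite -[LHS]/(tmap u (bm_id b_ab) (ind_del phi _ (theta h Y y))).
  by rewrite -ind_del_nat uE ind_delK.
- move=> Y M f f' e; apply: rcomod_map_eq => z.
  suff E : rc_map (f : rcomod_map (cohom_rcomod h Y) M) = rc_map (f' : rcomod_map (cohom_rcomod h Y) M).
    by rewrite E.
  (* Inserting the coaction recovers the composite with [theta], for which uniqueness is known. *)
  have E (g : rcomod_map (cohom_rcomod h Y) M) y : tmap g (bm_id N) (theta h Y y) =
     ind_ins phi M (tmap g (bm_id b_ab) (cohom_unit Y y)).
    by rewrite ind_ins_nat [ind_ins _ _ _]ind_ins_unit.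
  apply: (theta_uniq (h := h) (Y := Y)) => y; rewrite !E; congr (ind_ins _ _ _).
  exact: (congr1 (fun w : rcomod_map Y (ind_rcomod phi M) => w y) e).
Qed.

End CohomLeftAdjoint.

(** * Testing exactness of cohom *)

Section TensorCohom.
Variables (k : comPzRingType) (A B : algebra k) (C : coring A) (D : coring B).
Variables (N : bicomod C D) (h : cohom (bc_rcomod N)).

Section Tens.
Variables (S R : algebra k) (X : bimod S R) (Y : rcomod R D).

(** The universal map for [X (x) h_D(N, Y)]: it is [theta] of [X (x) Y] read through [upsilon], so
    linear maps out of [X (x) h_D(N, Y)] can be built and compared as for [theta]. *)
Definition tens_theta : bimap (tensor X Y) (tensor (tensor X (coh_bimod h Y)) N) :=
  bm_comp associ (tmap (bm_id X) (theta h Y)).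

Lemma tens_thetaE x y : tens_theta (x \ot y) = associ (x \ot theta h Y y).
Proof. by rewrite bm_compE tmapE. Qed.

Lemma tens_theta_colin t :
  tens_rcoact (tensor X (coh_bimod h Y)) (bc_r N) (tens_theta t) =
  tmap tens_theta (bm_id D) (tens_rcoact X (rc_coact Y) t).
Proof. exact: (upsilon_inv0P h t). Qed.

Definition tens_theta_map :
  rcomod_map (tens_rcomod X Y) (tens_rcomod (tensor X (coh_bimod h Y)) (bc_rcomod N)) :=
  @RcomodMap _ _ _ _ (tens_rcomod X Y)
    (tens_rcomod (tensor X (coh_bimod h Y)) (bc_rcomod N)) tens_theta tens_theta_colin.

Lemma upsilon_theta t : tmap (upsilon h X Y) (bm_id N) (tens_theta t) =
  theta h (tens_rcomod X Y) t.
Proof.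
have K u : tmap (upsilon h X Y) (bm_id N) (tmap (upsilon_inv h X Y) (bm_id N) u) = u.
  rewrite -tmap_compl; elim/ot_ind: u => [|u v eu ev|u d]; rewrite ?addE ?eu ?ev //.
  by rewrite tmapE bm_compE upsilon_invK.
by rewrite -(K (theta h (tens_rcomod X Y) t)) upsilon_invE.
Qed.

Variables (Z : bimod S A).

Lemma tens_theta_uniq (u v : bimap (tensor X (coh_bimod h Y)) Z) :
  (forall t, tmap u (bm_id N) (tens_theta t) = tmap v (bm_id N) (tens_theta t)) ->
  u = v.
Proof.
move=> e; suff E : bm_comp u (upsilon_inv h X Y) = bm_comp v (upsilon_inv h X Y).
  apply: bimap_eq => t; rewrite -(upsilonK (h := h) t).
  exact: (congr1 (fun w : bimap _ Z => w (upsilon h X Y t)) E).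
apply: theta_uniq => t.
rewrite (tmap_compl u) (tmap_compl v).
have := e t; have := upsilon_invE h (X := X) (Y := Y) t.
by rewrite -[upsilon_inv0 _ _ _ _]/(tens_theta t) => ->.
Qed.

Variable w : rcomod_map (tens_rcomod X Y) (tens_rcomod Z (bc_rcomod N)).

Definition tens_ctr : bimap (tensor X (coh_bimod h Y)) Z :=
  bm_comp (ctr h w) (upsilon h X Y).

Lemma tens_ctrE t : tmap tens_ctr (bm_id N) (tens_theta t) = w t.
Proof. by rewrite (tmap_compl (ctr h w)) upsilon_theta; exact: (ctrE h w t). Qed.

End Tens.

Definition regD := bc_rcomod (reg_bicomod D).
Definition hD := cohom_bicomod h (reg_bicomod D).

Section Sigma.
Variables (R : algebra k) (Y : rcomod R D).

Lemma coact_colin y : tens_rcoact Y (Delta D) (rc_coact Y y) =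
  tmap (rc_coact Y) (bm_id D) (rc_coact Y y).
Proof.
by rewrite -[LHS]/(associ (tmap _ _ _)) -(proj1 (rc_coactP Y)) assocK.
Qed.

Definition coact_map : rcomod_map Y (tens_rcomod Y regD) :=
  @RcomodMap _ _ _ _ Y (tens_rcomod Y regD) (rc_coact Y) coact_colin.

Definition sigma : bimap (coh_bimod h Y) (tensor Y hD) :=
  bm_comp (upsilon_inv h Y regD) (cohom_map h coact_map).

Lemma sigmaE y : tmap sigma (bm_id N) (theta h Y y) = tens_theta Y regD (rc_coact Y y).
Proof.
rewrite (tmap_compl (upsilon_inv h Y regD)).
transitivity (tmap (upsilon_inv h Y regD) (bm_id N)
   (theta h (tens_rcomod Y regD) (rc_coact Y y))).
  congr (tmap _ _ _); exact: (theta_nat h coact_map y).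
exact: (upsilon_invE h (X := Y) (Y := regD)).
Qed.

Lemma sigma_colin z :
  tens_rcoact Y (bc_r hD) (sigma z) = tmap sigma (bm_id C) (cohom_rcoact h Y z).
Proof.
suff E : bm_comp (tens_rcoact Y (bc_r hD)) sigma =
    bm_comp (tmap sigma (bm_id C)) (cohom_rcoact h Y).
  exact: (congr1 (fun w : bimap (coh_bimod h Y) _ => w z) E).
apply: theta_uniq => y.
rewrite (tmap_compl (tens_rcoact Y (bc_r hD))) (tmap_compl _ (cohom_rcoact h Y)).
rewrite sigmaE cohom_rcoactE.
transitivity (lcoact_bimap N (tensor Y hD) (tmap sigma (bm_id N) (theta h Y y))); last first.
  elim/ot_ind: (theta h Y y) => [|u v eu ev|u n]; rewrite ?addE ?eu ?ev //.
  rewrite !tmapE lcoact_bimapE.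
  elim/ot_ind: (bc_l N n) => [|v w ev ew|c n']; rewrite ?addE ?ev ?ew //.
  by rewrite !(associE, tmapE).
rewrite sigmaE.
elim/ot_ind: (rc_coact Y y) => [|u v eu ev|y' d]; rewrite ?addE ?eu ?ev //.
rewrite tens_thetaE.
transitivity (tmap associ (bm_id N) (associ (y' \ot tmap (cohom_rcoact h regD) (bm_id N) (theta h regD d)))).
  elim/ot_ind: (theta h regD d) => [|v w ev ew|z' n]; rewrite ?addE ?ev ?ew //.
  by rewrite !(associE, tmapE) tens_rcoactE.
rewrite cohom_rcoactE.
elim/ot_ind: (theta h regD d) => [|v w ev ew|z' n]; rewrite ?addE ?ev ?ew //.
rewrite !(associE, tmapE) lcoact_bimapE.
elim/ot_ind: (bc_l N n) => [|v w ev ew|c n']; rewrite ?addE ?ev ?ew //.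
by rewrite !(associE, tmapE).
Qed.

(** Seen through [theta], the left coaction of [h_D(N, D)] is the comultiplication of [D], by
    [cohom_lcoactE]. *)
Lemma tens_lcoact_theta (t : tensor Y D) :
  tmap (bm_comp associ (tmap (bm_id Y) (bc_l hD))) (bm_id N) (tens_theta Y regD t) =
  tens_theta (tensor Y D) regD (tens_rcoact Y (Delta D) t).
Proof.
elim/ot_ind: t => [|u v eu ev|y d]; rewrite ?addE ?eu ?ev //.
rewrite tens_thetaE tens_rcoactE.
transitivity (tmap associ (bm_id N) (associ (y \ot tmap (cohom_lcoact h (reg_bicomod D)) (bm_id N) (theta h regD d)))).
  elim/ot_ind: (theta h regD d) => [|v w ev ew|z' n]; rewrite ?addE ?ev ?ew //.
  by rewrite !(associE, tmapE) bm_compE tmapE.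
rewrite cohom_lcoactE.
rewrite -[bc_l _ _]/(Delta D d).
elim/ot_ind: (Delta D d) => [|v w ev ew|d1 d2]; rewrite ?addE ?ev ?ew //.
rewrite !(associE, tmapE) tens_thetaE.
rewrite -[theta h (bc_rcomod (reg_bicomod D)) d2]/(theta h regD d2).
elim/ot_ind: (theta h regD d2) => [|v w ev ew|z' n]; rewrite ?addE ?ev ?ew //.
by rewrite !(associE, tmapE).
Qed.

Lemma tens_coact_theta (t : tensor Y D) :
  tmap (tmap (rc_coact Y) (bm_id hD)) (bm_id N) (tens_theta Y regD t) =
  tens_theta (tensor Y D) regD (tmap (rc_coact Y) (bm_id D) t).
Proof.
elim/ot_ind: t => [|u v eu ev|y d]; rewrite ?addE ?eu ?ev //.
rewrite tmapE !tens_thetaE.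
elim/ot_ind: (theta h regD d) => [|v w ev ew|z' n]; rewrite ?addE ?ev ?ew //.
by rewrite !(associE, tmapE).
Qed.

(** After [theta] the two sides become the two sides of coassociativity of [Y]. *)
Lemma sigma_equalized z :
  tmap (rc_coact Y) (bm_id hD) (sigma z) = associ (tmap (bm_id Y) (bc_l hD) (sigma z)).
Proof.
suff E : bm_comp (tmap (rc_coact Y) (bm_id hD)) sigma =
    bm_comp (bm_comp associ (tmap (bm_id Y) (bc_l hD))) sigma.
  exact: (congr1 (fun w : bimap (coh_bimod h Y) _ => w z) E).
apply: theta_uniq => y; rewrite !(tmap_compl _ sigma) sigmaE.
by rewrite [RHS]tens_lcoact_theta tens_coact_theta coact_colin.
Qed.

End Sigma.

Lemma sigma_nat (R : algebra k) (Y Y' : rcomod R D) (f : rcomod_map Y Y') z :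
  sigma Y' (cohom_map h f z) = tmap f (bm_id hD) (sigma Y z).
Proof.
suff E : bm_comp (sigma Y') (cohom_map h f) = bm_comp (tmap f (bm_id hD)) (sigma Y).
  exact: (congr1 (fun w : bimap (coh_bimod h Y) _ => w z) E).
apply: theta_uniq => y; rewrite (tmap_compl (sigma Y')) (tmap_compl _ (sigma Y)).
rewrite [RHS](congr1 (tmap _ _) (sigmaE y)).
rewrite [LHS](congr1 (tmap _ _) (theta_nat h f y)) sigmaE rc_mapP.
elim/ot_ind: (rc_coact Y y) => [|u v eu ev|y' d]; rewrite ?addE ?eu ?ev //.
rewrite tmapE !tens_thetaE.
elim/ot_ind: (theta h regD d) => [|v w ev ew|z' n]; rewrite ?addE ?ev ?ew //.
by rewrite !(associE, tmapE).
Qed.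

(* Stand-in for exactness of [h] at [Y -> Y (x) D => Y (x) D (x) D], as seen by
   maps into the cofree object [E (x) N]. *)
Definition coact_test (E : rmod A) := forall Y : rcomod (base_alg k) D,
  (forall u : rcomod_map Y (tens_rcomod E (bc_rcomod N)),
     exists w : rcomod_map (tens_rcomod Y regD) (tens_rcomod E (bc_rcomod N)),
       forall y, w (rc_coact Y y) = u y) /\
  (forall u : rcomod_map (tens_rcomod Y regD) (tens_rcomod E (bc_rcomod N)),
     (forall y, u (rc_coact Y y) = 0) ->
     exists w : rcomod_map (tens_rcomod (tensor Y D) regD) (tens_rcomod E (bc_rcomod N)),
       forall t, w (tmap (rc_coact Y) (bm_id D) t) - w (tens_rcoact Y (Delta D) t) = u t).

Section Exactness.
Hypothesis test : coact_test (char_mod A).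
Variable Y : rcomod (base_alg k) D.

(** A map [u] to the character module corresponds to a colinear map out of [Y]. The test extends the
    latter along the coaction, so [u] factors through [sigma] and vanishes on its kernel. *)
Lemma sigma_inj : injective (sigma Y).
Proof.
apply: ker_inj => z sz; apply: contrapT => z0.
(* The kernel of the identity serves as the zero submodule. *)
have [u _ uz] := @char_mod_separation _ _ _ (ker_submod (bm_id (coh_bimod h Y))) z z0.
apply: uz.
pose u' : rcomod_map Y (tens_rcomod (char_mod A) (bc_rcomod N)) :=
  rcomod_comp (tens_rcomod_map u (rcomod_id (bc_rcomod N))) (theta_map h Y).
have [w wE] := proj1 (test Y) u'.
suff -> : u = bm_comp (tens_ctr w) (sigma Y) by rewrite bm_compE sz bm0.
apply: theta_uniq => y; rewrite (tmap_compl _ (sigma Y)).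
rewrite [RHS](congr1 (tmap _ _) (sigmaE y)).
by rewrite [RHS](tens_ctrE w) wE.
Qed.

(** Otherwise some [u] kills the image of [sigma] but not [t]. By the test, [u] factors through the
    difference of the two maps that agree on [t]. *)
Lemma sigma_im (t : tensor Y hD) :
  tmap (rc_coact Y) (bm_id hD) t = associ (tmap (bm_id Y) (bc_l hD) t) ->
  exists z, sigma Y z = t.
Proof.
move=> et; apply: contrapT => nt.
have [u uK ut] := @char_mod_separation _ _ _ (im_submod (sigma Y)) t nt.
apply: ut.
pose u' : rcomod_map (tens_rcomod Y regD) (tens_rcomod (char_mod A) (bc_rcomod N)) :=
  rcomod_comp (tens_rcomod_map u (rcomod_id (bc_rcomod N))) (tens_theta_map Y regD).
have [|w wE] := proj2 (test Y) u'.
  move=> y; rewrite -[LHS]/(tmap u (bm_id N) (tens_theta Y regD (rc_coact Y y))).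
  rewrite -sigmaE -tmap_compl.
  have -> : bm_comp u (sigma Y) = bzero _ _ by apply: bimap_eq => z; apply: uK; exists z.
  exact: tmap_bzero.
pose v := tens_ctr w.
suff -> : u = bsub (bm_comp v (tmap (rc_coact Y) (bm_id hD)))
   (bm_comp v (bm_comp associ (tmap (bm_id Y) (bc_l hD)))).
  by rewrite -[LHS]/(v (tmap _ _ t) - v (associ (tmap _ _ t))) et subrr.
apply: (tens_theta_uniq (Y := regD)) => s.
rewrite tmap_bsub !(tmap_compl v).
rewrite [X in _ = X - _](congr1 (tmap _ _) (tens_coact_theta s)).
rewrite [X in _ = _ - X](congr1 (tmap _ _) (tens_lcoact_theta s)).
by rewrite [X in _ = X - _](tens_ctrE w) [X in _ = _ - X](tens_ctrE w) wE.
Qed.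

End Exactness.
End TensorCohom.

(** * Sufficient conditions for the coaction test *)

Section RcomodMaps.
Variables (k : comPzRingType) (R B : algebra k) (D : coring B) (Y Z : rcomod R D).

Lemma rcomod_sub_subproof (f g : rcomod_map Y Z) y :
  rc_coact Z (bsub f g y) = tmap (bsub f g) (bm_id D) (rc_coact Y y).
Proof. by rewrite tmap_bsub -!rc_mapP [LHS]bmB. Qed.
Definition rcomod_sub (f g : rcomod_map Y Z) : rcomod_map Y Z :=
  RcomodMap (rcomod_sub_subproof f g).

Lemma rcomod_zero_subproof y :
  rc_coact Z (bzero Y Z y) = tmap (bzero Y Z) (bm_id D) (rc_coact Y y).
Proof. by rewrite tmap_bzero [LHS]bm0. Qed.
Definition rcomod_zero : rcomod_map Y Z := RcomodMap rcomod_zero_subproof.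

Lemma rc_coact_inj : injective (rc_coact Y).
Proof. by move=> x y e; rewrite -(proj2 (rc_coactP Y) x) e (proj2 (rc_coactP Y)). Qed.

(** The counit of [D] is applied to the last factor of both sides of the hypothesis. *)
Lemma rc_coact_equalizer (t : tensor Y D) :
  tmap (rc_coact Y) (bm_id D) t = tens_rcoact Y (Delta D) t ->
  rc_coact Y (runit (tmap (bm_id Y) (counit D) t)) = t.
Proof.
move=> e.
transitivity (runit (tmap (bm_id _) (counit D) (tmap (rc_coact Y) (bm_id D) t))).
  elim/ot_ind: t {e} => [|u v eu ev|y d]; rewrite ?addE ?eu ?ev //.
  by rewrite !tmapE !runitE bmZr.
rewrite e; elim/ot_ind: t {e} => [|u v eu ev|y d]; rewrite ?addE ?eu ?ev //.
rewrite tens_rcoactE -[in RHS](counitr d).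
elim/ot_ind: (Delta D d) => [|u v eu ev|d1 d2]; rewrite ?addE ?eu ?ev //.
by rewrite associE !tmapE !runitE otZr.
Qed.
End RcomodMaps.

Section CoactTest.
Variables (k : comPzRingType) (A B : algebra k) (C : coring A) (D : coring B).
Variables (N : bicomod C D).

(** The object [E (x) N] is injective. The coaction of [Y] is a monomorphism, which gives the first
    half. For the second, the kernel of the difference [d] is the image of the coaction, where [u]
    vanishes, so [u] factors through [d]. *)
Lemma injector_coact_test : left_flat D -> injector (bc_rcomod N) -> coact_test N (char_mod A).
Proof.
move=> flatD inj Y.
have Einj := inj _ (@char_mod_injective _ A).
split=> [u|u uY].
  have m : mono (coact_map Y : @hom (comod_cat D) _ _).
    move=> Z f g e; apply: rcomod_map_eq => z; apply: (@rc_coact_inj _ _ _ _ Y).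
    exact: (congr1 (fun w : rcomod_map Z (tens_rcomod Y (regD D)) => w z) e).
  have [w wE] := Einj _ _ _ m (u : @hom (comod_cat D) _ _).
  exists w => y; exact: (congr1 (fun w : rcomod_map Y _ => w y) wE).
pose d : rcomod_map (tens_rcomod Y (regD D)) (tens_rcomod (tensor Y D) (regD D)) :=
  rcomod_sub (tens_rcomod_map (rc_coact Y) (rcomod_id (regD D)))
    (coact_map (tens_rcomod Y (regD D))).
have [t dt|w wE] := injective_factor flatD (d := d : @hom (comod_cat D) _ _)
    (u := u : @hom (comod_cat D) _ _) Einj.
  by rewrite -[t](@rc_coact_equalizer _ _ _ _ Y); [exact: uY | exact: subr0_eq].
exists (w : rcomod_map _ _) => t; rewrite -bmB.
exact: (congr1 (fun w : rcomod_map (tens_rcomod Y (regD D)) _ => w t) (esym wE)).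
Qed.

Section Coseparable.
Variable pi : bicomod_map (CC_bicomod D) (reg_bicomod D).
Hypothesis piK : forall d, pi (Delta D d) = d.

Section Retraction.
Variables (R : algebra k) (Y : rcomod R D).

Let epi : bimap (tensor D D) (reg B) := bm_comp (counit D) pi.

(** y (x) d |-> y_0 eps(pi(y_1 (x) d)), the natural retraction of the coaction built from the
    splitting [pi] of [Delta]. *)
Definition cosep_retr0 : bimap (tensor Y D) Y :=
  bm_comp runit (bm_comp (tmap (bm_id Y) epi) (bm_comp assoc (tmap (rc_coact Y) (bm_id D)))).

Lemma cosep_retr0E y d :
  cosep_retr0 (y \ot d) = runit (tmap (bm_id Y) epi (assoc (rc_coact Y y \ot d))).
Proof. by rewrite !bm_compE tmapE. Qed.

Lemma cosep_retrK y : cosep_retr0 (rc_coact Y y) = y.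
Proof.
rewrite !bm_compE (proj1 (rc_coactP Y)) -tmap_compr.
rewrite -[RHS](proj2 (rc_coactP Y)); congr (runit (bm_fun (tmap _ _) _)).
by apply: bimap_eq => d; rewrite !bm_compE piK.
Qed.

(** Left colinearity of [pi] computes the comultiplication of [pi (d \ot d')]; the counit on its
    right factor recovers [pi]. The companion [pi_r] uses right colinearity and the left factor. *)
Lemma pi_l d d' : pi (d \ot d') =
  runit (tmap (bm_id D) epi (assoc (Delta D d \ot d'))).
Proof.
rewrite -[LHS]counitr; have := bc_mapl pi (d \ot d').
rewrite -[bc_l (reg_bicomod D) _]/(Delta D _) => ->.
rewrite -[bc_l _ _]/(tens_lcoact D (Delta D) (d \ot d')) tens_lcoactE.
by rewrite tmap_compr.
Qed.

Lemma pi_r d d' : pi (d \ot d') =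
  lunit (tmap epi (bm_id D) (associ (d \ot Delta D d'))).
Proof.
rewrite -[LHS]counitl; have := bc_mapr pi (d \ot d').
rewrite -[bc_r (reg_bicomod D) _]/(Delta D _) => ->.
rewrite -[bc_r _ _]/(tens_rcoact D (Delta D) (d \ot d')) tens_rcoactE.
by rewrite tmap_compl.
Qed.

(** Both sides are y_0 (x) pi(y_1 (x) d): the left one by coassociativity and [pi_l], the right one
    by [pi_r]. *)
Lemma cosep_retr_colin t : rc_coact Y (cosep_retr0 t) =
  tmap cosep_retr0 (bm_id D) (tens_rcoact Y (Delta D) t).
Proof.
elim/ot_ind: t => [|u v eu ev|y d]; rewrite ?addE ?eu ?ev //.
transitivity (tmap (bm_id Y) pi (assoc (rc_coact Y y \ot d))).
  rewrite cosep_retr0E.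
  pose g (w : tensor D D) := runit (tmap (bm_id D) epi (assoc (w \ot d))).
  have gD : {morph g : x y / x + y} by move=> *; rewrite /g !addE.
  have gZ b w : g (b *< w) = b *< g w by rewrite /g -otZl !bmZl.
  have rE := (rtensE Y gD gZ, rtensD Y gD gZ, rtens0 Y gD gZ).
  transitivity (rtens (M := Y) g (tmap (bm_id Y) (Delta D) (rc_coact Y y))).
    rewrite -(proj1 (rc_coactP Y)).
    elim/ot_ind: (rc_coact Y y) => [|u v eu ev|y' e]; rewrite ?(addE, rE) ?eu ?ev //.
    rewrite assocE !tmapE runitE bmZr.
    elim/ot_ind: (rc_coact Y y') => [|u v eu ev|y'' e']; rewrite ?(addE, rE) ?eu ?ev //.
    by rewrite assocE rE /g assocE tmapE runitE otZr.
  elim/ot_ind: (rc_coact Y y) => [|u v eu ev|y' e]; rewrite ?(addE, rE) ?eu ?ev //.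
  by rewrite !tmapE rE assocE tmapE pi_l.
rewrite tens_rcoactE.
transitivity (tmap (bm_id Y) (bm_comp lunit (tmap epi (bm_id D)))
   (tmap (bm_id Y) associ (assoc (rc_coact Y y \ot Delta D d)))).
  elim/ot_ind: (rc_coact Y y) => [|u v eu ev|y' e]; rewrite ?addE ?eu ?ev //.
  by rewrite !assocE !tmapE pi_r.
elim/ot_ind: (Delta D d) => [|u v eu ev|d1 d2]; rewrite ?addE ?eu ?ev //.
rewrite associE tmapE cosep_retr0E.
elim/ot_ind: (rc_coact Y y) => [|u v eu ev|y' e]; rewrite ?addE ?eu ?ev //.
by rewrite !assocE !tmapE associE bm_compE tmapE runitE lunitE ot_bal.
Qed.

Definition cosep_retr : rcomod_map (tens_rcomod Y (regD D)) Y :=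
  @RcomodMap _ _ _ _ (tens_rcomod Y (regD D)) Y cosep_retr0 cosep_retr_colin.

End Retraction.

Lemma cosep_retr_nat (R : algebra k) (Y Y' : rcomod R D) (f : rcomod_map Y Y') t :
  cosep_retr Y' (tmap f (bm_id D) t) = f (cosep_retr Y t).
Proof.
rewrite -[LHS]/(cosep_retr0 Y' _) -[RHS]/(f (cosep_retr0 Y _)).
elim/ot_ind: t => [|u v eu ev|y d]; rewrite ?addE ?eu ?ev //.
rewrite tmapE !cosep_retr0E rc_mapP.
elim/ot_ind: (rc_coact Y y) => [|u v eu ev|y' e]; rewrite ?addE ?eu ?ev //.
by rewrite !(tmapE, assocE) !runitE bmZr.
Qed.
End Coseparable.

(** The natural retraction is a contracting homotopy, which works for every [E]. *)
Lemma coseparable_coact_test : coseparable D -> forall E, coact_test N E.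
Proof.
case=> pi0 pi0E; pose pi : bicomod_map (CC_bicomod D) (reg_bicomod D) := pi0.
have piK d : pi (Delta D d) = d.
  exact: (congr1 (fun w : bicomod_map (reg_bicomod D) (reg_bicomod D) => w d) pi0E).
move=> E Y; split=> [u|u uY].
  exists (rcomod_comp u (cosep_retr pi Y)) => y.
  by rewrite -[LHS]/(u (cosep_retr0 pi Y _)) cosep_retrK.
pose s := cosep_retr pi (tens_rcomod Y (regD D)).
(* The witness is minus [u] after [s]. By naturality [s] carries the first map into the image of the
   coaction, which [u] kills; it splits the second, and the two signs cancel. *)
exists (rcomod_sub (rcomod_zero _ _) (rcomod_comp u s)) => t.
have s0 : s (tmap (rc_coact Y) (bm_id D) t) = rc_coact Y (cosep_retr pi Y t).
  exact: (cosep_retr_nat pi (coact_map Y) t).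
have s1 : s (tens_rcoact Y (Delta D) t) = t.
  exact: (cosep_retrK piK (Y := tens_rcomod Y (regD D)) t).
rewrite -[LHS]/((0 - u (s _)) - (0 - u (s _))) s0 s1 uY.
by rewrite subrr !sub0r opprK.
Qed.

End CoactTest.

(** * The right adjoint of induction as a cotensor product *)

Section Cofree.
Variables (k : comPzRingType) (A B : algebra k) (C : coring A) (D : coring B).
Variables (phi : coring_hom C D).
Let rho := ch_alg phi.
Let b_ab := B_AB phi.
Let b_ba := B_BA phi.
Let W := BC_bicomod phi.

Section Obj.
Variables (R : algebra k) (Y : bimod R B).

Definition restr : bimod R A := res (alg_hom_id R) rho Y.

Lemma cof_counit_subproof : bilin (P := restr) (fun (y : Y) (b : b_ba) => y >* (b : B)).
Proof.
split; first split.
- by move=> y y' b; exact: (@ractDl _ _ _ Y).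
- by move=> y b b'; exact: (@ractDr _ _ _ Y).
- by move=> y b b'; exact: esym (@ractA _ _ _ Y y b b').
- by move=> r y b; exact: (@lractA _ _ _ Y).
- by move=> y b a; exact: (@ractA _ _ _ Y).
Qed.

(* y (x) b (x) c |-> y b eps(c) *)
Definition cof_counit : bimap (tensor Y W) restr :=
  bm_comp (blift cof_counit_subproof)
    (tmap (bm_id Y) (bm_comp runit (tmap (bm_id b_ba) (counit C)))).

Lemma cof_counitE y (b : b_ba) c :
  cof_counit (y \ot (b \ot c)) = (y >* ((b : B) * rho (counit C c)) : Y).
Proof. by rewrite bm_compE tmapE bliftE bm_compE tmapE runitE. Qed.

Lemma cof_counitZ t a : cof_counit (t >* a) = ((cof_counit t : Y) >* rho a : Y).
Proof. exact: (bmZr cof_counit t a). Qed.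

Section Ext.
Variables (M : bimod R A) (g : bimap M restr).

Lemma restr_ext_subproof : bilin (P := Y) (fun (m : M) (b : b_ab) => (g m : Y) >* (b : B)).
Proof.
split; first split.
- by move=> m m' b; rewrite bmD; exact: (@ractDl _ _ _ Y).
- by move=> m b b'; exact: (@ractDr _ _ _ Y).
- by move=> m a b; rewrite bmZr; exact: esym (@ractA _ _ _ Y (g m) (rho a) b).
- by move=> r m b; rewrite bmZl; exact: (@lractA _ _ _ Y).
- by move=> m b b'; exact: (@ractA _ _ _ Y).
Qed.

Definition restr_ext : bimap (tensor M b_ab) Y := blift restr_ext_subproof.
Lemma restr_extE m b : restr_ext (m \ot b) = (g m : Y) >* (b : B).
Proof. exact: bliftE. Qed.

Lemma cof_subproof : bilin (P := tensor Y W)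
  (fun (m : M) (c : C) => ot (M := Y) (N := W) (g m) (ot (M := b_ba) (N := C) (1 : B) c)).
Proof.
split; first split.
- by move=> m m' c; rewrite bmD otDl.
- by move=> m c c'; rewrite !otDr.
- move=> m a c; rewrite bmZr -[X in ot X _]/((g m : Y) >* rho a) ot_bal.
  congr (_ \ot _); rewrite otZl -ot_bal; congr (_ \ot _).
  by rewrite /= mul1r mulr1.
- by move=> r m c; rewrite bmZl otZl.
- by move=> m c a; rewrite otZr otZr.
Qed.

(** As [Y (x)_B (B (x)_A C)] is the cofree comodule [Y (x)_A C] on the restriction of [Y], this map
    is [g (x) C], and [cof_counit] is the counit of the cofree object. *)
Definition cof : bimap (tensor M C) (tensor Y W) := blift cof_subproof.
Lemma cofE m c : cof (m \ot c) = ot (M := Y) (N := W) (g m) ((1 : b_ba) \ot c).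
Proof. exact: bliftE. Qed.

Lemma cof_colin t : tens_rcoact Y (bc_r W) (cof t) =
  tmap cof (bm_id C) (tens_rcoact M (Delta C) t).
Proof.
elim/ot_ind: t => [|u v eu ev|m c]; rewrite ?addE ?eu ?ev //.
rewrite cofE !tens_rcoactE.
elim/ot_ind: (Delta C c) => [|u v eu ev|c1 c2]; rewrite ?addE ?eu ?ev //.
by rewrite !associE tmapE cofE.
Qed.

Lemma cof_counit_cof t : cof_counit (cof t) = g (runit (tmap (bm_id M) (counit C) t)).
Proof.
elim/ot_ind: t => [|u v eu ev|m c]; rewrite ?addE ?eu ?ev //.
by rewrite cofE cof_counitE tmapE runitE bmZr mul1r.
Qed.

End Ext.

Lemma cof_counit_coact t : cof cof_counit (tens_rcoact Y (bc_r W) t) = t.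
Proof.
elim/ot_ind: t => [|u v eu ev|y w]; rewrite ?addE ?eu ?ev //.
elim/ot_ind: w => [|u v eu ev|b c]; rewrite ?addE ?eu ?ev //.
rewrite !tens_rcoactE -[in RHS](counitl c).
elim/ot_ind: (Delta C c) => [|u v eu ev|c1 c2]; rewrite ?addE ?eu ?ev //.
rewrite !associE cofE cof_counitE tmapE lunitE -ot_bal ot_bal otZl.
by congr (_ \ot (_ \ot _)); rewrite /= mulr1.
Qed.

End Obj.

Lemma cof_counit_nat (R : algebra k) (Y Y' : bimod R B) (g : bimap Y Y') t :
  cof_counit Y' (tmap g (bm_id W) t) =
  res_map (alg_hom_id R) rho g (cof_counit Y t).
Proof.
elim/ot_ind: t => [|u v eu ev|y w]; rewrite ?addE ?eu ?ev //.
elim/ot_ind: w => [|u v eu ev|b c]; rewrite ?addE ?eu ?ev //.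
by rewrite tmapE !cof_counitE [RHS](bmZr g).
Qed.

Lemma cof_counit_tens (R S : algebra k) (X : bimod R S) (Y : bimod S B) x s :
  cof_counit (tensor X Y) (associ (x \ot s)) = x \ot (cof_counit Y s : Y).
Proof.
pose Q : bimap (tensor X (tensor Y W)) (restr (tensor X Y)) :=
  bm_comp (cof_counit (tensor X Y)) associ.
rewrite -[LHS]/(Q (x \ot s)).
elim/ot_ind: s => [|u v eu ev|y w]; rewrite ?addE ?eu ?ev ?ot0r //.
elim/ot_ind: w => [|u v eu ev|b c]; rewrite ?addE ?eu ?ev ?ot0r //.
by rewrite bm_compE associE !cof_counitE otZr.
Qed.

Lemma phi0 : phi 0 = 0 :> D. Proof. exact: (bm0 (ch_map phi)). Qed.

Lemma cof_counit_coind (b : b_ba) (t : tensor C C) :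
  cof_counit D (coind_aux b t) = ((b : B) *< (phi (runit (tmap (bm_id C) (counit C) t)) : D) : D).
Proof.
elim/ot_ind: t => [|u v eu ev|c c'].
- by rewrite coind_aux0 !bm0; exact: esym (lact0 D b).
- by rewrite coind_auxD !bmD eu ev; exact: esym (@lactDr _ _ _ D b _ _).
- by rewrite coind_auxE cof_counitE mul1r tmapE runitE phiZr lractA.
Qed.

Section CofComod.
Variables (R : algebra k) (Y : rcomod R D).
Let r := rc_coact Y.

(* t (x) c |-> t eps (x) phi(c) b *)
Definition cof_phi (b : b_ab) (s : tensor (tensor Y W) C) : tensor Y D :=
  tlift (fun t c => ot (M := Y) (N := D) (cof_counit Y t) ((phi c : D) >* (b : B))) s.

Lemma cof_phi_subproof b :
  balanced (@ract _ _ _ (tensor Y W)) (@lact _ _ _ C)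
    (fun t c => ot (M := Y) (N := D) (cof_counit Y t) ((phi c : D) >* (b : B))).
Proof.
split=> [t t' c|t c c'|t a c].
- by rewrite bmD otDl.
- by rewrite phiD ractDl otDr.
- by rewrite cof_counitZ phiZl lractA ot_bal.
Qed.

Lemma cof_phiE b (t : tensor Y W) c :
  cof_phi b (t \ot c) = ot (M := Y) (N := D) (cof_counit Y t) ((phi c : D) >* (b : B)).
Proof. exact: tliftE (cof_phi_subproof b) t c. Qed.
Lemma cof_phiD b : {morph cof_phi b : x y / x + y}.
Proof. exact: tliftD (cof_phi_subproof b). Qed.
Lemma cof_phi0 b : cof_phi b 0 = 0.
Proof. exact: tlift0 (cof_phi_subproof b). Qed.

(** At y (x) b' (x) c both sides are y (x) b' phi(c) b, by the two counit laws of [C]. *)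
Lemma cof_phi_coact b t : cof_phi b (tens_rcoact Y (bc_r W) t) =
  (cof_counit (tensor Y D) (associ (tmap (bm_id Y) (bc_l W) t)) : tensor Y D) >* (b : B).
Proof.
elim/ot_ind: t => [|u v eu ev|y w]; rewrite ?(addE, cof_phiD, cof_phi0) ?eu ?ev //.
elim/ot_ind: w => [|u v eu ev|b' c]; rewrite ?(addE, cof_phiD, cof_phi0) ?eu ?ev //.
rewrite tmapE tens_rcoactE -[bc_l W _]/(BC_lcoact phi (b' \ot c)) BC_lcoactE.
rewrite -[bc_r W _]/(tens_rcoact b_ba (Delta C) (b' \ot c)) tens_rcoactE.
rewrite cof_counit_tens cof_counit_coind counitr.
transitivity (y \ot ((b' : B) *<
  ((phi (lunit (tmap (counit C) (bm_id C) (Delta C c))) : D) >* (b : B)))); last first.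
  by rewrite counitl otZr -lractA.
elim/ot_ind: (Delta C c) => [|u v eu ev|c1 c2];
  rewrite ?(bmD, bm0, otDr, ot0r, cof_phiD, cof_phi0, phiD, phi0, ractDl, ract0, lactDr, lact0) ?eu ?ev //.
rewrite !associE cof_phiE cof_counitE tmapE lunitE phiZl ot_bal.
by rewrite lactA lractA.
Qed.

(** On the cotensor product the left coaction of [W] can be traded for the coaction of [Y], with
    which [cof_counit] commutes. This is the source of the colinearity of [cot_ext]. *)
Lemma cof_counit_coactE t : tmap r (bm_id W) t = associ (tmap (bm_id Y) (bc_l W) t) ->
  forall b, r ((cof_counit Y t : Y) >* b) = cof_phi b (tens_rcoact Y (bc_r W) t).
Proof.
move=> et b; rewrite cof_phi_coact -et cof_counit_nat bmZr.
by [].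
Qed.

End CofComod.
End Cofree.

(** * Colinear maps into the cotensor product of Y and W *)

Section CotensorMaps.
Variables (k : comPzRingType) (A B : algebra k) (C : coring A) (D : coring B).
Variables (phi : coring_hom C D).
Let rho := ch_alg phi.
Let b_ab := B_AB phi.
Let W := BC_bicomod phi.

Lemma coind_auxZl a t :
  coind_aux (1 : B_BA phi) (a *< t) = rho a *< coind_aux (1 : B_BA phi) t.
Proof.
rewrite /coind_aux -ot_bal -!bmZl otZl.
by congr (assoc (tmap _ _ (associ (_ \ot _)))); rewrite /= mul1r mulr1.
Qed.

Section Transpose.
Variables (R : algebra k) (M : rcomod R C) (Y : rcomod R D).
Let r := rc_coact M.

(* The C-colinear maps from M to the cotensor product of Y and W over D. *)
Definition cot_map (v : bimap M (tensor Y W)) :=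
  (forall m, tmap (rc_coact Y) (bm_id W) (v m) = associ (tmap (bm_id Y) (bc_l W) (v m))) /\
  (forall m, tens_rcoact Y (bc_r W) (v m) = tmap v (bm_id C) (r m)).

Section Ext.
Variable v : bimap M (tensor Y W).
Hypothesis vP : cot_map v.

Definition cot_ext0 : bimap (tensor M b_ab) Y := restr_ext (bm_comp (cof_counit phi Y) v).

Lemma cot_ext0E m (b : b_ab) :
  cot_ext0 (m \ot b) = (cof_counit phi Y (v m) : Y) >* (b : B).
Proof. exact: restr_extE. Qed.

Lemma cot_ext_colin t :
  rc_coact Y (cot_ext0 t) = tmap cot_ext0 (bm_id D) (ind_coact phi r t).
Proof.
elim/ot_ind: t => [|x y ex ey|m b]; rewrite ?addE ?ex ?ey //.
rewrite cot_ext0E (cof_counit_coactE (proj1 vP m)) (proj2 vP) ind_coactE.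
elim/ot_ind: (r m) => [|x y ex ey|m' c].
- by rewrite ind_aux0 !bm0 cof_phi0.
- by rewrite ind_auxD !bmD cof_phiD ex ey.
by rewrite tmapE cof_phiE ind_auxE tmapE cot_ext0E ract1.
Qed.

Definition cot_ext : rcomod_map (ind_rcomod phi M) Y :=
  @RcomodMap _ _ _ _ (ind_rcomod phi M) Y cot_ext0 cot_ext_colin.

Lemma cot_extE m (b : b_ab) : cot_ext (m \ot b) = (cof_counit phi Y (v m) : Y) >* (b : B).
Proof. exact: cot_ext0E. Qed.

(** Colinearity of [v] into the cofree comodule [Y (x) W] determines it by its composite with the
    counit. *)
Lemma cot_map_cof m : v m = cof (bm_comp (cof_counit phi Y) v) (r m).
Proof.
rewrite -[LHS]cof_counit_coact (proj2 vP).
elim/ot_ind: (r m) => [|x y ex ey|m' c]; rewrite ?addE ?ex ?ey //.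
by rewrite !tmapE !cofE.
Qed.

End Ext.

Section Lift.
Variable f : rcomod_map (ind_rcomod phi M) Y.

Lemma restr1_subproof : @bimod_morph _ _ _ M (restr phi Y) (fun m => f (m \ot (1 : b_ab))).
Proof.
split=> [x y|a x|x b].
- by rewrite otDl bmD.
- by rewrite -otZl bmZl.
- rewrite ot_bal -[RHS]/((f (x \ot (1 : b_ab)) : Y) >* rho b) -bmZr otZr.
  by congr (f (_ \ot _)); rewrite /= mul1r mulr1.
Qed.
Definition restr1 : bimap M (restr phi Y) := Bimap restr1_subproof.

(* m |-> f(m_0 (x) 1) (x) 1 (x) m_1 *)
Definition cot_lift : bimap M (tensor Y W) := bm_comp (cof restr1) r.

(** Both sides are f(m_0 (x) 1) (x) phi(m_1) (x) 1 (x) m_2: the left one because [f] is D-colinear,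
    the right one by the coaction of [W]. *)
Lemma cot_lift_eq m : tmap (rc_coact Y) (bm_id W) (cot_lift m) =
  associ (tmap (bm_id Y) (bc_l W) (cot_lift m)).
Proof.
pose Q (m' : M) (w : tensor C C) : tensor (tensor Y D) W :=
  associ ((restr1 m' : Y) \ot coind_aux (1 : B_BA phi) w).
have Qb : balanced (@ract _ _ _ M) (@lact _ _ _ (tensor C C)) Q.
  split=> [x y w|x w w'|x a w]; rewrite /Q.
  - by rewrite bmD !addE.
  - by rewrite coind_auxD !addE.
  - by rewrite coind_auxZl -ot_bal bmZr.
have QE := tliftE Qb; have QD := tliftD Qb; have Q0 := tlift0 Qb.
rewrite bm_compE.
transitivity (tlift Q (tmap (bm_id M) (Delta C) (r m))); last first.
  elim/ot_ind: (r m) => [|u v eu ev|m' c]; rewrite ?(addE, QD, Q0) ?eu ?ev //.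
  rewrite tmapE [LHS]QE cofE tmapE /Q; congr (associ (_ \ot _)).
  by rewrite -[RHS]/(BC_lcoact phi _) BC_lcoactE.
rewrite -(proj1 (rc_coactP M)) -/r.
elim/ot_ind: (r m) => [|u v eu ev|m' c]; rewrite ?(addE, QD, Q0) ?eu ?ev //.
rewrite cofE !tmapE [rc_coact Y _](rc_mapP f (m' \ot (1 : b_ab))).
rewrite -[rc_coact _ _]/(ind_coact phi r (m' \ot (1 : b_ab))) ind_coactE.
elim/ot_ind: (r m') => [|u v eu ev|m'' c'].
- by rewrite ind_aux0 !(ot0l, bm0) Q0.
- by rewrite ind_auxD !(bmD, otDl) QD eu ev.
rewrite assocE [RHS]QE /Q ind_auxE tmapE coind_auxE associE ract1 lact1.
by [].
Qed.

Lemma cot_lift_colin m : tens_rcoact Y (bc_r W) (cot_lift m) = tmap cot_lift (bm_id C) (r m).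
Proof.
rewrite -[cot_lift m]/(cof restr1 (r m)) cof_colin.
rewrite -[tens_rcoact _ _ _]/(associ (tmap (bm_id M) (Delta C) (r m))).
by rewrite -(proj1 (rc_coactP M)) assocK tmap_compl.
Qed.

Lemma cot_liftP : cot_map cot_lift.
Proof. by split; [exact: cot_lift_eq | exact: cot_lift_colin]. Qed.

Lemma cot_lift_counit m (b : b_ab) :
  (cof_counit phi Y (cot_lift m) : Y) >* (b : B) = f (m \ot b).
Proof.
rewrite -[cot_lift m]/(cof restr1 (r m)) cof_counit_cof (proj2 (rc_coactP M)).
rewrite -[restr1 m]/(f (m \ot (1 : b_ab))) -bmZr otZr.
by congr (f (_ \ot _)); rewrite /= mul1r.
Qed.

End Lift.

(** Together with [cot_lift_counit] this makes [cot_ext] and [cot_lift] mutually inverse. *)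
Lemma cot_extK (v : bimap M (tensor Y W)) (vP : cot_map v) m : cot_lift (cot_ext vP) m = v m.
Proof.
rewrite (cot_map_cof vP); congr (bm_fun (cof _) _).
by apply: bimap_eq => x; rewrite -[LHS]/(cot_ext vP _) cot_extE ract1.
Qed.

End Transpose.

Lemma cot_lift_comp (R : algebra k) (M M' : rcomod R C) (Y : rcomod R D)
    (f : rcomod_map (ind_rcomod phi M') Y) (g : rcomod_map M M') m :
  cot_lift (rcomod_comp f (ind_rcomod_map phi g)) m = cot_lift f (g m).
Proof.
rewrite -[LHS]/(cof _ (rc_coact M m)) -[RHS]/(cof _ (rc_coact M' (g m))) rc_mapP.
elim/ot_ind: (rc_coact M m) => [|x y ex ey|m' c]; rewrite ?addE ?ex ?ey //.
rewrite tmapE !cofE; congr (_ \ot _).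
by rewrite -[LHS]/(f (tmap g _ _)) tmapE.
Qed.

Lemma cot_lift_nat (R : algebra k) (M : rcomod R C) (Y Y' : rcomod R D)
    (f : rcomod_map (ind_rcomod phi M) Y) (g : rcomod_map Y Y') m :
  cot_lift (rcomod_comp g f) m = tmap g (bm_id W) (cot_lift f m).
Proof.
rewrite -[LHS]/(cof _ (rc_coact M m)) -[cot_lift f m]/(cof _ (rc_coact M m)).
elim/ot_ind: (rc_coact M m) => [|x y ex ey|m' c]; rewrite ?addE ?ex ?ey //.
by rewrite !cofE tmapE.
Qed.

End CotensorMaps.

Section CotensorAdjoint.
Variables (k : comPzRingType) (A B : algebra k) (C : coring A) (D : coring B).
Variables (phi : coring_hom C D) (flatC : left_flat C).
Let b_ab := B_AB phi.
Let W := BC_bicomod phi.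

Variables (H : functor (comod_cat D) (comod_cat C)).
Let Hm (Y : comod_cat D) : rcomod (base_alg k) C := H Y.
Let Ym (Y : comod_cat D) : rcomod (base_alg k) D := Y.
Variable tau : forall Y : comod_cat D, bimap (Hm Y) (tensor (Ym Y) W).
Hypothesis tau_inj : forall Y, injective (tau Y).
Hypothesis tauP : forall Y, cot_map (tau Y).
Hypothesis tau_im : forall Y t,
  tmap (rc_coact (Ym Y)) (bm_id W) t = associ (tmap (bm_id (Ym Y)) (bc_l W) t) ->
  exists z, tau Y z = t.
Hypothesis tau_nat : forall Y Y' (f : rcomod_map (Ym Y) (Ym Y')) z,
  tau Y' ((fmap H (f : @hom (comod_cat D) Y Y') : rcomod_map (Hm Y) (Hm Y')) z) =
  tmap f (bm_id W) (tau Y z).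

(** The values of [cot_lift f] lie in the cotensor product, hence in the image of [tau Y]. The
    factor is colinear because [tau Y (x) C] is still injective, [C] being flat. *)
Lemma cot_factor (M : rcomod (base_alg k) C) (Y : comod_cat D)
    (f : rcomod_map (ind_rcomod phi M) (Ym Y)) :
  exists g : rcomod_map M (Hm Y), forall m, tau Y (g m) = cot_lift f m.
Proof.
pose g0 m := projT1 (cid (tau_im (cot_lift_eq f m))).
have g0E m : tau Y (g0 m) = cot_lift f m by rewrite /g0; case: cid.
have g0P : bimod_morph g0.
  by split=> [x y|a x|x b]; apply: (@tau_inj Y); rewrite !(g0E, bmD, bmZl, bmZr).
have gc m : rc_coact (Hm Y) (Bimap g0P m) = tmap (Bimap g0P) (bm_id C) (rc_coact M m).
  apply: (flat_inj flatC (@tau_inj Y)).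
  rewrite -(proj2 (tauP Y)) -tmap_compl -[Bimap g0P m]/(g0 m) g0E cot_lift_colin.
  by congr (bm_fun (tmap _ _) _); apply: bimap_eq => x; rewrite bm_compE -g0E.
by exists (RcomodMap gc).
Qed.

Lemma cotensor_adjunction : inhabited (adjunction (induction_functor phi) H).
Proof.
have eE (M : rcomod (base_alg k) C) Y (g : rcomod_map M (Hm Y)) m (b : b_ab) :
    cot_ext (tauP Y) (tmap g (bm_id b_ab) (m \ot b)) =
    (cof_counit phi (Ym Y) (tau Y (g m)) : Ym Y) >* (b : B).
  by rewrite tmapE cot_extE.
apply: (@adjunction_of_counit _ _ (induction_functor phi) H (fun Y => cot_ext (tauP Y))).
- move=> Y Y' g; apply: rcomod_map_eq => t.
  rewrite -[LHS]/((g : rcomod_map (Ym Y) (Ym Y')) (cot_ext (tauP Y) t)).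
  rewrite -[RHS]/(cot_ext (tauP Y') (tmap (fmap H g : rcomod_map (Hm Y) (Hm Y')) (bm_id b_ab) t)).
  elim/ot_ind: t => [|u v eu ev|x b]; rewrite ?addE ?eu ?ev //.
  by rewrite eE cot_extE tau_nat cof_counit_nat bmZr.
- move=> M Y f; have [g gE] := cot_factor (f : rcomod_map (ind_rcomod phi M) (Ym Y)).
  exists (g : @hom (comod_cat C) _ _); apply: rcomod_map_eq => t.
  rewrite -[LHS]/(cot_ext (tauP Y) (tmap g (bm_id b_ab) t)).
  elim/ot_ind: t => [|u v eu ev|m b]; rewrite ?addE ?eu ?ev //.
  by rewrite eE gE cot_lift_counit.
- move=> M Y u v e; apply: rcomod_map_eq => m; apply: (@tau_inj Y).
  have K (w : rcomod_map M (Hm Y)) m' : tau Y (w m') =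
      cot_lift (rcomod_comp (cot_ext (tauP Y)) (ind_rcomod_map phi w)) m'.
    by rewrite cot_lift_comp cot_extK.
  rewrite !K; congr (bm_fun (cot_lift _) _); exact: e.
Qed.

End CotensorAdjoint.

(** * Cohom as right adjoint of induction *)

Section CohomRightAdjoint.
Variables (k : comPzRingType) (A B : algebra k) (C : coring A) (D : coring B).
Variables (phi : coring_hom C D) (flatC : left_flat C).
Let N := CB_bicomod phi.
Let W := BC_bicomod phi.
Variable h : cohom (bc_rcomod N).
Hypothesis test : coact_test N (char_mod A).
Variables (Psi : bicomod_map (hD h) W) (Psi' : bicomod_map W (hD h)).
Hypotheses (PsiK : cancel Psi Psi') (Psi'K : cancel Psi' Psi).

Section Tau.
Variable Y : rcomod (base_alg k) D.

Let tPsi : bimap (tensor Y (hD h)) (tensor Y W) := tmap (bm_id Y) Psi.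
Let tPsi' : bimap (tensor Y W) (tensor Y (hD h)) := tmap (bm_id Y) Psi'.

Definition tau : bimap (cohom_rcomod h Y) (tensor Y W) := bm_comp tPsi (sigma h Y).

Let tPsiK : cancel tPsi tPsi'.
Proof.
elim/ot_ind=> [|u v eu ev|y z]; rewrite ?addE ?eu ?ev //.
by rewrite !tmapE PsiK.
Qed.

Let tPsi'K : cancel tPsi' tPsi.
Proof.
elim/ot_ind=> [|u v eu ev|y z]; rewrite ?addE ?eu ?ev //.
by rewrite !tmapE Psi'K.
Qed.

Lemma tau_inj : injective tau.
Proof. by move=> x y /(can_inj tPsiK); exact: (sigma_inj test). Qed.

Lemma tPsi_lcoact (E E' : bicomod D C) (f : bicomod_map E E') (t : tensor Y E) :
  associ (tmap (bm_id Y) (bc_l E') (tmap (bm_id Y) f t)) =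
  tmap (bm_id (tensor Y D)) f (associ (tmap (bm_id Y) (bc_l E) t)).
Proof.
elim/ot_ind: t => [|u v eu ev|y z]; rewrite ?addE ?eu ?ev //.
rewrite !tmapE bc_mapl.
elim/ot_ind: (bc_l E z) => [|u v eu ev|d z']; rewrite ?addE ?eu ?ev //.
by rewrite !(tmapE, associE).
Qed.

Lemma tPsi_coact (E E' : bimod B A) (f : bimap E E') (t : tensor Y E) :
  tmap (rc_coact Y) (bm_id E') (tmap (bm_id Y) f t) =
  tmap (bm_id (tensor Y D)) f (tmap (rc_coact Y) (bm_id E) t).
Proof.
by elim/ot_ind: t => [|u v eu ev|y z]; rewrite ?addE ?eu ?ev // !tmapE.
Qed.

Lemma tau_cot : cot_map (phi := phi) tau.
Proof.
split=> z.
  rewrite bm_compE tPsi_coact sigma_equalized.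
  by rewrite [RHS](tPsi_lcoact Psi (sigma h Y z)).
rewrite -[rc_coact _ _]/(cohom_rcoact h Y z) tmap_compl -sigma_colin.
rewrite -[tau z]/(tPsi (sigma h Y z)).
elim/ot_ind: (sigma h Y z) => [|u v eu ev|y w]; rewrite ?addE ?eu ?ev //.
rewrite tmapE !tens_rcoactE bc_mapr.
elim/ot_ind: (bc_r (hD h) w) => [|u v eu ev|w' c]; rewrite ?addE ?eu ?ev //.
by rewrite !(tmapE, associE).
Qed.

Lemma tau_im (t : tensor Y W) :
  tmap (rc_coact Y) (bm_id W) t = associ (tmap (bm_id Y) (bc_l W) t) ->
  exists z, tau z = t.
Proof.
move=> et; have [|z zE] := sigma_im (h := h) test (Y := Y) (t := tPsi' t).
  by rewrite tPsi_coact et -tPsi_lcoact.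
by exists z; rewrite bm_compE zE tPsi'K.
Qed.

End Tau.

Lemma cohom_right_adjunction :
  inhabited (adjunction (induction_functor phi) (cohom_functor h)).
Proof.
apply: (@cotensor_adjunction _ _ _ _ _ phi flatC (cohom_functor h) (fun Y => tau Y)).
- exact: tau_inj.
- exact: tau_cot.
- exact: tau_im.
- move=> Y Y' f z.
  rewrite -[LHS]/(tmap _ _ (sigma h Y' (cohom_map h f z))) sigma_nat.
  rewrite -[tau _ z]/(tmap (bm_id _) Psi (sigma h Y z)).
  elim/ot_ind: (sigma h Y z) => [|u v eu ev|y w]; rewrite ?addE ?eu ?ev //.
  by rewrite !tmapE.
Qed.

End CohomRightAdjoint.

Lemma frobenius_of_test (k : comPzRingType) (A B : algebra k)
    (C : coring A) (D : coring B) (phi : coring_hom C D)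
    (h : cohom (bc_rcomod (CB_bicomod phi))) :
  left_flat C -> coact_test (CB_bicomod phi) (char_mod A) ->
  @isomorphic (bicomod_cat D C) (cohom_bicomod h (reg_bicomod D)) (BC_bicomod phi) ->
  frobenius_functor (induction_functor phi).
Proof.
move=> flatC test [f [g [gf fg]]].
pose f0 : bicomod_map (hD h) (BC_bicomod phi) := f.
pose g0 : bicomod_map (BC_bicomod phi) (hD h) := g.
have fK : cancel f0 g0.
  by move=> z; exact: (congr1 (fun w : bicomod_map (hD h) (hD h) => w z) gf).
have gK : cancel g0 f0.
  by move=> z; exact: (congr1 (fun w : bicomod_map (BC_bicomod phi) (BC_bicomod phi) => w z) fg).
exists (cohom_functor h); split; last exact: cohom_adjunction.
exact: cohom_right_adjunction flatC h test f0 g0 fK gK.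
Qed.

(** * From a Frobenius functor to quasi-finiteness *)

Section CofreeTensor.
Variables (k : comPzRingType) (A B : algebra k) (C : coring A) (D : coring B).
Variables (phi : coring_hom C D) (R : algebra k) (X : bimod R A).
Let N := CB_bicomod phi.
Let b_ab := B_AB phi.
Let XC : rcomod R C := tens_rcomod X (bc_rcomod (reg_bicomod C)).

(** Rebracketing identifies [X (x)_A N] with the comodule induced from the cofree comodule
    [X (x)_A C]. *)
Lemma cofree_assoc_colin (t : tensor X N) :
  ind_coact phi (rc_coact XC) (associ t : tensor XC b_ab) =
  tmap (associ : bimap (tensor X N) (tensor XC b_ab)) (bm_id D) (tens_rcoact X (bc_r N) t).
Proof.
elim/ot_ind: t => [|u v eu ev|x n]; rewrite ?addE ?eu ?ev //.
elim/ot_ind: n => [|u v eu ev|c b]; rewrite ?addE ?eu ?ev //.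
rewrite associE ind_coactE tens_rcoactE -[bc_r N _]/(ind_coact phi (Delta C) (c \ot b)) ind_coactE.
rewrite -[rc_coact XC _]/(tens_rcoact X (Delta C) (x \ot c)) tens_rcoactE.
elim/ot_ind: (Delta C c) => [|u v eu ev|c1 c2].
- by rewrite ind_aux0 !(ot0r, bm0, ind_aux0).
- by rewrite ind_auxD !(otDr, bmD, ind_auxD) eu ev.
by rewrite associE !ind_auxE associE tmapE associE.
Qed.

Definition cofree_assoc : rcomod_map (tens_rcomod X (bc_rcomod N)) (ind_rcomod phi XC) :=
  @RcomodMap _ _ _ _ (tens_rcomod X (bc_rcomod N)) (ind_rcomod phi XC) associ cofree_assoc_colin.

Definition cofree_eps : bimap XC X := bm_comp runit (tmap (bm_id X) (counit C)).

Lemma cofree_eps_ins (t : tensor X N) :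
  tmap cofree_eps (bm_id N) (ind_ins phi XC (associ t)) = t.
Proof.
elim/ot_ind: t => [|u v eu ev|x n]; rewrite ?addE ?eu ?ev //.
elim/ot_ind: n => [|u v eu ev|c b]; rewrite ?addE ?eu ?ev //.
rewrite associE ind_insE -[rc_coact XC _]/(tens_rcoact X (Delta C) (x \ot c)) tens_rcoactE.
rewrite -[in RHS](counitl c).
elim/ot_ind: (Delta C c) => [|u v eu ev|c1 c2]; rewrite ?addE ?eu ?ev //.
by rewrite associE assocE !tmapE bm_compE tmapE runitE lunitE ot_bal otZl.
Qed.

Section Colinear.
Variable M : rcomod R C.

Lemma cofree_ext_subproof (u : bimap M X) m :
  rc_coact XC (tmap u (bm_id C) (rc_coact M m)) =
  tmap (bm_comp (tmap u (bm_id C)) (rc_coact M)) (bm_id C) (rc_coact M m).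
Proof.
transitivity (tmap (tmap u (bm_id C)) (bm_id C) (tens_rcoact M (Delta C) (rc_coact M m))).
  rewrite -[LHS]/(tens_rcoact X (Delta C) _).
  elim/ot_ind: (rc_coact M m) => [|x y ex ey|m' c]; rewrite ?addE ?ex ?ey //.
  rewrite tmapE !tens_rcoactE.
  elim/ot_ind: (Delta C c) => [|x y ex ey|c1 c2]; rewrite ?addE ?ex ?ey //.
  by rewrite !(associE, tmapE).
by rewrite coact_colin -tmap_compl.
Qed.

Definition cofree_ext (u : bimap M X) : rcomod_map M XC :=
  @RcomodMap _ _ _ _ M XC (bm_comp (tmap u (bm_id C)) (rc_coact M)) (cofree_ext_subproof u).

Lemma cofree_eps_ext (u : bimap M X) m : cofree_eps (cofree_ext u m) = u m.
Proof.
rewrite -[in RHS](proj2 (rc_coactP M) m) -[cofree_ext u m]/(tmap u (bm_id C) (rc_coact M m)).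
elim/ot_ind: (rc_coact M m) => [|x y ex ey|m' c]; rewrite ?addE ?ex ?ey //.
by rewrite tmapE bm_compE !tmapE !runitE bmZr.
Qed.

Lemma cofree_ext_ins (u : bimap M X) (t : tensor M b_ab) :
  tmap (cofree_ext u) (bm_id b_ab) t = associ (tmap u (bm_id N) (ind_ins phi M t)).
Proof.
elim/ot_ind: t => [|x y ex ey|m b]; rewrite ?addE ?ex ?ey //.
rewrite tmapE ind_insE -[cofree_ext u m]/(tmap u (bm_id C) (rc_coact M m)).
elim/ot_ind: (rc_coact M m) => [|x y ex ey|m' c]; rewrite ?addE ?ex ?ey //.
by rewrite assocE !tmapE associE.
Qed.
End Colinear.
End CofreeTensor.

(** * The left adjoint of tensoring with N *)

Section FrobeniusCohom.
Variables (k : comPzRingType) (A B : algebra k) (C : coring A) (D : coring B).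
Variables (phi : coring_hom C D).
Let N := CB_bicomod phi.
Let b_ab := B_AB phi.
Let F := induction_functor phi.
Variables (G : functor (comod_cat D) (comod_cat C)).
Let Gm (Y : comod_cat D) : rcomod (base_alg k) C := G Y.
Let Ym (Y : comod_cat D) : rcomod (base_alg k) D := Y.

Definition forget_comp : functor (comod_cat D) (rmod_cat A).
Proof.
refine (@Functor (comod_cat D) (rmod_cat A) (fun Y => rc_mod (Gm Y))
  (fun Y Y' f => rc_map (fmap G f : rcomod_map (Gm Y) (Gm Y'))) _ _).
- by move=> Y; rewrite fmap1.
- by move=> Y Y' Y'' f g; rewrite fmapM.
Defined.

Section LeftAdjoint.
Variable adjR : adjunction G F.

Let eta (Y : comod_cat D) : rcomod_map (Ym Y) (ind_rcomod phi (Gm Y)) := adj_unit adjR Y.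

Definition forget_unit (Y : comod_cat D) : rcomod_map (Ym Y) (tens_rcomod (Gm Y) (bc_rcomod N)) :=
  rcomod_comp (ind_ins_map phi (Gm Y)) (eta Y).

(** This composes [G] left adjoint to [F] with the forgetful functor left adjoint to the cofree one.
    The unit is kept explicit so that the C-coaction it induces on [G Y] can be identified. *)
Lemma forget_comp_adjunction :
  exists adj : adjunction forget_comp (tensor_functor (bc_rcomod N)),
    forall Y, adj_unit adj Y = forget_unit Y.
Proof.
apply: (@adjunction_of_unit _ _ forget_comp (tensor_functor (bc_rcomod N)) forget_unit).
- move=> Y Y' f; apply: rcomod_map_eq => y.
  rewrite -[LHS]/(tmap (fmap G f : rcomod_map (Gm Y) (Gm Y')) (bm_id N) (ind_ins phi (Gm Y) (eta Y y))).
  rewrite -ind_ins_nat -[RHS]/(ind_ins phi (Gm Y') (eta Y' _)); congr (ind_ins _ _ _).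
  exact: (congr1 (fun w : rcomod_map (Ym Y) (ind_rcomod phi (Gm Y')) => w y) (adj_unit_nat adjR f)).
- move=> Y X g.
  pose g' : rcomod_map (Ym Y) (ind_rcomod phi (tens_rcomod (X : rmod A) (bc_rcomod (reg_bicomod C)))) :=
    rcomod_comp (cofree_assoc phi (X : rmod A)) (g : rcomod_map _ _).
  pose XC : comod_cat C := tens_rcomod (X : rmod A) (bc_rcomod (reg_bicomod C)).
  pose v : rcomod_map (Gm Y) XC := @transpose _ _ G F adjR Y XC g'.
  have vE y : tmap v (bm_id b_ab) (eta Y y) = cofree_assoc phi (X : rmod A) ((g : rcomod_map _ _) y).
    exact: (congr1 (fun w : rcomod_map (Ym Y) (ind_rcomod phi XC) => w y)
             (@transposeE _ _ G F adjR Y XC g')).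
  exists (bm_comp (cofree_eps C X) v : bimap (Gm Y) (X : rmod A)).
  apply: rcomod_map_eq => y.
  rewrite -[LHS]/(tmap (bm_comp (cofree_eps C X) v) (bm_id N) (ind_ins phi (Gm Y) (eta Y y))).
  rewrite tmap_compl -ind_ins_nat vE; exact: cofree_eps_ins.
- move=> Y X f f' e.
  pose f0 : bimap (Gm Y) X := f; pose f0' : bimap (Gm Y) X := f'.
  (* Linear maps are compared through their colinear extensions to the cofree comodule, where
     uniqueness for [adjR] applies. *)
  suff E : cofree_ext f0 = cofree_ext f0'.
    by apply: bimap_eq => m; rewrite -[LHS](cofree_eps_ext f0) E [LHS]cofree_eps_ext.
  apply: (@adj_uniq _ _ _ _ adjR Y (tens_rcomod (X : rmod A) (bc_rcomod (reg_bicomod C)))).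
  apply: rcomod_map_eq => y.
  rewrite -[LHS]/(tmap (cofree_ext f0) (bm_id b_ab) (eta Y y)).
  rewrite -[RHS]/(tmap (cofree_ext f0') (bm_id b_ab) (eta Y y)) !cofree_ext_ins.
  congr (associ _).
  exact: (congr1 (fun w : rcomod_map (Ym Y) (tens_rcomod (X : rmod A) (bc_rcomod N)) => w y) e).
Qed.

End LeftAdjoint.

(** As right adjoint of [F], [G] preserves monomorphisms, and these are injective maps since [C] is
    flat. So the left adjoint of [- (x)_A N] preserves monomorphisms. *)
Lemma frobenius_injector (flatC : left_flat C) :
  adjunction F G -> adjunction G F -> injector (bc_rcomod N).
Proof.
move=> adjL adjR; have [adj _] := forget_comp_adjunction adjR.
apply: (right_adjoint_injectives adj) => Y Y' f fm.
have inj : injective (fmap G f : rcomod_map (Gm Y) (Gm Y')).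
  by apply: comod_mono_inj => //; exact: right_adjoint_mono adjL _ _ _ fm.
move=> Z u v e; apply: bimap_eq => z; apply: inj.
exact: (congr1 (fun w : bimap (Z : rmod A) (Gm Y') => w z) e).
Qed.

End FrobeniusCohom.

Lemma bicomod_iso_of_bij (k : comPzRingType) (A B : algebra k) (C : coring A) (D : coring B)
    (M N : bicomod C D) (f : bicomod_map M N) (g : N -> M) :
  cancel f g -> cancel g f -> @isomorphic (bicomod_cat C D) M N.
Proof.
move=> fK gK; have fi := can_inj fK.
have gP : bimod_morph g.
  by split=> [x y|a x|x b]; apply: fi; rewrite ?(bmD, bmZl, bmZr) !gK.
pose g0 : bimap N M := Bimap gP.
have gf : bm_comp g0 f = bm_id M by apply: bimap_eq => x; rewrite /= fK.
have gl n : bc_l M (g0 n) = tmap (bm_id C) g0 (bc_l N n).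
  by rewrite -[n in RHS]gK bc_mapl -tmap_compr gf tmap_id.
have gr n : bc_r M (g0 n) = tmap g0 (bm_id D) (bc_r N n).
  by rewrite -[n in RHS]gK bc_mapr -tmap_compl gf tmap_id.
by exists f, (BicomodMap gl gr); split; apply: bicomod_map_eq => x; [exact: fK | exact: gK].
Qed.

(* The left k-action is determined by the right action. *)
Lemma rlinear_bimod_morph (k : comPzRingType) (A : algebra k) (M N : rmod A) (f : M -> N) :
  {morph f : x y / x + y} -> (forall m a, f (m >* a) = f m >* a) -> bimod_morph f.
Proof. by move=> fD fZ; split=> // l m; rewrite !bm_sym. Qed.

Lemma bc_l_colin (k : comPzRingType) (A B : algebra k) (C : coring A) (D : coring B)
    (M : bicomod C D) m :
  tens_rcoact C (bc_r M) (bc_l M m) = tmap (bc_l M) (bm_id D) (bc_r M m).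
Proof. by rewrite -[LHS]/(associ (tmap _ _ (bc_l M m))) -bc_lr assocK. Qed.

Lemma tmap_ltens (k : comPzRingType) (R A S : algebra k) (M M' : bimod R A) (N : bimod A S)
    (f : bimap M M') (t : tensor M N) : tmap f (bm_id N) t = ltens f t.
Proof. by []. Qed.

Section ForgetTensor.
Variables (k : comPzRingType) (R A B S : algebra k) (D : coring S).
Variables (X : bimod R A) (N : bimod A S) (r : bimap N (tensor N D)).

(** The two tensor products have convertible carriers, but their rebracketing maps are built over
    different left algebras and must be compared on pure tensors. *)
Lemma forget_associ (x : X) (t : tensor N D) :
  (associ (ot (M := forgetl X) (N := tensor N D) x t) : tensor (tensor X N) D) =
  associ (x \ot t).
Proof.
pose g (t : tensor N D) : tensor (tensor X N) D :=
  associ (ot (M := forgetl X) (N := tensor N D) x t).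
have gD : {morph g : u v / u + v}.
  move=> u v; rewrite /g otDr; exact: (bmD (associ (M := forgetl X))).
rewrite -[LHS]/(g t).
elim/ot_ind: t => [|u v eu ev|n d].
- by rewrite (morphD0 gD) ot0r bm0.
- by rewrite gD eu ev otDr bmD.
- by rewrite associE; exact: (associE (M := forgetl X)).
Qed.

Lemma forget_tens_rcoact (t : tensor (forgetl X) N) :
  (tens_rcoact (forgetl X) r t : tensor (tensor X N) D) = tens_rcoact X r (t : tensor X N).
Proof.
elim/ot_ind: t => [|u v eu ev|x n].
- by rewrite bm0 [RHS](bm0 (tens_rcoact X r)).
- by rewrite bmD [RHS](bmD (tens_rcoact X r)) -eu -ev.
rewrite tens_rcoactE [RHS](tens_rcoactE (X := X) r x n).
exact: forget_associ.
Qed.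
End ForgetTensor.

Section EpsL.
Variables (k : comPzRingType) (A B : algebra k) (C : coring A) (D : coring B).
Variable (W : bicomod C D).

Definition eps_l : bimap (tensor C W) W := bm_comp lunit (tmap (counit C) (bm_id W)).

Lemma eps_lE c w : eps_l (c \ot w) = counit C c *< w.
Proof. by rewrite bm_compE tmapE lunitE. Qed.

Lemma eps_l_lcoact w : eps_l (bc_l W w) = w.
Proof. exact: (proj2 (bc_lP W) w). Qed.
End EpsL.

(** * The isomorphism of cohom at D with W *)

Section FrobeniusIso.
Variables (k : comPzRingType) (A B : algebra k) (C : coring A) (D : coring B).
Variables (phi : coring_hom C D).
Let N := CB_bicomod phi.
Let W := BC_bicomod phi.
Let b_ab := B_AB phi.
Let F := induction_functor phi.
Variables (G : functor (comod_cat D) (comod_cat C)).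
Let Gm (Y : comod_cat D) : rcomod (base_alg k) C := G Y.
Let Ym (Y : comod_cat D) : rcomod (base_alg k) D := Y.
Variables (adjL : adjunction F G) (adjR : adjunction G F).
Let Gmap (Y Y' : comod_cat D) (f : rcomod_map (Ym Y) (Ym Y')) : rcomod_map (Gm Y) (Gm Y') :=
  fmap G (f : @hom (comod_cat D) Y Y').

Let kap (Y : comod_cat D) : rcomod_map (ind_rcomod phi (Gm Y)) (Ym Y) := adj_counit adjL Y.
(* In Sweedler notation z |-> kap(z_0 (x) 1) (x) 1 (x) z_1. *)
Definition gam (Y : comod_cat D) : bimap (Gm Y) (tensor (Ym Y) W) := cot_lift (kap Y).

Lemma gam_nat Y Y' (f : rcomod_map (Ym Y) (Ym Y')) z :
  gam Y' (Gmap f z) = tmap f (bm_id W) (gam Y z).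
Proof.
rewrite /gam -cot_lift_nat -cot_lift_comp; congr (bm_fun (cot_lift _) _).
exact: (esym (adj_counit_nat adjL (f : @hom (comod_cat D) Y Y'))).
Qed.

Section Lift.
Variables (M : rcomod (base_alg k) C) (Y : comod_cat D).

Definition adj_lift (f : rcomod_map (ind_rcomod phi M) (Ym Y)) : rcomod_map M (Gm Y) :=
  comp (fmap G (f : @hom (comod_cat D) (F (M : comod_cat C)) Y))
    (adj_unit adjL (M : comod_cat C)).

Lemma adj_liftE f : rcomod_comp (kap Y) (ind_rcomod_map phi (adj_lift f)) = f.
Proof. exact: (adj_transposeR adjL (x := M) (y := Y) f). Qed.

Lemma gam_adj_lift f m : gam Y (adj_lift f m) = cot_lift f m.
Proof. by rewrite -cot_lift_comp adj_liftE. Qed.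

(** [gam] determines the counit [kap], by [cot_lift_counit], and hence the transposes of [u] and
    [v]. *)
Lemma adj_lift_uniq (u v : rcomod_map M (Gm Y)) :
  (forall m, gam Y (u m) = gam Y (v m)) -> u = v.
Proof.
move=> e; apply: (adj_counit_uniq (adj := adjL) (x := M) (y := Y)).
apply: rcomod_map_eq => t.
rewrite -[LHS]/(kap Y (tmap u (bm_id b_ab) t)) -[RHS]/(kap Y (tmap v (bm_id b_ab) t)).
elim/ot_ind: t => [|x y ex ey|m b]; rewrite ?addE ?ex ?ey //.
rewrite !tmapE; rewrite -[LHS]cot_lift_counit -[RHS]cot_lift_counit.
by rewrite -[cot_lift _ (u m)]/(gam Y _) -[cot_lift _ (v m)]/(gam Y _) e.
Qed.
End Lift.

Variable adj : adjunction (forget_comp G) (tensor_functor (bc_rcomod N)).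
Hypothesis adjE : forall Y, adj_unit adj Y = forget_unit adjR Y.
Let h := Cohom adj.

Section Rcoact.
Variables (R : algebra k) (Y : rcomod R D).
Let hY := coh_bimod h Y.
Let Y0 : comod_cat D := rforget Y.

Definition frob_rcoact0 (z : coh_mod h Y0) : forgetl (tensor hY C) := rc_coact (Gm Y0) z.

Lemma frob_rcoact_subproof : bimod_morph frob_rcoact0.
Proof.
apply: rlinear_bimod_morph; first exact: (bmD (rc_coact (Gm Y0))).
exact: (bmZr (rc_coact (Gm Y0))).
Qed.

(** The coaction of [G Y] satisfies the equation defining that of cohom, because the unit is
    [ind_ins] of something and so lies in the cotensor product. *)
Lemma frob_rcoact z : cohom_rcoact h Y z = frob_rcoact0 z.
Proof.
suff E : Bimap (of_coh_subproof (cohom_rcoact h Y)) = Bimap frob_rcoact_subproof.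
  exact: (congr1 (fun w : bimap (coh_mod h Y0) (forgetl (tensor hY C)) => w z) E).
apply: coh_uniq => y.
have uE : coh_unit h Y0 y = ind_ins phi (Gm Y0) ((adj_unit adjR Y0 : rcomod_map (Ym Y0) (ind_rcomod phi (Gm Y0))) y).
  exact: (congr1 (fun w : rcomod_map (Ym Y0) (tens_rcomod (Gm Y0) (bc_rcomod N)) => w y) (adjE Y0)).
transitivity (lcoact_bimap N hY (theta h Y y)); first exact: cohom_rcoactE.
transitivity (lcoact_bimap N (Gm Y0) (coh_unit h Y0 y)); first by [].
rewrite uE ind_ins_lcoact -uE.
by [].
Qed.
End Rcoact.


Let Dr : rcomod B D := bc_rcomod (reg_bicomod D).
Let D0 : comod_cat D := rforget Dr.
Let DD0 : comod_cat D := rforget (tens_rcomod D Dr).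
Let E := cohom_bicomod h (reg_bicomod D).

Definition frob_gam (z : E) : tensor D W := gam D0 z.
(** The cotensor product of [D] with [W] is [W] itself, through the counit of [D], whose inverse is
    the left coaction. *)
Definition frob_phi0 (z : E) : W := (eps_l W) (frob_gam z).

Lemma frob_gamD : {morph frob_gam : x y / x + y}.
Proof. exact: (bmD (gam D0)). Qed.

Lemma frob_gam_Delta z : tmap (Delta D) (bm_id W) (frob_gam z) =
  associ (tmap (bm_id D) (bc_l W) (frob_gam z)).
Proof. exact: (proj1 (cot_liftP (kap D0)) z). Qed.

Lemma frob_gam_colin z : tens_rcoact D (bc_r W) (frob_gam z) =
  ltens frob_gam (rc_coact (Gm D0) z).
Proof.
rewrite -[LHS](forget_tens_rcoact (X := D)).
transitivity (tmap (gam D0) (bm_id C) (rc_coact (Gm D0) z)).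
  exact: (proj2 (cot_liftP (kap D0)) z).
have gZ (x : Gm D0) a : gam D0 (x >* a) = gam D0 x >* a by rewrite bmZr.
have gD : {morph gam D0 : x y / x + y} by exact: bmD.
transitivity (ltens (gam D0) (rc_coact (Gm D0) z)); last by [].
elim/ot_ind: (rc_coact (Gm D0) z) => [|x y ex ey|x c].
- by rewrite bm0 ltens0.
- by rewrite bmD ltensD // ex ey.
- by rewrite tmapE ltensE.
Qed.

(** By [frob_gam_Delta], [frob_gam z] lies in the cotensor product of [D] and [W]; the counit [Q] on
    the first factor [D] then gives the claim. *)
Lemma frob_phi_lcoact z : bc_l W (frob_phi0 z) = frob_gam z.
Proof.
pose Q : bimap (tensor (tensor D D) W) (tensor D W) :=
  tmap (bm_comp lunit (tmap (counit D) (bm_id D))) (bm_id W).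
transitivity (Q (tmap (Delta D) (bm_id W) (frob_gam z))); last first.
  elim/ot_ind: (frob_gam z) => [|u v eu ev|d w]; rewrite ?addE ?eu ?ev //.
  by rewrite !tmapE; congr (_ \ot _); exact: counitl.
rewrite frob_gam_Delta /frob_phi0.
elim/ot_ind: (frob_gam z) => [|u v eu ev|d w]; rewrite ?addE ?eu ?ev //.
rewrite eps_lE bmZl tmapE.
elim/ot_ind: (bc_l W w) => [|u v eu ev|d' w']; rewrite ?addE ?eu ?ev //.
by rewrite associE tmapE bm_compE tmapE lunitE otZl.
Qed.

(** [B] acts on [E] by functoriality along [lmul], so left linearity of [frob_phi] reduces to
    naturality of [gam] and this identity. *)
Lemma lmul_eps (b : B) (t : tensor (forgetl Dr) W) :
  (eps_l W) (tmap (lmul Dr b) (bm_id W) t : tensor D W) = b *< (eps_l W) (t : tensor D W).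
Proof.
move: t; apply: (tens_ext (M := forgetl Dr) (N := W)) => [x y|x y|d w].
- rewrite (bmD (tmap (lmul Dr b) (bm_id W))); exact: (bmD (eps_l W)).
- rewrite -lactDr; congr (_ *< _); exact: (bmD (eps_l W)).
rewrite -[tpure d w]/(ot (M := forgetl Dr) (N := W) d w) tmapE.
rewrite -[LHS]/((eps_l W) (ot (M := D) (N := W) (b *< (d : D)) w)).
by rewrite -[RHS]/(b *< (eps_l W) (ot (M := D) (N := W) d w)) !eps_lE bmZl -lactA.
Qed.

Lemma frob_phi_subproof : bimod_morph frob_phi0.
Proof.
split=> [x y|b z|z a].
- by rewrite /frob_phi0 frob_gamD bmD.
- rewrite /frob_phi0 -lmul_eps; congr ((eps_l W) _); exact: (gam_nat (lmul Dr b) z).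
- rewrite /frob_phi0 -bmZr; congr ((eps_l W) _); exact: (bmZr (gam D0) z a).
Qed.
Definition frob_phi : bimap E W := Bimap frob_phi_subproof.

Lemma frob_phi_colin z : bc_r W (frob_phi z) = tmap frob_phi (bm_id C) (bc_r E z).
Proof.
rewrite -[bc_r E z]/(cohom_rcoact h Dr z) frob_rcoact.
transitivity (tmap (eps_l W) (bm_id C) (tens_rcoact D (bc_r W) (frob_gam z))).
  rewrite -[frob_phi z]/((eps_l W) (frob_gam z)).
  elim/ot_ind: (frob_gam z) => [|u v eu ev|d w]; rewrite ?addE ?eu ?ev //.
  rewrite eps_lE bmZl tens_rcoactE.
  elim/ot_ind: (bc_r W w) => [|u v eu ev|w' c]; rewrite ?addE ?eu ?ev //.
  by rewrite associE tmapE eps_lE otZl.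
rewrite frob_gam_colin.
rewrite -[frob_rcoact0 z]/(rc_coact (Gm D0) z).
move: (rc_coact (Gm D0) z).
have gZ (x : Gm D0) a : gam D0 (x >* a) = gam D0 x >* a by rewrite bmZr.
have gD : {morph gam D0 : x y / x + y} by exact: bmD.
apply: (tens_ext (M := Gm D0) (N := C)) => [x y|x y|x c].
- rewrite -(bmD (tmap (eps_l W) (bm_id C))); congr (tmap _ _ _); exact: (ltensD C gD gZ).
- exact: (bmD (tmap frob_phi (bm_id C))).
rewrite -[tpure x c]/(ot (M := Gm D0) (N := C) x c) [ltens _ _](ltensE C gD gZ) tmapE.
by rewrite -[ot x c]/(ot (M := E) (N := C) x c) tmapE.
Qed.

(* (d (x) d') (x) w |-> d eps(d') (x) w *)
Definition eps_m : bimap (tensor (tensor D D) W) (tensor D W) :=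
  tmap (bm_comp runit (tmap (bm_id D) (counit D))) (bm_id W).

Lemma eps_m_Delta t : eps_m (tmap (Delta D) (bm_id W) t) = t.
Proof.
rewrite -tmap_comp -[RHS]tmap_id; congr (bm_fun (tmap _ _) _);
  apply: bimap_eq => d //; exact: counitr.
Qed.

(** The left coaction of [E] involves the inverse of [upsilon]. This counterpart of [frob_phi] on
    [h_D(N, D (x) D)] becomes [D (x) frob_phi] after [upsilon], so that naturality of [gam] along
    [Delta] can be used. *)
Definition frob_phi2 (w : coh_bimod h (tens_rcomod D Dr)) : tensor D W :=
  eps_m (gam DD0 w).

Lemma frob_phi2D : {morph frob_phi2 : x y / x + y}.
Proof.
move=> x y; rewrite /frob_phi2 -bmD; congr (eps_m _); exact: (bmD (gam DD0)).
Qed.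

Lemma tins_eps (d : D) (t : tensor (forgetl Dr) W) :
  eps_m (tmap (tins Dr d) (bm_id W) t : tensor (tensor D D) W) =
  d \ot (eps_l W) (t : tensor D W).
Proof.
move: t; apply: (tens_ext (M := forgetl Dr) (N := W)) => [x y|x y|d' w].
- rewrite (bmD (tmap (tins Dr d) (bm_id W))); exact: (bmD eps_m).
- rewrite -otDr; congr (_ \ot _); exact: (bmD (eps_l W)).
rewrite -[tpure d' w]/(ot (M := forgetl Dr) (N := W) d' w) tmapE.
rewrite -[RHS]/(d \ot (eps_l W) (ot (M := D) (N := W) d' w)) eps_lE -ot_bal.
rewrite -[LHS]/(eps_m (ot (M := tensor D D) (N := W) (d \ot d') w)).
by rewrite [LHS]tmapE bm_compE tmapE runitE.
Qed.

Lemma frob_phi2_upsilon (s : tensor D E) :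
  frob_phi2 (upsilon h D Dr s) = tmap (bm_id D) frob_phi s.
Proof.
elim/ot_ind: s => [|u v eu ev|d z].
- by rewrite !bm0; exact: morphD0 frob_phi2D.
- by rewrite !bmD frob_phi2D eu ev.
rewrite tmapE upsilonE -[RHS](tins_eps d); congr (eps_m _).
exact: (gam_nat (tins Dr d) z).
Qed.

Lemma frob_phi_lcolin z : bc_l W (frob_phi z) = tmap (bm_id D) frob_phi (bc_l E z).
Proof.
rewrite [LHS]frob_phi_lcoact -frob_phi2_upsilon.
rewrite -[bc_l E z]/(upsilon_inv h D Dr (cohom_map h (bc_l_map (reg_bicomod D)) z)).
rewrite upsilon_invK.
transitivity (eps_m (tmap (Delta D) (bm_id W) (frob_gam z))).
  by rewrite eps_m_Delta.
congr (eps_m _); exact: esym (gam_nat (rforget_map (bc_l_map (reg_bicomod D))) z).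
Qed.

Definition frob_phi_map : bicomod_map E W := BicomodMap frob_phi_lcolin frob_phi_colin.


Let Wr : rcomod (base_alg k) C := rforget (bc_rcomod W).

Definition frob_v (w : Wr) : tensor (Ym D0) W := bc_l W w.

Lemma frob_v_subproof : bimod_morph frob_v.
Proof.
apply: rlinear_bimod_morph; first exact: (bmD (bc_l W)).
exact: (bmZr (bc_l W)).
Qed.

Lemma frob_vP : cot_map (phi := phi) (Bimap frob_v_subproof).
Proof.
split=> w.
  transitivity (tmap (Delta D) (bm_id W) (bc_l W w)); first by [].
  transitivity (associ (tmap (bm_id D) (bc_l W) (bc_l W w))); last by [].
  by rewrite -(proj1 (bc_lP W)) assocK.
transitivity (tens_rcoact D (bc_r W) (bc_l W w)).
  exact: (forget_tens_rcoact (X := D) (bc_r W) (bc_l W w)).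
rewrite bc_l_colin.
rewrite tmap_ltens -[LHS]/(ltens frob_v (bc_r W w)).
rewrite -[rc_coact Wr w]/(bc_r W w).
exact: esym (tmap_ltens (Bimap frob_v_subproof) _).
Qed.


(** The inverse of [frob_phi]: the transpose of the left coaction of [W], seen as a map into the
    cotensor product of [D] and [W]. *)
Definition frob_xi : rcomod_map Wr (Gm D0) := adj_lift (cot_ext frob_vP).

Lemma gam_xi w : frob_gam (frob_xi w) = bc_l W w.
Proof.
transitivity (cot_lift (cot_ext frob_vP) w); first exact: (gam_adj_lift (Y := D0) (cot_ext frob_vP) w).
exact: (cot_extK frob_vP w).
Qed.

Lemma frob_xiK : cancel (frob_xi : W -> E) frob_phi.
Proof.
move=> w; transitivity ((eps_l W) (frob_gam (frob_xi w))); first by [].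
by rewrite gam_xi eps_l_lcoact.
Qed.

Lemma frob_phi_base_subproof : @bimod_morph _ _ _ (Gm D0) Wr frob_phi.
Proof.
apply: rlinear_bimod_morph; first exact: (bmD frob_phi).
exact: (bmZr frob_phi).
Qed.

Lemma frob_phi_base_colin z : rc_coact Wr (Bimap frob_phi_base_subproof z) =
  tmap (Bimap frob_phi_base_subproof) (bm_id C) (rc_coact (Gm D0) z).
Proof.
rewrite tmap_ltens -[LHS]/(bc_r W (frob_phi z)) frob_phi_colin tmap_ltens.
by rewrite -[bc_r E z]/(cohom_rcoact h Dr z) frob_rcoact.
Qed.

Definition frob_phi_base : rcomod_map (Gm D0) Wr := RcomodMap frob_phi_base_colin.

(** It suffices to compare after [gam], where [frob_xi] becomes the left coaction of [W] and
    [frob_phi_lcoact] applies. *)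
Lemma frob_phiK : cancel frob_phi (frob_xi : W -> E).
Proof.
move=> z0.
suff e : rcomod_comp frob_xi frob_phi_base = rcomod_id (Gm D0).
  exact: (congr1 (fun w : rcomod_map (Gm D0) (Gm D0) => w z0) e).
apply: adj_lift_uniq => z.
transitivity (frob_gam (frob_xi (frob_phi z))); first by [].
by rewrite gam_xi [LHS]frob_phi_lcoact.
Qed.

Lemma frobenius_cohom_iso : @isomorphic (bicomod_cat D C) E W.
Proof. exact: (bicomod_iso_of_bij (f := frob_phi_map) frob_phiK frob_xiK). Qed.

End FrobeniusIso.

Lemma frobenius_cohom (k : comPzRingType) (A B : algebra k)
    (C : coring A) (D : coring B) (phi : coring_hom C D) :
  left_flat C -> frobenius_functor (induction_functor phi) ->
  [/\ quasi_finite (bc_rcomod (CB_bicomod phi)),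
      injector (bc_rcomod (CB_bicomod phi))
    & exists h : cohom (bc_rcomod (CB_bicomod phi)),
        @isomorphic (bicomod_cat D C)
          (cohom_bicomod h (reg_bicomod D)) (BC_bicomod phi)].
Proof.
move=> flatC [G [[adjL] [adjR]]].
have [adj adjE] := forget_comp_adjunction adjR.
split; [exact: (inhabits (Cohom adj)) | exact: (frobenius_injector flatC adjL adjR) |].
by exists (Cohom adj); exact: (frobenius_cohom_iso adjL adjE).
Qed.

Unset Implicit Arguments.

Theorem theorem2p3p1 (k : comPzRingType) (A B : algebra k)
    (C : coring A) (D : coring B) (phi : coring_hom C D)
    (flatC : left_flat C) (flatD : left_flat D) :
  (frobenius_functor (induction_functor phi) <->
   [/\ quasi_finite (bc_rcomod (CB_bicomod phi)),
       injector (bc_rcomod (CB_bicomod phi))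
     & exists h : cohom (bc_rcomod (CB_bicomod phi)),
         @isomorphic (bicomod_cat D C)
           (cohom_bicomod h (reg_bicomod D)) (BC_bicomod phi)]) /\
  (coseparable C -> coseparable D ->
   (frobenius_functor (induction_functor phi) <->
    quasi_finite (bc_rcomod (CB_bicomod phi)) /\
    exists h : cohom (bc_rcomod (CB_bicomod phi)),
      @isomorphic (bicomod_cat D C)
        (cohom_bicomod h (reg_bicomod D)) (BC_bicomod phi))).
Proof.
split=> [|_ cosepD]; split.
- exact: frobenius_cohom.
- move=> [_ inj [h iso]]; apply: frobenius_of_test iso => //.
  exact: injector_coact_test.
- by move=> frob; have [qf _ iso] := frobenius_cohom flatC frob.
- move=> [_ [h iso]]; apply: frobenius_of_test iso => //.
  exact: coseparable_coact_test.
Qed.
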